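(* For every $t\geq0$, every $\mathbf{x}\in\mathbb{H}$ and every $f\in\mathcal{C}^\infty_c(\mathbb{H},\mathbb{R})$ (smooth compactly supported real-valued functions), $$P_t\big(|f-P_t(f)(\mathbf{x})|\big)(\mathbf{x})\leq 4C_1\sqrt{t}\,P_t(|\nabla f|)(\mathbf{x}).$$
   Context: $\mathbb{H}=\mathbb{R}^3$ is the Heisenberg group with product $(x,y,z)\bullet(x',y',z')=(x+x',y+y',z+z'+\tfrac12(xy'-yx'))$. The left-invariant vector fields are $X=\partial_x-\tfrac y2\partial_z$, $Y=\partial_y+\tfrac x2\partial_z$. Put $L=X^2+Y^2$ and $|\nabla f|=\sqrt{(Xf)^2+(Yf)^2}$. The heat semigroup $(P_t)_{t\ge0}=(e^{tL})_{t\geq 0}$ is given by $P_0=\mathrm{Id}$ and, for $t>0$, $P_tf(\mathbf{x})=\int_{\mathbb{R}^3}f(\mathbf{x}\bullet\mathbf{y})\,p_t(\mathbf{y})\,d\mathbf{y}$ ($d\mathbf y$ Lebesgue measure), where, with $r^2=x^2+y^2$, $$p_t(x,y,z)=\frac1{8\pi^2}\int_{-\infty}^{+\infty}e^{i\lambda z}\frac{\lambda}{\sinh\lambda t}\exp\!\Big(-\frac{r^2}{4}\lambda\coth(\lambda t)\Big)d\lambda .$$ $C_1$ denotes the smallest constant such that $|\nabla P_tf|\leq C_1P_t(|\nabla f|)$ pointwise for all $t\geq0$ and all smooth $f:\mathbb{H}\to\mathbb{R}$ whose partial derivatives all have polynomial growth; such a finite positive constant exists (H.-Q. Li's gradient bound).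 *)

(* Defs.v *)
From mathcomp Require Import all_boot all_order all_algebra.
From mathcomp Require Import complex.
From mathcomp Require Import all_classical all_reals all_analysis.

Set Implicit Arguments.
Unset Strict Implicit.
Unset Printing Implicit Defensive.

Import Order.TTheory GRing.Theory Num.Theory.
Import numFieldNormedType.Exports.

Local Open Scope classical_set_scope.
Local Open Scope ring_scope.

Definition sinh {R : realType} (u : R) : R := (expR u - expR (- u)) / 2.
Definition cosh {R : realType} (u : R) : R := (expR u + expR (- u)) / 2.
Definition coth {R : realType} (u : R) : R := cosh u / sinh u.

Definition expC {R : realType} (w : R[i]) : R[i] :=
  let: (a +i* b)%C := w in (expR a * cos b +i* (expR a * sin b))%C.

Definition Cintegral {d : measure_display} {T : measurableType d}
    {R : realType} (mu : {measure set T -> \bar R}) (D : set T)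
    (F : T -> R[i]) : R[i] :=
  (Rintegral mu D (fun x => complex.Re (F x))
   +i* Rintegral mu D (fun x => complex.Im (F x)))%C.

(* The carrier of the Heisenberg group is R^3, with the product topology and
   the product Borel sigma-algebra. Its norm in the library is the max norm. *)
Notation heis R := (R * R * R)%type.

Definition hmul {R : realType} (p q : heis R) : heis R :=
  let: (x, y, z) := p in let: (x', y', z') := q in
  (x + x', y + y', z + z' + 2^-1 * (x * y' - y * x')).

Notation lebesgue3 R :=
  ((@lebesgue_measure R \x @lebesgue_measure R) \x @lebesgue_measure R)%E.

Definition axis {R : realType} (i : 'I_3) : heis R :=
  ((i == 0)%:R, (i == 1)%:R, (i == 2)%:R).

Definition partial {R : realType} (i : 'I_3) (f : heis R -> R) : heis R -> R :=
  fun p => 'D_(axis i) f p.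

Definition partials {R : realType} (s : seq 'I_3) (f : heis R -> R) :
  heis R -> R := foldr partial f s.

(* Both conjuncts are needed: ['D_v f p] is a total operation, with a junk value
   when the derivative does not exist. *)
Definition smooth {R : realType} (f : heis R -> R) : Prop :=
  forall s : seq 'I_3, continuous (partials s f) /\
    forall (i : 'I_3) (p : heis R), derivable (partials s f) p (axis i).

Definition polynomial_growth {R : realType} (f : heis R -> R) : Prop :=
  exists (c : R) (k : nat), forall p : heis R, `|f p| <= c * (1 + `|p|) ^+ k.

Definition smooth_polynomial_growth {R : realType} (f : heis R -> R) : Prop :=
  smooth f /\ forall s : seq 'I_3, polynomial_growth (partials s f).

Definition smooth_compact_support {R : realType} (f : heis R -> R) : Prop :=
  smooth f /\ compact (closure [set p | f p != 0]).

Definition Xfield {R : realType} (f : heis R -> R) (p : heis R) : R :=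
  let: (x, y, z) := p in partial 0 f p - y / 2 * partial 2 f p.

Definition Yfield {R : realType} (f : heis R -> R) (p : heis R) : R :=
  let: (x, y, z) := p in partial 1 f p + x / 2 * partial 2 f p.

Definition hgrad {R : realType} (f : heis R -> R) (p : heis R) : R :=
  Num.sqrt (Xfield f p ^+ 2 + Yfield f p ^+ 2).

(* At l = 0 the integrand, which should be extended by continuity, takes an
   arbitrary value; this is a null set. The integral is real (the imaginary part
   of the integrand is odd in l), whence the real part. *)
Definition heat_kernel {R : realType} (t : R) (p : heis R) : R :=
  let: (x, y, z) := p in
  let r2 := x ^+ 2 + y ^+ 2 in
  complex.Re
    ((1 / (8 * pi ^+ 2))%:C%C *
     Cintegral (@lebesgue_measure R) setT (fun l : R =>
       expC ('i%C * (l * z)%:C%C) * (l / sinh (l * t))%:C%C *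
       expC (- (r2 / 4 * l * coth (l * t)))%:C%C)).

Definition heat {R : realType} (t : R) (f : heis R -> R) (p : heis R) : R :=
  if t == 0 then f p
  else Rintegral (lebesgue3 R) setT (fun q => f (hmul p q) * heat_kernel t q).

Definition gradient_bound {R : realType} (c : R) : Prop :=
  forall (t : R) (f : heis R -> R), 0 <= t -> smooth_polynomial_growth f ->
  forall p : heis R, hgrad (heat t f) p <= c * heat t (hgrad f) p.

Definition optimal_gradient_constant {R : realType} (c : R) : Prop :=
  gradient_bound c /\ forall c' : R, gradient_bound c' -> c <= c'.

(* Main.v *)
(** The covariance P_t(fg) - P_t f P_t g is a telescoping sum over n + 1 time steps of
    length t/n; the step at time s contributes at most
    2 (t/n) P_{t-s}(|grad P_s f| |grad P_s g|), up to o(1/n). Here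
    |grad P_s f| <= C1 P_s |grad f| by the gradient bound, and |grad P_s g| <= 1/sqrt s
    when |g| <= 1. As the integral of 1/sqrt s over [0, t] is 2 sqrt t, this gives
    P_t(fg) - P_t f P_t g <= 4 C1 sqrt t P_t |grad f|, and one takes for g a regularised
    sign of f - P_t f (x).

    The bound |grad P_t g| <= 1/sqrt t comes from an entropy comparison. Let a and q be
    independent with densities p_s and p_t, and b = a q. Gibbs' inequality compares the
    law of (a, b) with p_s(a) p_{s+t}(b) (1 + Y + Y^2/2), where Y pairs the horizontal
    part of a linearly with g(b) and with g at the quarter turn of b. The left side is
    an entropy difference, equal to 2 ln((s+t)/t) by scaling; the drift of Y is
    proportional to s |grad P_t g|; and s tends to 0.

    Of the kernel one only uses positivity (a consequence of the gradient bound for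
    concentrating Gaussians), the explicit Fourier transform in z, the Chapman-Kolmogorov
    identity, scaling and a few moments. *)

(* The constant 1 in |grad P_t g| <= 1/sqrt t is a balance of three terms. Write N for |grad P_t
   g|^2 at the identity. The drift of [Y] contributes 4 s N, the mean of Y^2/2 costs at most 2 s N,
   and the entropy difference 2 ln((s+t)/t) is at most 2 s/t; what is left is 2 s N <= 2 s/t. The 2
   in front of the logarithm is half the homogeneous dimension 4: p_t has size t^-2. The final
   constant 4 is the 2 of the carre du champ times the 2 of the integral of 1/sqrt s. Time
   derivatives of the semigroup are avoided. Neither P_s f nor the regularised sign has compact
   support, so everything is carried by a class of bounded functions with a uniform second-order
   expansion along y -> y h. The semigroup preserves this class with a controlled constant, and the
   covariance over a short step is read off from the expansion. Positivity has to come first: the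
   oscillating integral defining p_t does not show it, while Fourier inversion through Fatou, the
   moments, Tonelli and the entropy all rest on it. *)
From HB Require Import structures.
Require Import Defs.
From mathcomp Require Import all_boot all_order all_algebra.
From mathcomp Require Import complex ring lra.
From mathcomp Require Import all_classical all_reals all_analysis measurable_realfun.

Set Implicit Arguments.
Unset Strict Implicit.
Unset Printing Implicit Defensive.

Import Order.TTheory GRing.Theory Num.Theory.
Import numFieldNormedType.Exports.

Local Open Scope classical_set_scope.
Local Open Scope ring_scope.

(** * Lebesgue measure on R^3 and the Heisenberg group *)

Notation leb R := (@lebesgue_measure R).

Ltac mfun1 := lazymatch goal with
  | |- measurable_fun _ (fun x => @?f x + @?g x) => apply: (@measurable_funD _ _ _ _ f g)
  | |- measurable_fun _ (fun x => @?f x * @?g x) => apply: (@measurable_funM _ _ _ _ f g)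
  | |- measurable_fun _ (fun x => - @?f x) => apply: (@measurable_funN _ _ _ _ f)
  | |- measurable_fun _ (fun x => (@?f x) ^+ ?n) => apply: (@measurable_funX _ _ _ _ f n)
  | |- measurable_fun _ (fun x => expR (@?f x)) => apply: (measurableT_comp (@measurable_expR _) (g := f))
  | |- measurable_fun _ (fun x => cos (@?f x)) => apply: (measurableT_comp (continuous_measurable_fun (@continuous_cos _)) (g := f))
  | |- measurable_fun _ (fun x => sin (@?f x)) => apply: (measurableT_comp (continuous_measurable_fun (@continuous_sin _)) (g := f))
  | |- measurable_fun _ (fun x => `|@?f x|) => apply: (measurableT_comp (@normr_measurable _ setT) (g := f))
  | |- measurable_fun _ (fun x => (@?f x, @?g x)) => apply: (@measurable_fun_pair _ _ _ _ _ _ f g)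
  | |- measurable_fun _ (fun x => (@?f x).1) => apply: (measurableT_comp measurable_fst (g := f))
  | |- measurable_fun _ (fun x => (@?f x).2) => apply: (measurableT_comp measurable_snd (g := f))
  | |- measurable_fun _ (fun x => x) => exact: measurable_id
  | |- measurable_fun _ (fun x => ?c) => exact: measurable_cst
  end.
Ltac mfun := repeat (first [assumption | mfun1]).

Section affine.
Context {R : realType}.
Local Notation mu := (leb R).
Implicit Types (a c : R).

Let aff c a : measurableTypeR R -> measurableTypeR R := fun x => c * x + a.

Let meas_affine c a : measurable_fun setT (aff c a).
Proof. by rewrite /aff; mfun. Qed.

HB.instance Definition _ c a := isMeasurableFun.Build _ _ _ _ (aff c a) (@meas_affine c a).

(** Uniqueness of Lebesgue measure: the rescaled push-forward gives half-open intervals their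
    length. *)
Let affine_pos c a (A : set R) : 0 < c -> measurable A ->
  (c%:E * pushforward mu (aff c a) A = mu A)%E.
Proof.
move=> c0 mA.
pose nc := NngNum (ltW c0).
have -> : (c%:E * pushforward mu (aff c a) A =
  mscale nc (pushforward mu (aff c a)) A)%E by [].
apply/esym/lebesgue_measure_unique => //= _ [[u v]] _ <-.
rewrite /mscale /= /pushforward.
have -> : aff c a @^-1` `]u, v]%classic = `](u - a) / c, (v - a) / c]%classic.
  apply/seteqP; split => x /=; rewrite !in_itv /= /aff ltr_pdivrMr// ler_pdivlMr// (mulrC x) ltrBlDr lerBrDr //.
rewrite !lebesgue_measure_itv/= !lte_fin ltr_pM2r ?invr_gt0// ltrD2r.
case: ifP => _; last by rewrite mule0.
rewrite -!EFinD -EFinM; congr EFin; field; exact: lt0r_neq0.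
Qed.

Lemma ge0_integral_affine c a (f : R -> \bar R) : c != 0 ->
  measurable_fun setT f -> (forall x, 0 <= f x)%E ->
  (\int[mu]_x f (c * x + a)%R = `|c|^-1%:E * \int[mu]_x f x)%E.
Proof.
have pos c' a' (g : R -> \bar R) : 0 < c' -> measurable_fun setT g -> (forall x, 0 <= g x)%E ->
  (\int[mu]_x g (c' * x + a')%R = c'^-1%:E * \int[mu]_x g x)%E.
  move=> c0 mg g0.
  pose nc := NngNum (ltW c0).
  have m12 A : measurable A -> mu A = mscale nc (pushforward mu (aff c' a')) A.
    by move=> mA; rewrite -(affine_pos a' c0 mA).
  rewrite [in RHS](@eq_measure_integral _ _ _ setT (mscale nc (pushforward mu (aff c' a')))) //=; last by move=> A mA _; exact: m12.
  rewrite ge0_integral_mscale//. rewrite (ge0_integral_pushforward (meas_affine c' a'))//=.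
  by rewrite muleA -EFinM mulVf ?lt0r_neq0// mul1e preimage_setT.
move=> c0 mf f0; have [cp|cn|c00] := ltgtP 0 c.
- by rewrite pos // gtr0_norm.
(* A negative slope is a positive one after a reflection, which preserves Lebesgue measure. *)
- have mf' : measurable_fun setT (fun x : R => f (- x)%R).
    exact: (measurableT_comp mf (@oppr_measurable _ _)).
  rewrite ltr0_norm//.
  have -> : (\int[mu]_x f x = \int[mu]_x f (- x)%R)%E.
    rewrite (@eq_measure_integral _ _ _ _ (pushforward mu (-%R : measurableTypeR R -> measurableTypeR R))); last first.
        by move=> A mA _; apply: esym; exact: lebesgue_measureN.
    by rewrite ge0_integral_pushforward//= preimage_setT.
  rewrite -(pos (- c) (- a) (fun x : R => f (- x)%R)) ?oppr_gt0//.
  by apply: eq_integral => x _; congr f; ring.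
- by rewrite -c00 eqxx in c0.
Qed.

End affine.

Section transfer.
Context d (T : measurableType d) (R : realType) (m : {measure set T -> \bar R}).
Variables (phi : T -> T) (k : R).
Hypothesis mphi : measurable_fun setT phi.
Hypothesis k_ge0 : 0 <= k.
Hypothesis transf : forall g : T -> \bar R, measurable_fun setT g ->
  (forall x, 0 <= g x)%E -> (\int[m]_x g (phi x) = k%:E * \int[m]_x g x)%E.

(** Tonelli gives changes of variables for nonnegative functions only. Integrability passes over
    through [|f|], and the value of the integral, in [Rintegral_transfer], through positive and
    negative parts. *)
Lemma integrable_transfer (f : T -> R) : m.-integrable setT (EFin \o f) ->
  m.-integrable setT (EFin \o (f \o phi)).
Proof.
move=> /integrableP[mf fi]; apply/integrableP; split.
  exact: (measurableT_comp mf mphi).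
rewrite (transf (g := fun x => `|(EFin \o f) x|%E)) //=.
  by rewrite lte_mul_pinfty//= ge0_fin_numE// integral_ge0.
apply/measurable_EFinP; apply: measurableT_comp => //; exact/measurable_EFinP.
Qed.

Lemma Rintegral_transfer (f : T -> R) : m.-integrable setT (EFin \o f) ->
  Rintegral m setT (f \o phi) = k * Rintegral m setT f.
Proof.
move=> fi; have /integrableP[mf fi'] := fi.
rewrite /Rintegral.
have -> : (\int[m]_x ((f \o phi) x)%:E = k%:E * \int[m]_x (f x)%:E)%E.
  rewrite integralE [in RHS]integralE.
  rewrite muleBr//; last first.
    by rewrite fin_num_adde_defr// integrable_pos_fin_num.
  rewrite -!transf//; last 2 first.
  - exact: measurable_funeneg.
  - exact: measurable_funepos.
  by congr (_ - _)%E; apply: eq_integral => x _; rewrite ?funeposE ?funenegE.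
by rewrite fineM// integrable_fin_num.
Qed.

End transfer.

Section prodm.
Context d1 d2 (T1 : measurableType d1) (T2 : measurableType d2) (R : realType)
  (m1 : {sigma_finite_measure set T1 -> \bar R})
  (m2 : {sigma_finite_measure set T2 -> \bar R}).

(* The library does not make [m1 \x m2] canonically sigma-finite, which iterated
   products need. *)
Definition prodm : set (T1 * T2) -> \bar R := (m1 \x m2)%E.

HB.instance Definition _ := Measure.on prodm.

Let prodm_sigma_finite : sigma_finite setT prodm.
Proof.
have /sigma_finiteP[F [TF ndF Foo]] := sigma_finiteT m1.
have /sigma_finiteP[G [TG ndG Goo]] := sigma_finiteT m2.
exists (fun n => F n `*` G n).
  apply/esym; rewrite -subTset => -[x y] _.
  have [[n _ Fx] [k _ Gy]] : (\bigcup_n F n) x /\ (\bigcup_n G n) y.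
    by rewrite -TF -TG.
  exists (maxn n k) => //; split => /=.
  - by move/subsetPset : (ndF _ _ (leq_maxl n k)); exact.
  - by move/subsetPset : (ndG _ _ (leq_maxr n k)); exact.
move=> k; have [mF Fk] := Foo k; have [mG Gk] := Goo k.
split; first exact: measurableX.
by rewrite /prodm product_measure1E// lte_mul_pinfty// ge0_fin_numE.
Qed.

HB.instance Definition _ := Measure_isSigmaFinite.Build _ _ _ prodm prodm_sigma_finite.

End prodm.


(* [lebesgue_measure] lives on the alias [measurableTypeR R]; [mu1] is the same
   measure for the measurable structure that [heis R] takes from [R]. *)
Definition mu1 {R : realType} : set R -> \bar R := @lebesgue_measure R.
HB.instance Definition _ (R : realType) := isMeasure.Build _ R R (@mu1 R)
  (measure0 (@lebesgue_measure R)) (measure_ge0 (@lebesgue_measure R))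
  (@measure_semi_sigma_additive _ _ _ (@lebesgue_measure R)).
HB.instance Definition _ (R : realType) := Measure_isSigmaFinite.Build _ R R (@mu1 R)
  (sigma_finiteT (@lebesgue_measure R)).
Notation mu2 := (prodm mu1 mu1).
Notation mu3 := (prodm (prodm mu1 mu1) mu1).

Section three_dim.
Context {R : realType}.
Local Notation mu := (@mu1 R).

Lemma ge0_integral_mu1 (f : R -> \bar R) : measurable_fun setT f ->
  (forall x, 0 <= f x)%E -> (\int[leb R]_x f x = \int[mu]_x f x)%E.
Proof.
move=> mf f0.
pose i : measurableTypeR R -> R := id.
have mi : measurable_fun setT i by move=> _ A mA; rewrite setTI.
transitivity (\int[pushforward (leb R) i]_x f x)%E.
  by rewrite ge0_integral_pushforward//= preimage_setT.
exact: eq_measure_integral.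
Qed.

Lemma integral_mu1 (f : R -> \bar R) : measurable_fun setT f ->
  (\int[leb R]_x f x = \int[mu]_x f x)%E.
Proof.
move=> mf; rewrite integralE [RHS]integralE !ge0_integral_mu1//.
- exact: measurable_funeneg.
- exact: measurable_funepos.
Qed.

Lemma ge0_integral_aff c a (f : R -> \bar R) : c != 0 ->
  measurable_fun setT f -> (forall x, 0 <= f x)%E ->
  (\int[mu]_x f (c * x + a)%R = `|c|^-1%:E * \int[mu]_x f x)%E.
Proof.
move=> c0 mf f0; rewrite -!ge0_integral_mu1//; first exact: ge0_integral_affine.
by apply: (measurableT_comp mf (g := fun x => c * x + a)); mfun.
Qed.

Lemma ge0_integral3 (f : heis R -> \bar R) : measurable_fun setT f ->
  (forall q, 0 <= f q)%E ->
  (\int[mu3]_q f q = \int[mu]_x \int[mu]_y \int[mu]_z f (x, y, z))%E.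
Proof.
move=> mf f0.
rewrite (fubini_tonelli1 f mf f0) fubini_tonelli1//.
- exact: measurable_fun_fubini_tonelli_F.
- by move=> w; apply: integral_ge0.
Qed.

Lemma ge0_measurable_int_z (f : heis R -> \bar R) : measurable_fun setT f ->
  (forall q, 0 <= f q)%E ->
  measurable_fun setT (fun w : R * R => (\int[mu]_z f (w.1, w.2, z))%E).
Proof.
move=> mf f0.
have := @measurable_fun_fubini_tonelli_F _ _ _ _ R mu1 f mf f0.
by apply: eq_measurable_fun => -[x y] _.
Qed.

Lemma ge0_measurable_int_yz (f : heis R -> \bar R) : measurable_fun setT f ->
  (forall q, 0 <= f q)%E ->
  measurable_fun setT (fun x : R => (\int[mu]_y \int[mu]_z f (x, y, z))%E).
Proof.
move=> mf f0.
apply: (@measurable_fun_fubini_tonelli_F _ _ _ _ R mu1 (fun w : R * R => (\int[mu]_z f (w.1, w.2, z))%E)).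
  exact: ge0_measurable_int_z.
by move=> w; apply: integral_ge0.
Qed.

(** Triangular affine maps, the common form of left translations and dilations: one Tonelli
    computation, innermost variable first, gives both Jacobians. *)
Definition tri (c1 a1 c2 a2 c3 : R) (l : R * R -> R) (q : heis R) : heis R :=
  (c1 * q.1.1 + a1, c2 * q.1.2 + a2, c3 * q.2 + l q.1).

Lemma measurable_tri c1 a1 c2 a2 c3 l : measurable_fun setT l ->
  measurable_fun setT (tri c1 a1 c2 a2 c3 l).
Proof.
move=> ml; rewrite /tri; mfun; exact: (measurableT_comp ml measurable_fst).
Qed.

Lemma ge0_integral_tri c1 a1 c2 a2 c3 l (f : heis R -> \bar R) :
  c1 != 0 -> c2 != 0 -> c3 != 0 -> measurable_fun setT l ->
  measurable_fun setT f -> (forall q, 0 <= f q)%E ->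
  (\int[mu3]_q f (tri c1 a1 c2 a2 c3 l q) =
   (`|c1| * `|c2| * `|c3|)^-1%:E * \int[mu3]_q f q)%E.
Proof.
move=> c10 c20 c30 ml mf f0.
have mg : measurable_fun setT (fun q => f (tri c1 a1 c2 a2 c3 l q)).
  by apply: (measurableT_comp mf); exact: measurable_tri.
rewrite (ge0_integral3 mg (fun q => f0 _)) (ge0_integral3 mf f0).
have mfz x y : measurable_fun setT (fun z => f (x, y, z)).
  by apply: (measurableT_comp mf); exact: measurable_fun_pair.
transitivity (\int[mu]_x \int[mu]_y (`|c3|^-1%:E * \int[mu]_z f (c1 * x + a1, c2 * y + a2, z)%R))%E.
  apply: eq_integral => x _; apply: eq_integral => y _.
  exact: (ge0_integral_aff (l (x, y)) c30 (mfz (c1 * x + a1) (c2 * y + a2)) (fun z => f0 _)).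
have mfy x : measurable_fun setT (fun y => \int[mu]_z f (x, y, z))%E.
  by apply: (measurableT_comp (ge0_measurable_int_z mf f0) (g := fun y => (x, y))); exact: measurable_fun_pair.
have mfy' x : measurable_fun setT (fun y => \int[mu]_z f (x, c2 * y + a2, z)%R)%E.
  by apply: (measurableT_comp (mfy x) (g := fun y => c2 * y + a2)); mfun.
have mfx := ge0_measurable_int_yz mf f0.
have i0 x y : (0 <= \int[mu]_z f (x, y, z))%E by apply: integral_ge0.
have i1 x : (0 <= \int[mu]_y \int[mu]_z f (x, y, z))%E by apply: integral_ge0.
transitivity (\int[mu]_x ((`|c3|^-1%:E * `|c2|^-1%:E) * \int[mu]_y \int[mu]_z f (c1 * x + a1, y, z)%R))%E.
  apply: eq_integral => x _.
  apply: etrans; first apply: (ge0_integralZl _ measurableT (mfy' _) (fun y _ => i0 _ _)).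
    by rewrite lee_fin.
  by rewrite (ge0_integral_aff a2 c20 (mfy _) (i0 _)) muleA.
have mfx' : measurable_fun setT (fun x => \int[mu]_y \int[mu]_z f (c1 * x + a1, y, z)%R)%E.
  by apply: (measurableT_comp mfx (g := fun x => c1 * x + a1)); mfun.
apply: etrans; first apply: (ge0_integralZl _ measurableT mfx' (fun x _ => i1 _)).
  by rewrite -EFinM lee_fin.
rewrite (ge0_integral_aff a1 c10 mfx i1) muleA; congr (_ * _)%E.
by rewrite -!EFinM; congr EFin; rewrite !invfM; ring.
Qed.

(** Quarter turn about the vertical axis. It is a group automorphism that preserves [pk]; it makes
    odd moments vanish and provides the second half of [Y] in the entropy argument. *)
Definition rho (q : heis R) : heis R := (q.1.2, - q.1.1, q.2).

Lemma measurable_rho : measurable_fun setT rho.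
Proof. by rewrite /rho; mfun. Qed.

Lemma ge0_integral_rho (f : heis R -> \bar R) :
  measurable_fun setT f -> (forall q, 0 <= f q)%E ->
  (\int[mu3]_q f (rho q) = \int[mu3]_q f q)%E.
Proof.
move=> mf f0.
have mg : measurable_fun setT (fun q => f (rho q)).
  by apply: (measurableT_comp mf); exact: measurable_rho.
rewrite (ge0_integral3 mg (fun q => f0 _)) (ge0_integral3 mf f0) /rho /=.
have mh : measurable_fun setT (fun w : R * R => \int[mu]_z f (w.2, - w.1, z)%R)%E.
  have := ge0_measurable_int_z mf f0 => mi.
  apply: (measurableT_comp mi (g := fun w : R * R => (w.2, - w.1))).
  by apply: measurable_fun_pair; mfun.
have h0 (w : R * R) : (0 <= \int[mu]_z f (w.2, - w.1, z)%R)%E by apply: integral_ge0.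
have /= -> := @fubini_tonelli _ _ _ _ R mu mu _ mh h0.
apply: eq_integral => y _ /=.
have mk : measurable_fun setT (fun x => \int[mu]_z f (y, x, z))%E.
  by apply: (measurableT_comp (ge0_measurable_int_z mf f0) (g := fun x => (y, x))); mfun.
have k0 x : (0 <= \int[mu]_z f (y, x, z))%E by apply: integral_ge0.
have n1 : (-1 : R) != 0 by rewrite oppr_eq0 oner_eq0.
have := ge0_integral_aff 0 n1 mk k0; rewrite normrN1 invr1 mul1e => <-.
by apply: eq_integral => x _; apply: eq_integral => z _; rewrite mulN1r addr0.
Qed.

Lemma hmul_tri (p : heis R) : hmul p =
  tri 1 p.1.1 1 p.1.2 1 (fun w => p.2 + 2^-1 * (p.1.1 * w.2 - p.1.2 * w.1)).
Proof.
case: p => [[a b] c]; apply/funext => -[[x y] z] /=; rewrite /tri /=.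
by congr (_, _, _); ring.
Qed.

Lemma measurable_hmul (p : heis R) : measurable_fun setT (hmul p).
Proof. by rewrite hmul_tri; apply: measurable_tri; mfun. Qed.

Lemma ge0_integral_hmul (p : heis R) (f : heis R -> \bar R) :
  measurable_fun setT f -> (forall q, 0 <= f q)%E ->
  (\int[mu3]_q f (hmul p q) = \int[mu3]_q f q)%E.
Proof.
move=> mf f0; rewrite hmul_tri.
apply: etrans; first apply: (ge0_integral_tri _ _ _ _ _ _ mf f0); rewrite ?oner_neq0//.
  by mfun.
by rewrite normr1 !mulr1 invr1 mul1e.
Qed.

Definition dil (r : R) : heis R -> heis R := tri r 0 r 0 (r ^+ 2) (fun=> 0).

Lemma measurable_dil r : measurable_fun setT (dil r).
Proof. by apply: measurable_tri; mfun. Qed.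

(** The exponent 4 = 1 + 1 + 2 is the homogeneous dimension; it matches the factor [(t ^+ 2)^-1] of
    [pk_scale], from which the entropy inherits its [2 * ln t]. *)
Lemma ge0_integral_dil (r : R) (f : heis R -> \bar R) : 0 < r ->
  measurable_fun setT f -> (forall q, 0 <= f q)%E ->
  (\int[mu3]_q f (dil r q) = (r ^+ 4)^-1%:E * \int[mu3]_q f q)%E.
Proof.
move=> r0 mf f0.
apply: etrans; first apply: (ge0_integral_tri _ _ _ _ _ _ mf f0); rewrite ?lt0r_neq0 ?exprn_gt0//.
by rewrite !gtr0_norm// ?exprn_gt0// -expr2 -exprD.
Qed.

End three_dim.

(** * Gaussian integrals *)

Section integration_helpers.
Context d (T : measurableType d) (R : realType) (m : {measure set T -> \bar R}).
Implicit Types f g : T -> R.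

Lemma integrable_dom f g : measurable_fun setT f -> (forall x, `|f x| <= g x) ->
  m.-integrable setT (EFin \o g) -> m.-integrable setT (EFin \o f).
Proof.
move=> mf fg; apply: le_integrable => //; first exact/measurable_EFinP.
by move=> x _ /=; rewrite lee_fin (le_trans (fg x))// ler_norm.
Qed.

Lemma integrable_meas f : m.-integrable setT (EFin \o f) -> measurable_fun setT f.
Proof. by move=> /integrableP[/measurable_EFinP]. Qed.

Lemma integrable_scale k f : m.-integrable setT (EFin \o f) ->
  m.-integrable setT (EFin \o (fun x => k * f x)).
Proof. by move=> fi; have := integrableZl measurableT k fi; apply: eq_integrable. Qed.

Lemma integrable_add f g : m.-integrable setT (EFin \o f) ->
  m.-integrable setT (EFin \o g) -> m.-integrable setT (EFin \o (fun x => f x + g x)).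
Proof. by move=> fi gi; have := integrableD measurableT fi gi; apply: eq_integrable. Qed.

Lemma integrable_sub f g : m.-integrable setT (EFin \o f) ->
  m.-integrable setT (EFin \o g) -> m.-integrable setT (EFin \o (fun x => f x - g x)).
Proof. by move=> fi gi; have := integrableB measurableT fi gi; apply: eq_integrable. Qed.

Lemma ge0_integrable_EFin f c : measurable_fun setT f -> (forall x, 0 <= f x) ->
  (\int[m]_x (f x)%:E = c%:E)%E -> m.-integrable setT (EFin \o f).
Proof.
move=> mf f0 fc; apply/integrableP; split; first exact/measurable_EFinP.
by under eq_integral do rewrite /= ger0_norm//; rewrite fc ltry.
Qed.

Lemma EFin_Rintegral f : m.-integrable setT (EFin \o f) ->
  (\int[m]_x (f x)%:E = (Rintegral m setT f)%:E)%E.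
Proof. by move=> fi; rewrite /Rintegral fineK//; exact: integrable_fin_num. Qed.

End integration_helpers.

Section aff1.
Context {R : realType}.
Local Notation mu := (@mu1 R).
Variables (c a : R).
Hypothesis c0 : c != 0.

Lemma integrable_aff (f : R -> R) : mu.-integrable setT (EFin \o f) ->
  mu.-integrable setT (EFin \o (fun x => f (c * x + a))).
Proof.
apply: (@integrable_transfer _ _ _ mu (fun x => c * x + a) (`|c|^-1)); [by mfun|by rewrite invr_ge0|].
by move=> g mg g0; exact: ge0_integral_aff.
Qed.

Lemma Rintegral_aff (f : R -> R) : mu.-integrable setT (EFin \o f) ->
  Rintegral mu setT (fun x => f (c * x + a)) = `|c|^-1 * Rintegral mu setT f.
Proof.
apply: (@Rintegral_transfer _ _ _ mu (fun x => c * x + a)).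
by move=> g mg g0; exact: ge0_integral_aff.
Qed.

End aff1.

Lemma Rintegral_odd {R : realType} (f : R -> R) : mu1.-integrable setT (EFin \o f) ->
  (forall x, f (- x) = - f x) -> Rintegral mu1 setT f = 0.
Proof.
move=> fi fodd; have n1 : (-1 : R) != 0 by rewrite oppr_eq0 oner_eq0.
have := Rintegral_aff 0 n1 fi; rewrite normrN1 invr1 mul1r.
have -> : Rintegral mu1 setT (fun x : R => f (-1 * x + 0)) = (-1) * Rintegral mu1 setT f.
  by rewrite -RintegralZl//; apply: eq_Rintegral => x _; rewrite mulN1r addr0 fodd mulN1r.
lra.
Qed.

Section derivative_integral.
Context {R : realType}.
Local Notation mu := (@mu1 R).

(** The integral of [h (x + s)] does not depend on [s]; differentiating it under the integral at
    [s = 0] gives the claim. A majorant uniform in small shifts replaces limits at infinity. *)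
Lemma Rintegral_derive0 (h h' G : R -> R) :
  (forall x : R, is_derive x 1 h (h' x)) -> mu.-integrable setT (EFin \o h) ->
  mu.-integrable setT (EFin \o G) ->
  (forall s x, `|s| < 1 -> `|h' (x + s)| <= G x) ->
  Rintegral mu setT h' = 0.
Proof.
move=> dh hi Gi hG.
pose f s x := h (x + s).
have df (s x : R) : is_derive s (1 : R) (f ^~ x) (h' (x + s)).
  have -> : f ^~ x = h \o (fun s => x + s) by [].
  have e : is_derive s (1 : R) (fun s : R => x + s) 1.
    by rewrite -[X in is_derive _ _ _ X]add0r; exact: is_deriveD.
  have := dh (x + s) => d2.
  by have := is_derive1_comp d2 e; rewrite mulr1.
have fi s : mu.-integrable setT (EFin \o f s).
  have := integrable_aff s (oner_neq0 R) hi; apply: eq_integrable => // x _ /=.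
  by rewrite mul1r.
have I0 : `]-1, 1[%classic (0 : R) by rewrite /= in_itv /= ltrN10 ltr01.
have sI (s : R) : `]-1, 1[%classic s -> `|s| < 1 by rewrite /= in_itv /= => /andP[? ?]; rewrite ltr_norml; apply/andP.
have p1E s x : partial1of2 f s x = h' (x + s).
  by rewrite partial1of2E; exact: derive_val.
have G0 x : 0 <= G x.
  by have := hG 0 x; rewrite normr0 ltr01 => /(_ isT); apply: le_trans.
have Gub s x : `]-1, 1[%classic s -> setT x -> `|partial1of2 f s x| <= G x.
  by move=> Is _; rewrite p1E; apply: hG; exact: sI.
have dfx s x : `]-1, 1[%classic s -> setT x -> derivable (f ^~ x) s 1.
  by move=> _ _; have [] := df s x.
have := differentiation_under_integral measurableT I0 (fun s _ => fi s) dfx G0 Gi Gub.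
have -> : (fun x' => \int[mu]_(y in setT) f x' y) = cst (Rintegral mu setT h).
  apply/funext => s /=.
  have := Rintegral_aff s (oner_neq0 R) hi; rewrite normr1 invr1 mul1r => <-.
  by apply: eq_Rintegral => x _; rewrite mul1r.
rewrite derive1_cst => e; rewrite [RHS]e; apply: eq_Rintegral => x _.
by rewrite p1E addr0.
Qed.

End derivative_integral.

Section gaussian.
Context {R : realType}.
Local Notation mu := (@mu1 R).
Implicit Types (a k x : R).

Definition gexp a x := expR (- (a * x ^+ 2)).

Lemma gexp_ge0 a x : 0 <= gexp a x. Proof. exact: expR_ge0. Qed.

Lemma measurable_gexp a : measurable_fun setT (gexp a).
Proof. by rewrite /gexp; mfun. Qed.

Lemma integral_gexp a : 0 < a ->
  (\int[mu]_x (gexp a x)%:E = (Num.sqrt (pi / a))%:E)%E.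
Proof.
move=> a0; have s0 : 0 < Num.sqrt a by rewrite sqrtr_gt0.
have mg : measurable_fun setT (fun x : R => (gauss_fun x)%:E).
  by apply/measurable_EFinP; rewrite /gauss_fun; mfun.
have := ge0_integral_aff 0 (lt0r_neq0 s0) mg (fun x => gauss_fun_ge0 x).
rewrite -(ge0_integral_mu1 mg (fun x => gauss_fun_ge0 x)) integralT_gauss.
rewrite gtr0_norm// -EFinM => e.
have -> : (Num.sqrt (pi / a) : R) = (Num.sqrt a)^-1 * Num.sqrt pi.
  by rewrite sqrtrM ?pi_ge0// sqrtrV ?ltW// mulrC.
rewrite -e; apply: eq_integral => x _; congr (expR _)%:E.
by rewrite addr0 exprMn sqr_sqrtr ?ltW.
Qed.

Lemma integrable_gexp a : 0 < a -> mu.-integrable setT (EFin \o gexp a).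
Proof.
move=> a0; apply: (ge0_integrable_EFin (measurable_gexp a) (gexp_ge0 a)).
exact: integral_gexp.
Qed.

Lemma Rintegral_gexp a : 0 < a -> Rintegral mu setT (gexp a) = Num.sqrt (pi / a).
Proof. by move=> a0; rewrite /Rintegral integral_gexp. Qed.

(** From 1 + u/2 <= e^(u/2) with u = a x^2. A polynomial factor is paid for by halving the rate of
    the Gaussian. *)
Lemma gexp_poly2_le a x : 0 <= a -> (1 + 2 * (a * x ^+ 2)) * gexp a x <= 4 * gexp (a / 2) x.
Proof.
move=> a0; rewrite /gexp; set u := a * x ^+ 2.
have -> : a / 2 * x ^+ 2 = u / 2 by rewrite /u; field.
have e : expR (- u) = expR (- (u / 2)) * expR (- (u / 2)) by rewrite -expRD; congr expR; field.
have u0 : 0 <= u by rewrite mulr_ge0// sqr_ge0.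
rewrite e mulrA ler_wpM2r ?expR_ge0//.
rewrite expRN ler_pdivrMr ?expR_gt0//.
by have := expR_ge1Dx (u / 2); lra.
Qed.

(** (x + s)^2 exceeds x^2/2 - s^2 by (x + 2 s)^2 / 2. This provides the shift-uniform majorants for
    [Rintegral_derive0]. *)
Lemma gexp_shift_le a x s : 0 <= a -> `|s| < 1 -> gexp a (x + s) <= expR a * gexp (a / 2) x.
Proof.
move=> a0 s1; rewrite /gexp -expRD ler_expR.
have s2 : s ^+ 2 <= 1 by rewrite -(expr1n R 2) -real_normK ?num_real// lerXn2r ?nnegrE// ltW.
have h : x ^+ 2 / 2 - 1 <= (x + s) ^+ 2 by have := sqr_ge0 (x + 2 * s); nra.
have : a * (x ^+ 2 / 2 - 1) <= a * (x + s) ^+ 2 by rewrite ler_wpM2l.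
lra.
Qed.

Lemma is_derive_gexp a x : is_derive x 1 (gexp a) (- (2 * a * x) * gexp a x).
Proof.
have e : is_derive x (1 : R) (fun x : R => - (a * x ^+ 2)) (- (2 * a * x)).
  by apply: is_derive_eq; rewrite /GRing.scale /= ; ring.
by have := is_derive1_comp (is_derive_expR _) e; rewrite mulrC.
Qed.

Lemma integrable_gexp2 a : 0 < a -> mu.-integrable setT (EFin \o (fun x => x ^+ 2 * gexp a x)).
Proof.
move=> a0; have a20 : 0 < a / 2 by rewrite divr_gt0.
apply: (integrable_dom (g := fun x => 2 / a * gexp (a / 2) x)).
- by rewrite /gexp; mfun.
- move=> x; rewrite (ger0_norm (mulr_ge0 (sqr_ge0 _) (gexp_ge0 _ _))).
  have := gexp_poly2_le x (ltW a0); have := gexp_ge0 a x => g0 h.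
  rewrite -(ler_pM2l a0).
  have -> : a * (2 / a * gexp (a / 2) x) = 2 * gexp (a / 2) x by field; exact: lt0r_neq0.
  lra.
- by apply/integrable_scale/integrable_gexp.
Qed.

(** Integration by parts: x e^(-a x^2) has derivative (1 - 2 a x^2) e^(-a x^2), whose integral
    vanishes. *)
Lemma Rintegral_gexp2 a : 0 < a ->
  Rintegral mu setT (fun x => x ^+ 2 * gexp a x) = (2 * a)^-1 * Num.sqrt (pi / a).
Proof.
move=> a0.
pose h' x := (1 - 2 * a * x ^+ 2) * gexp a x.
have dh x : is_derive x (1 : R) (fun x : R => x * gexp a x) (h' x).
  have := is_derive_gexp a x => e.
  by apply: is_derive_eq; rewrite /GRing.scale /= /h'; ring.
have hi : mu.-integrable setT (EFin \o (fun x : R => x * gexp a x)).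
  apply: (integrable_dom (g := fun x => gexp a x + x ^+ 2 * gexp a x)).
  - by rewrite /gexp; mfun.
  - move=> x; rewrite normrM (ger0_norm (gexp_ge0 a x)) -{2}(mul1r (gexp a x)) -mulrDl.
    by rewrite ler_wpM2r ?gexp_ge0// ler_norml; apply/andP; split; nra.
  - by apply: integrable_add; [exact: integrable_gexp|exact: integrable_gexp2].
have a40 : 0 < a / 2 / 2 by rewrite !divr_gt0.
have Gi : mu.-integrable setT (EFin \o (fun x => 4 * expR (a / 2) * gexp (a / 2 / 2) x)).
  exact/integrable_scale/integrable_gexp.
have hG s x : `|s| < 1 -> `|h' (x + s)| <= 4 * expR (a / 2) * gexp (a / 2 / 2) x.
  move=> s1; rewrite /h' normrM (ger0_norm (gexp_ge0 a _)).
  apply: (@le_trans _ _ (4 * gexp (a / 2) (x + s))).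
    apply: le_trans (gexp_poly2_le _ (ltW a0)); rewrite ler_wpM2r ?gexp_ge0//.
    have h2 : 0 <= a * (x + s) ^+ 2 by rewrite mulr_ge0 ?sqr_ge0// ltW.
    by rewrite ler_norml; apply/andP; split; lra.
  by rewrite -mulrA ler_pM2l// gexp_shift_le// divr_ge0// ltW.
have := Rintegral_derive0 dh hi Gi hG.
rewrite (_ : h' = fun x => gexp a x - 2 * a * (x ^+ 2 * gexp a x)); last first.
  by apply/funext => x; rewrite /h'; ring.
rewrite RintegralB//; [|exact: integrable_gexp|exact/integrable_scale/integrable_gexp2].
rewrite RintegralZl//; last exact: integrable_gexp2.
rewrite Rintegral_gexp// => /eqP; rewrite subr_eq0 => /eqP ->.
by rewrite mulKf// mulf_neq0// lt0r_neq0.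
Qed.

Lemma gexp4_le a x : 0 < a -> x ^+ 4 * gexp a x <= 8 / a ^+ 2 * gexp (a / 2) x.
Proof.
move=> a0; rewrite /gexp; set u := a * x ^+ 2.
have -> : a / 2 * x ^+ 2 = u / 2 by rewrite /u; field.
have e : expR (- u) = expR (- (u / 2)) * expR (- (u / 2)) by rewrite -expRD; congr expR; field.
have u0 : 0 <= u by apply: mulr_ge0; [exact: ltW|exact: sqr_ge0].
rewrite e mulrA ler_wpM2r ?expR_ge0//.
rewrite expRN ler_pdivrMr ?expR_gt0//.
have -> : x ^+ 4 = u ^+ 2 / a ^+ 2 by rewrite /u; field; exact: lt0r_neq0.
rewrite (mulrAC 8) ler_wpM2r ?invr_ge0 ?sqr_ge0//.
have := @expR_ge1Dxn R (u / 2) 1 (divr_ge0 u0 (ler0n _ _)).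
rewrite (_ : (2`!)%:R = 2 :> R)//; lra.
Qed.

Lemma integrable_gexp4 a : 0 < a -> mu.-integrable setT (EFin \o (fun x => x ^+ 4 * gexp a x)).
Proof.
move=> a0; apply: (integrable_dom (g := fun x => 8 / a ^+ 2 * gexp (a / 2) x)).
- by rewrite /gexp; mfun.
- move=> x; rewrite ger0_norm; first exact: gexp4_le.
  by rewrite mulr_ge0 ?gexp_ge0 ?exprn_even_ge0.
- by apply/integrable_scale/integrable_gexp; rewrite divr_gt0.
Qed.

Lemma Rintegral_gexp4_le a : 0 < a ->
  Rintegral mu setT (fun x => x ^+ 4 * gexp a x) <= 16 / a ^+ 2 * Num.sqrt (pi / a).
Proof.
move=> a0; have a20 : 0 < a / 2 by rewrite divr_gt0.
apply: (@le_trans _ _ (Rintegral mu setT (fun x => 8 / a ^+ 2 * gexp (a / 2) x))).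
  apply: le_Rintegral => //; first exact: integrable_gexp4.
    by apply/integrable_scale/integrable_gexp.
  by move=> x _; exact: gexp4_le.
rewrite RintegralZl//; last exact: integrable_gexp.
rewrite Rintegral_gexp// (_ : 16 = 8 * 2 :> R); last by ring.
rewrite -!mulrA ler_pM2l// mulrCA ler_pM2l ?invr_gt0 ?exprn_gt0//.
have -> : (2 : R) = Num.sqrt 4.
  by rewrite (_ : 4 = 2 ^+ 2 :> R) ?sqrtr_sqr ?ger0_norm//; ring.
rewrite -sqrtrM// ler_wsqrtr//.
have -> : pi * (a / Num.sqrt 4)^-1 = 2 * (pi / a) :> R.
  rewrite (_ : 4 = 2 ^+ 2 :> R) ?sqrtr_sqr ?ger0_norm//; last by ring.
  by field; exact: lt0r_neq0.
by rewrite ler_wpM2r ?divr_ge0 ?pi_ge0 ?ltW//; lra.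
Qed.

Lemma integrable_gexp_cos a k : 0 < a ->
  mu.-integrable setT (EFin \o (fun x => gexp a x * cos (k * x))).
Proof.
move=> a0; apply: (integrable_dom (g := gexp a)); last exact: integrable_gexp.
- by rewrite /gexp; mfun.
- move=> x; rewrite normrM ger0_norm ?gexp_ge0// ler_piMr ?gexp_ge0//.
  exact: cos_max.
Qed.

Let J k := Rintegral mu setT (fun x => gexp 1 x * cos (k * x)).

Lemma gexp_lin_le x : `|x| * gexp 1 x <= 4 * gexp (2^-1) x.
Proof.
have := gexp_poly2_le x (@ler01 R); rewrite !mul1r; apply: le_trans.
rewrite ler_wpM2r ?gexp_ge0// ler_norml; apply/andP; split; nra.
Qed.

Let is_derive_coskx (k x : R) : is_derive k (1 : R) (fun k : R => cos (k * x)) (- (x * sin (k * x))).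
Proof.
have e : is_derive k (1 : R) (fun k : R => k * x) x.
  by apply: is_derive_eq; rewrite /GRing.scale /= ; ring.
by have := is_derive1_comp (is_derive_cos _) e; rewrite mulNr mulrC.
Qed.

Let is_derive_sinkx (k x : R) : is_derive x (1 : R) (fun x : R => sin (k * x)) (k * cos (k * x)).
Proof.
have e : is_derive x (1 : R) (fun x : R => k * x) k.
  by apply: is_derive_eq; rewrite /GRing.scale /= ; ring.
by have := is_derive1_comp (is_derive_sin _) e; rewrite mulrC.
Qed.

Let int_xsin k : mu.-integrable setT (EFin \o (fun x => x * (gexp 1 x * sin (k * x)))).
Proof.
apply: (integrable_dom (g := fun x => 4 * gexp (2^-1) x)).
- by rewrite /gexp; mfun.
- move=> x; rewrite mulrA normrM normrM (ger0_norm (gexp_ge0 _ _)).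
  apply: le_trans (gexp_lin_le x); rewrite ler_piMr ?mulr_ge0 ?gexp_ge0//.
  exact: sin_max.
- by apply/integrable_scale/integrable_gexp; rewrite invr_gt0.
Qed.

Let parts k : 2 * Rintegral mu setT (fun x => x * (gexp 1 x * sin (k * x))) = k * J k.
Proof.
pose h' x := gexp 1 x * (k * cos (k * x) - 2 * x * sin (k * x)).
have dh x : is_derive x (1 : R) (fun x : R => gexp 1 x * sin (k * x)) (h' x).
  have e1 := is_derive_gexp 1 x; have e2 := is_derive_sinkx k x.
  by apply: is_derive_eq; rewrite /GRing.scale /= /h'; ring.
have hi : mu.-integrable setT (EFin \o (fun x : R => gexp 1 x * sin (k * x))).
  apply: (integrable_dom (g := gexp 1)); last exact: integrable_gexp.
  - by rewrite /gexp; mfun.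
  - move=> x; rewrite normrM ger0_norm ?gexp_ge0// ler_piMr ?gexp_ge0//.
    exact: sin_max.
pose G x := (`|k| + 2) * (4 * (expR (2^-1) * gexp (2^-1 / 2) x)).
have Gi : mu.-integrable setT (EFin \o G).
  apply/integrable_scale/integrable_scale/integrable_scale/integrable_gexp.
  by rewrite divr_gt0.
have hG s x : `|s| < 1 -> `|h' (x + s)| <= G x.
  move=> s1; rewrite /h' normrM (ger0_norm (gexp_ge0 _ _)); set y := x + s.
  have h1 : `|k * cos (k * y) - 2 * y * sin (k * y)| <= (`|k| + 2) * (1 + 2 * (1 * y ^+ 2)).
    apply: (@le_trans _ _ (`|k| + 2 * `|y|)).
      apply: (le_trans (ler_normB _ _)); rewrite !normrM (ger0_norm (ler0n _ 2)).
      apply: lerD; first by rewrite ler_piMr// cos_max.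
      by rewrite ler_piMr ?mulr_ge0// sin_max.
    have k0 := normr_ge0 k; have y0 := normr_ge0 y; rewrite mul1r -(real_normK (num_real y)).
    have h0 : 0 <= `|k| * `|y| ^+ 2 by rewrite mulr_ge0 ?sqr_ge0.
    by have := sqr_ge0 (`|y| - 1); nra.
  apply: (@le_trans _ _ ((`|k| + 2) * ((1 + 2 * (1 * y ^+ 2)) * gexp 1 y))).
    by rewrite [leLHS]mulrC [leRHS](mulrA (`|k| + 2)) ler_wpM2r ?gexp_ge0.
  rewrite /G ler_wpM2l ?addr_ge0//.
  apply: le_trans (gexp_poly2_le y (@ler01 R)) _; rewrite mul1r ler_wpM2l//.
  by apply: gexp_shift_le; rewrite ?invr_ge0.
have := Rintegral_derive0 dh hi Gi hG.
rewrite (_ : h' = fun x => k * (gexp 1 x * cos (k * x)) - 2 * (x * (gexp 1 x * sin (k * x)))); last first.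
  by apply/funext => x; rewrite /h'; ring.
rewrite RintegralB//; last 2 first.
- exact/integrable_scale/integrable_gexp_cos.
- exact/integrable_scale/int_xsin.
rewrite !RintegralZl//; last first.
  exact: integrable_gexp_cos.
by rewrite -/(J k); lra.
Qed.

(** The linear differential equation of the Gaussian's Fourier transform: differentiation in [k]
    produces a factor x, which [parts] trades for k/2. *)
Let dJ (k : R) : is_derive k (1 : R) J (- (k / 2) * J k).
Proof.
pose f k x := gexp 1 x * cos (k * x).
have fi s : mu.-integrable setT (EFin \o f s) by apply: integrable_gexp_cos.
have df (s x : R) : is_derive s (1 : R) (f ^~ x) (- (x * (gexp 1 x * sin (s * x)))).
  have e := is_derive_coskx s x; rewrite /f.
  by apply: is_derive_eq; rewrite /GRing.scale /= ; ring.
have p1E s x : partial1of2 f s x = - (x * (gexp 1 x * sin (s * x))).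
  by rewrite partial1of2E; apply: derive_val; exact: df.
have Ik : `]k - 1, k + 1[%classic k by rewrite /= in_itv /=; apply/andP; split; lra.
pose G x : R := 4 * gexp (2^-1) x.
have G0 x : 0 <= G x by rewrite mulr_ge0// gexp_ge0.
have Gi : mu.-integrable setT (EFin \o G).
  by apply/integrable_scale/integrable_gexp; rewrite invr_gt0.
have Gub s x : `]k - 1, k + 1[%classic s -> setT x -> `|partial1of2 f s x| <= G x.
  move=> _ _; rewrite p1E normrN mulrA normrM normrM (ger0_norm (gexp_ge0 _ _)).
  apply: le_trans (gexp_lin_le x); rewrite ler_piMr ?mulr_ge0 ?gexp_ge0//.
  exact: sin_max.
have dfx s x : `]k - 1, k + 1[%classic s -> setT x -> derivable (f ^~ x) s 1.
  by move=> _ _; have [] := df s x.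
have e1 := derivable_under_integral measurableT Ik (fun s _ => fi s) dfx G0 Gi Gub.
have e2 := differentiation_under_integral measurableT Ik (fun s _ => fi s) dfx G0 Gi Gub.
apply: DeriveDef; first exact: e1.
rewrite -derive1E [LHS]e2.
rewrite (@eq_Rintegral _ _ _ _ _ (fun x => -1 * (x * (gexp 1 x * sin (k * x))))); last first.
  by move=> x _; rewrite p1E mulN1r.
rewrite RintegralZl//.
by have := parts k; lra.
Qed.

Let JE k : J k = Num.sqrt pi * expR (- (k ^+ 2 / 4)).
Proof.
(* [H] divides [J] by the expected exponential, so its derivative is zero and [J 0] fixes the
   constant. *)
pose H k := J k * expR (k ^+ 2 / 4).
have dH (x : R) : is_derive x (1 : R) H 0.
  have e : is_derive x (1 : R) (fun x : R => x ^+ 2 / 4) (x / 2).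
    by apply: is_derive_eq; rewrite /GRing.scale /= ; field.
  have e2 := is_derive1_comp (is_derive_expR _) e.
  have e3 := is_deriveM (dJ x) e2.
  by apply: is_derive_eq; rewrite /GRing.scale /= ; ring.
have := is_derive_0_is_cst k 0 dH.
rewrite /H expr0n /= mul0r expR0 mulr1.
have -> : J 0 = Num.sqrt pi.
  rewrite /J (@eq_Rintegral _ _ _ _ _ (gexp 1)) ?Rintegral_gexp ?divr1//.
  by move=> x _; rewrite mul0r cos0 mulr1.
by move=> <-; rewrite -mulrA -expRD subrr expR0 mulr1.
Qed.

Lemma Rintegral_gexp_cos a k : 0 < a ->
  Rintegral mu setT (fun x => gexp a x * cos (k * x)) =
  Num.sqrt (pi / a) * expR (- (k ^+ 2 / (4 * a))).
Proof.
move=> a0; have s0 : 0 < Num.sqrt a by rewrite sqrtr_gt0.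
have := Rintegral_aff 0 (lt0r_neq0 s0) (integrable_gexp_cos (k / Num.sqrt a) (@ltr01 R)).
rewrite gtr0_norm// -/(J _) JE.
have -> : (Num.sqrt (pi / a) : R) = (Num.sqrt a)^-1 * Num.sqrt pi.
  by rewrite sqrtrM ?pi_ge0// sqrtrV ?ltW// mulrC.
have -> : (k / Num.sqrt a) ^+ 2 / 4 = k ^+ 2 / (4 * a).
  by rewrite exprMn exprVn sqr_sqrtr ?ltW//; field; exact: lt0r_neq0.
rewrite mulrA => <-; apply: eq_Rintegral => x _; rewrite addr0 /gexp exprMn sqr_sqrtr ?ltW// mul1r.
by rewrite mulrA divfK ?lt0r_neq0.
Qed.

End gaussian.

(** * The heat kernel as a cosine integral *)

Section hyperbolic.
Context {R : realType}.
Implicit Types u v x : R.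

Lemma ge0_derive_le (f f' : R -> R) : (forall x : R, is_derive x 1 f (f' x)) ->
  (forall x, 0 <= x -> 0 <= f' x) -> forall x, 0 <= x -> f 0 <= f x.
Proof.
move=> df f'0 x x0.
have d1 (y : R) : y \in `]0, +oo[%R -> derivable f y 1.
  by move=> _; apply: (@ex_derive _ _ _ _ _ _ _ (df y)).
have d2 (y : R) : y \in `]0, +oo[%R -> 0 <= (f^`())%classic y.
  rewrite in_itv/= andbT => y0.
  by rewrite derive1E (@derive_val _ _ _ _ _ _ _ (df y)); exact/f'0/ltW.
apply: (ger0_derive1_ndecry d1 d2 _ (lexx 0) x0).
apply: continuous_subspaceT => y; apply: differentiable_continuous.
by apply/derivable1_diffP; apply: (@ex_derive _ _ _ _ _ _ _ (df y)).
Qed.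

Lemma is_derive_sinh x : is_derive x (1 : R) (@sinh R) (cosh x).
Proof.
have e : is_derive x (1 : R) (fun x : R => expR (- x)) (- expR (- x)).
  by have := is_derive1_comp (is_derive_expR (- x)) (is_deriveNid x 1); rewrite mulrN1.
rewrite /sinh; apply: is_derive_eq; rewrite /GRing.scale /= /cosh; ring.
Qed.

Lemma is_derive_cosh x : is_derive x (1 : R) (@cosh R) (sinh x).
Proof.
have e : is_derive x (1 : R) (fun x : R => expR (- x)) (- expR (- x)).
  by have := is_derive1_comp (is_derive_expR (- x)) (is_deriveNid x 1); rewrite mulrN1.
rewrite /cosh; apply: is_derive_eq; rewrite /GRing.scale /= /sinh; ring.
Qed.

Lemma sinh0 : sinh (0 : R) = 0. Proof. by rewrite /sinh oppr0 subrr mul0r. Qed.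
Lemma cosh0 : cosh (0 : R) = 1. Proof. by rewrite /cosh oppr0 expR0; field. Qed.
Lemma sinhN u : sinh (- u) = - sinh u. Proof. by rewrite /sinh opprK; ring. Qed.
Lemma coshN u : cosh (- u) = cosh u. Proof. by rewrite /cosh opprK addrC. Qed.
Lemma sinhD u v : sinh (u + v) = sinh u * cosh v + cosh u * sinh v.
Proof. by rewrite /sinh /cosh opprD !expRD; field. Qed.
Lemma coshD u v : cosh (u + v) = cosh u * cosh v + sinh u * sinh v.
Proof. by rewrite /sinh /cosh opprD !expRD; field. Qed.

Lemma cosh_ge1 u : 1 <= cosh u.
Proof.
have e v : expR v = expR (v / 2) ^+ 2 by rewrite -expRM_natl; congr expR; field.
rewrite /cosh e (e (- u)) mulNr; have := expRxMexpNx_1 (u / 2).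
by have := sqr_ge0 (expR (u / 2) - expR (- (u / 2))); nra.
Qed.

Lemma cosh_gt0 u : 0 < cosh u. Proof. exact: lt_le_trans ltr01 (cosh_ge1 u). Qed.

(** First rung of a ladder starting from [cosh_ge1]: [sinh_ge], [cosh_ge2] and [sinh_ge3] each
    integrate the preceding bound from 0. *)
Lemma sinh_ge x : 0 <= x -> x <= sinh x.
Proof.
move=> x0; rewrite -subr_ge0.
have := @ge0_derive_le (fun x => sinh x - x) (fun x => cosh x - 1) _ _ x x0.
rewrite sinh0 subrr; apply.
- by move=> y; have := is_derive_sinh y => e; apply: is_derive_eq.
- by move=> y _; rewrite subr_ge0 cosh_ge1.
Qed.

Lemma sinh_ge0 x : 0 <= x -> 0 <= sinh x.
Proof. by move=> x0; exact: le_trans x0 (sinh_ge x0). Qed.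

Lemma sinh_gt0 x : 0 < x -> 0 < sinh x.
Proof. by move=> x0; exact: lt_le_trans x0 (sinh_ge (ltW x0)). Qed.

Lemma cosh_ge2 x : 0 <= x -> 1 + x ^+ 2 / 2 <= cosh x.
Proof.
move=> x0; rewrite -subr_ge0.
have := @ge0_derive_le (fun x => cosh x - (1 + x ^+ 2 / 2)) (fun x => sinh x - x) _ _ x x0.
rewrite cosh0 expr0n /= mul0r addr0 subrr; apply.
- move=> y; have := is_derive_cosh y => e; apply: is_derive_eq.
  by rewrite /GRing.scale /=; field.
- by move=> y y0; rewrite subr_ge0 sinh_ge.
Qed.

Lemma sinh_ge3 x : 0 <= x -> x + x ^+ 3 / 6 <= sinh x.
Proof.
move=> x0; rewrite -subr_ge0.
have := @ge0_derive_le (fun x => sinh x - (x + x ^+ 3 / 6)) (fun x => cosh x - (1 + x ^+ 2 / 2)) _ _ x x0.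
rewrite sinh0 expr0n /= mul0r addr0 subrr; apply.
- move=> y; have := is_derive_sinh y => e; apply: is_derive_eq.
  by rewrite /GRing.scale /=; field.
- by move=> y y0; rewrite subr_ge0 cosh_ge2.
Qed.

Lemma sinh_le_cosh x : 0 <= x -> sinh x <= x * cosh x.
Proof.
move=> x0; rewrite -subr_ge0.
have := @ge0_derive_le (fun x => x * cosh x - sinh x) (fun x => x * sinh x) _ _ x x0.
rewrite sinh0 mul0r subrr; apply.
- move=> y; have e1 := is_derive_sinh y; have e2 := is_derive_cosh y; apply: is_derive_eq.
  by rewrite /GRing.scale /=; ring.
- by move=> y y0; rewrite mulr_ge0// sinh_ge0.
Qed.

Lemma continuous_sinh : continuous (@sinh R).
Proof.
by move=> y; apply: differentiable_continuous; apply/derivable1_diffP; have [] := is_derive_sinh y.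
Qed.

Lemma continuous_cosh : continuous (@cosh R).
Proof.
by move=> y; apply: differentiable_continuous; apply/derivable1_diffP; have [] := is_derive_cosh y.
Qed.

Lemma sinh_neq0 x : x != 0 -> sinh x != 0.
Proof.
move=> x0; have [xp|xn|xe] := ltgtP 0 x.
- by rewrite lt0r_neq0// sinh_gt0.
- by rewrite -(opprK x) sinhN oppr_eq0 lt0r_neq0// sinh_gt0// oppr_gt0.
- by rewrite xe eqxx in x0.
Qed.

End hyperbolic.

Section coefficients.
Context {R : realType}.
Implicit Types s t l : R.

(* [l / sinh (l t)] and [l coth (l t)], extended by continuity at [l = 0]. *)
Definition hA t l : R := if l == 0 then t^-1 else l / sinh (l * t).
Definition hB t l : R := hA t l * cosh (l * t).

Lemma hA_even t l : hA t (- l) = hA t l.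
Proof.
rewrite /hA oppr_eq0; case: eqP => // _.
by rewrite (mulNr l t) sinhN invrN mulrNN.
Qed.

Lemma hB_even t l : hB t (- l) = hB t l.
Proof. by rewrite /hB hA_even mulNr coshN. Qed.

Lemma hA_scale t l : 0 < t -> hA t l = t^-1 * hA 1 (l * t).
Proof.
move=> t0; rewrite /hA mulf_eq0 (gt_eqF t0) orbF; case: eqP => [_|/eqP l0].
  by rewrite invr1 mulr1.
rewrite mulr1; have := sinh_neq0 (mulf_neq0 l0 (lt0r_neq0 t0)) => s0.
by field; rewrite s0 lt0r_neq0.
Qed.

Lemma hB_scale t l : 0 < t -> hB t l = t^-1 * hB 1 (l * t).
Proof. by move=> t0; rewrite /hB (hA_scale l t0) mulr1 -mulrA. Qed.

Lemma ge0_even_ind (P : R -> Prop) : (forall l, P l -> P (- l)) -> P 0 ->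
  (forall l, 0 < l -> P l) -> forall l, P l.
Proof.
move=> PN P0 Pp l; have [lp|ln|<-//] := ltgtP 0 l; first exact: Pp.
by rewrite -(opprK l); apply: PN; apply: Pp; rewrite oppr_gt0.
Qed.

(** Taylor bounds for l > 0, then parity. The 6 is 3!, since 6 sinh l >= 6 l + l^3 >= l (1 + l^2).
    The bound by [(cosh l)^-1] squeezes [hA 1] at 0, the one with 6 gives integrability, and
    [1 <= hB 1 l] the Gaussian decay of the kernel. *)
Lemma hA1_bounds l : [/\ 0 < hA 1 l, (cosh l)^-1 <= hA 1 l, hA 1 l <= 1,
  hA 1 l <= 6 * (1 + l ^+ 2)^-1 & 1 <= hB 1 l].
Proof.
elim/ge0_even_ind: l => [l|/=|l l0].
- by rewrite hA_even hB_even coshN sqrrN.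
- rewrite /hB /hA eqxx mul0r cosh0 invr1 expr0n /= addr0 invr1 !mulr1.
  by split => //; lra.
- rewrite /hB /hA gt_eqF// mulr1.
  have s0 := sinh_gt0 l0; have h1 := sinh_ge (ltW l0); have h2 := sinh_ge3 (ltW l0).
  have h3 := sinh_le_cosh (ltW l0); have c0 := cosh_gt0 l.
  split.
  + by rewrite divr_gt0.
  + by rewrite ler_pdivlMr// mulrC ler_pdivrMr.
  + by rewrite ler_pdivrMr// mul1r.
  + rewrite ler_pdivrMr// mulrAC ler_pdivlMr; last by have := sqr_ge0 l; lra.
    by apply: (@le_trans _ _ (6 * (l + l ^+ 3 / 6))); [nra|rewrite ler_pM2l].
  + by rewrite mulrAC ler_pdivlMr// mul1r.
Qed.

Lemma hA_gt0 t l : 0 < t -> 0 < hA t l.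
Proof. by move=> t0; rewrite hA_scale// mulr_gt0 ?invr_gt0//; have [] := hA1_bounds (l * t). Qed.

Lemma hA_le t l : 0 < t -> hA t l <= t^-1.
Proof. by move=> t0; rewrite (hA_scale l t0) ler_piMr ?invr_ge0 ?(ltW t0)//; have [] := hA1_bounds (l * t). Qed.

Lemma hA_le_w t l : 0 < t -> hA t l <= t^-1 * (6 * (1 + (l * t) ^+ 2)^-1).
Proof.
by move=> t0; rewrite (hA_scale l t0) ler_wpM2l ?invr_ge0 ?(ltW t0)//; have [] := hA1_bounds (l * t).
Qed.

Lemma hB_ge t l : 0 < t -> t^-1 <= hB t l.
Proof. by move=> t0; rewrite (hB_scale l t0) ler_peMr ?invr_ge0 ?(ltW t0)//; have [] := hA1_bounds (l * t). Qed.

Lemma hB_gt0 t l : 0 < t -> 0 < hB t l.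
Proof. by move=> t0; apply: lt_le_trans (hB_ge l t0); rewrite invr_gt0. Qed.

(** The rule coth u + coth v = sinh (u + v) / (sinh u sinh v). *)
Lemma hAB_sum s t l : 0 < s -> 0 < t -> (hB s l + hB t l) * hA (s + t) l = hA s l * hA t l.
Proof.
move=> s0 t0; have st0 := addr_gt0 s0 t0; rewrite /hB /hA; case: eqP => [->|/eqP l0].
  by rewrite !mul0r cosh0; field; rewrite !lt0r_neq0.
have S0 := sinh_neq0 (mulf_neq0 l0 (lt0r_neq0 s0)).
have T0 := sinh_neq0 (mulf_neq0 l0 (lt0r_neq0 t0)).
have := sinh_neq0 (mulf_neq0 l0 (lt0r_neq0 st0)); rewrite mulrDr sinhD => U0.
by field; rewrite S0 T0 U0.
Qed.

(** The rule coth u coth v + 1 = coth (u + v) (coth u + coth v), times l^2; the continuous extension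
    keeps it true at [l = 0]. *)
Lemma hB_add s t l : 0 < s -> 0 < t ->
  hB s l * hB t l + l ^+ 2 = hB (s + t) l * (hB s l + hB t l).
Proof.
move=> s0 t0; have st0 := addr_gt0 s0 t0; rewrite /hB /hA; case: eqP => [->|/eqP l0].
  by rewrite !mul0r cosh0 expr0n /=; field; rewrite !lt0r_neq0.
have S0 := sinh_neq0 (mulf_neq0 l0 (lt0r_neq0 s0)).
have T0 := sinh_neq0 (mulf_neq0 l0 (lt0r_neq0 t0)).
have := sinh_neq0 (mulf_neq0 l0 (lt0r_neq0 st0)); rewrite mulrDr sinhD coshD => U0.
by field; rewrite S0 T0 U0.
Qed.

Lemma continuous_hA1 : continuous (hA 1 : R -> R).
Proof.
move=> l; have [->|l0] := eqVneq l 0.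
  rewrite /continuous_at {2}/hA eqxx invr1.
  have c : (cosh x)^-1 @[x --> (0 : R)] --> (cosh (0 : R))^-1.
    by apply: cvgV; [rewrite cosh0 oner_neq0|exact: continuous_cosh].
  rewrite cosh0 invr1 in c.
  apply: (@squeeze_cvgr _ _ _ _ (fun x => (cosh x)^-1) (cst 1)).
  - by near=> x; have [_ -> ->] := hA1_bounds x.
  - exact: c.
  - exact: cvg_cst.
have : (fun l : R => l / sinh l) x @[x --> l] --> l / sinh l.
  apply: cvgM; first exact: cvg_id.
  by apply: cvgV; [exact: sinh_neq0|exact: continuous_sinh].
rewrite /continuous_at {2}/hA (negbTE l0) mulr1; apply: cvg_trans.
apply: near_eq_cvg; near=> x; rewrite /hA mulr1.
suff /negbTE -> : x != 0 by [].
near: x; apply/nbhs_ballP; exists `|l|; first by rewrite /= normr_gt0.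
by move=> x; rewrite /ball /= => h; apply/eqP => x0; move: h; rewrite x0 subr0 ltxx.
Unshelve. all: by end_near. Qed.

Lemma continuous_hA t : 0 < t -> continuous (hA t : R -> R).
Proof.
move=> t0; have -> : hA t = (fun l => t^-1 * hA 1 (l * t)) by apply/funext => l; rewrite hA_scale.
move=> l; apply: cvgM; first exact: cvg_cst.
apply: (@continuous_comp _ _ _ (fun x : R => x * t) (hA 1)); last exact: continuous_hA1.
exact: mulrr_continuous.
Qed.

Lemma continuous_hB t : 0 < t -> continuous (hB t : R -> R).
Proof.
move=> t0 l; apply: cvgM; first exact: continuous_hA.
apply: (@continuous_comp _ _ _ (fun x : R => x * t) (@cosh R)); last exact: continuous_cosh.
exact: mulrr_continuous.
Qed.

Lemma measurable_hA t : 0 < t -> measurable_fun setT (hA t : R -> R).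
Proof. by move=> t0; apply: continuous_measurable_fun; exact: continuous_hA. Qed.

Lemma measurable_hB t : 0 < t -> measurable_fun setT (hB t : R -> R).
Proof. by move=> t0; apply: continuous_measurable_fun; exact: continuous_hB. Qed.

(** Cauchy weight: it dominates [hA] up to scaling and, being positive with a slowly growing
    logarithm, serves again in [w3] for the entropy estimates. *)
Definition w1 (x : R) := (1 + x ^+ 2)^-1.

Lemma w1_gt0 x : 0 < w1 x.
Proof. by rewrite invr_gt0; have := sqr_ge0 x; lra. Qed.

Lemma measurable_w1 : measurable_fun setT w1.
Proof. by apply: continuous_measurable_fun; exact: continuous_oneDsqrV. Qed.

Lemma integral_w1 : (\int[mu1]_x (w1 x)%:E = (pi : R)%:E)%E.
Proof.
have w0 x : (0 <= (w1 x)%:E)%E by rewrite lee_fin ltW// w1_gt0.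
have mw : measurable_fun setT (fun x : R => (w1 x)%:E) by apply/measurable_EFinP; exact: measurable_w1.
rewrite -(ge0_integral_mu1 mw w0).
rewrite ge0_symfun_integralT; first last.
- by move=> x; rewrite /w1 /= sqrrN.
- exact: continuous_oneDsqrV.
- by move=> x; rewrite ltW// w1_gt0.
have := @integral0y_oneDsqr R; rewrite /oneDsqr set_itvcy => ->.
by rewrite -EFinM; congr EFin; field.
Qed.

Lemma integrable_w1 : mu1.-integrable setT (EFin \o w1).
Proof.
apply: (ge0_integrable_EFin measurable_w1 _ integral_w1).
by move=> x; rewrite ltW// w1_gt0.
Qed.

Lemma integrable_hA t : 0 < t -> mu1.-integrable setT (EFin \o (hA t : R -> R)).
Proof.
move=> t0; apply: (integrable_dom (g := fun l => t^-1 * (6 * w1 (t * l + 0)))).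
- exact: measurable_hA.
- by move=> l; rewrite (ger0_norm (ltW (hA_gt0 l t0))) addr0 (mulrC t); exact: hA_le_w.
- apply/integrable_scale/integrable_scale; apply: integrable_aff; first exact: lt0r_neq0.
  exact: integrable_w1.
Qed.

End coefficients.

Section Rintegral_limits.
Context d (T : measurableType d) (R : realType) (m : {measure set T -> \bar R}).

Lemma Rintegral_dominated (f_ : nat -> T -> R) (f g : T -> R) :
  (forall n, measurable_fun setT (f_ n)) ->
  (forall x, f_ n x @[n --> \oo] --> f x) ->
  (forall n x, `|f_ n x| <= g x) -> m.-integrable setT (EFin \o g) ->
  Rintegral m setT (f_ n) @[n --> \oo] --> Rintegral m setT f.
Proof.
move=> mf ff fg gi.
have mff : measurable_fun setT f by apply: measurable_fun_cvg mf _ => x _; exact: ff.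
have fi : m.-integrable setT (EFin \o f).
  apply: integrable_dom gi => // x.
  have : `|f_ n x| @[n --> \oo] --> `|f x| by apply: cvg_norm; exact: ff.
  by move/cvgr_to_le; apply; near=> n; exact: fg.
have ffE : {ae m, forall x, setT x -> (f_ n x)%:E @[n --> \oo] --> (f x)%:E}.
  by apply: aeW => x _; apply: cvg_EFin; [exact: nearW|exact: ff].
have fgE : {ae m, forall x n, setT x -> (`|(f_ n x)%:E| <= (EFin \o g) x)%E}.
  by apply: aeW => x n _; rewrite lee_fin; exact: fg.
have mfE n : measurable_fun setT (fun x => (f_ n x)%:E) by exact/measurable_EFinP.
have mfE' : measurable_fun setT (fun x => (f x)%:E) by exact/measurable_EFinP.
have [_ _ h] := @dominated_convergence _ _ _ m setT measurableT
  (fun n x => (f_ n x)%:E) (fun x => (f x)%:E) (EFin \o g) mfE mfE' ffE gi fgE.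
apply: fine_cvg; rewrite EFin_Rintegral// in h.
Unshelve. all: by end_near. Qed.

End Rintegral_limits.

Section kernel.
Context {R : realType}.
Implicit Types s t l r : R.
Local Notation mu := (@mu1 R).

(** As a function of [l], 4 pi times the Fourier transform of the kernel in the vertical variable
    (see [pk_fourier]); [r] is the squared horizontal radius. *)
Definition hK t r l : R := hA t l * expR (- (r / 4 * hB t l)).

Definition cpi : R := (8 * pi ^+ 2)^-1.

Definition pk t (q : heis R) : R :=
  cpi * Rintegral mu setT (fun l => cos (l * q.2) * hK t (q.1.1 ^+ 2 + q.1.2 ^+ 2) l).

Lemma cpi_gt0 : 0 < cpi.
Proof. by rewrite invr_gt0 mulr_gt0// exprn_gt0// pi_gt0. Qed.

Lemma hK_even t r l : hK t r (- l) = hK t r l.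
Proof. by rewrite /hK hA_even hB_even. Qed.

Lemma hK_gt0 t r l : 0 < t -> 0 < hK t r l.
Proof. by move=> t0; rewrite mulr_gt0 ?hA_gt0 ?expR_gt0. Qed.

Lemma hK_le t r l : 0 < t -> 0 <= r -> hK t r l <= expR (- (r / (4 * t))) * hA t l.
Proof.
move=> t0 r0; rewrite /hK mulrC ler_pM2r ?hA_gt0// ler_expR lerN2.
have -> : r / (4 * t) = r / 4 * t^-1 by field; exact: lt0r_neq0.
by rewrite ler_wpM2l ?divr_ge0// hB_ge.
Qed.

Lemma hK_le_hA t r l : 0 < t -> 0 <= r -> hK t r l <= hA t l.
Proof.
move=> t0 r0; apply: le_trans (hK_le l t0 r0) _; apply: (ler_piMl (ltW (hA_gt0 l t0))).
by rewrite expR_le1 oppr_le0 divr_ge0// mulr_ge0// ltW.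
Qed.

Lemma continuous_hK t r : 0 < t -> continuous (hK t r : R -> R).
Proof.
move=> t0 l; apply: cvgM; first exact: continuous_hA.
apply: (@continuous_comp _ _ _ (fun l => - (r / 4 * hB t l)) (@expR R)); last exact: continuous_expR.
by apply: cvgN; apply: cvgM; [exact: cvg_cst|exact: continuous_hB].
Qed.

Lemma measurable_hK t r : 0 < t -> measurable_fun setT (hK t r : R -> R).
Proof. by move=> t0; apply: continuous_measurable_fun; exact: continuous_hK. Qed.

Lemma integrable_hK t r : 0 < t -> 0 <= r -> mu.-integrable setT (EFin \o hK t r).
Proof.
move=> t0 r0; apply: (integrable_dom (g := hA t)); [exact: measurable_hK| |exact: integrable_hA].
by move=> l; rewrite (ger0_norm (ltW (hK_gt0 r l t0))) hK_le_hA.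
Qed.

Lemma integrable_cos_hK t r z : 0 < t -> 0 <= r ->
  mu.-integrable setT (EFin \o (fun l => cos (l * z) * hK t r l)).
Proof.
move=> t0 r0; have mk := measurable_hK r t0.
apply: (integrable_dom (g := hK t r)); [by mfun| |exact: integrable_hK].
move=> l; rewrite normrM (ger0_norm (ltW (hK_gt0 r l t0))).
by apply: (ler_piMl (ltW (hK_gt0 r l t0))); exact: cos_max.
Qed.

Lemma r2_ge0 (q : heis R) : 0 <= q.1.1 ^+ 2 + q.1.2 ^+ 2.
Proof. by rewrite addr_ge0 ?sqr_ge0. Qed.

Definition cA t : R := cpi * Rintegral mu setT (hA t).

Lemma pk_bound t q : 0 < t ->
  `|pk t q| <= cA t * expR (- ((q.1.1 ^+ 2 + q.1.2 ^+ 2) / (4 * t))).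
Proof.
move=> t0; have r0 := r2_ge0 q; rewrite /pk normrM (gtr0_norm cpi_gt0) /cA -mulrA.
rewrite (ler_pM2l cpi_gt0).
apply: (le_trans (le_normr_Rintegral measurableT (integrable_cos_hK q.2 t0 r0))).
rewrite mulrC -RintegralZl//; last exact: integrable_hA.
apply: le_Rintegral => //.
- exact: (integrable_norm (integrable_cos_hK q.2 t0 r0)).
- exact/integrable_scale/integrable_hA.
- move=> l _; rewrite normrM (ger0_norm (ltW (hK_gt0 _ l t0))).
  apply: le_trans (hK_le l t0 r0); rewrite ler_piMl ?cos_max//.
  exact: ltW (hK_gt0 _ l t0).
Qed.

Lemma cA_ge0 t : 0 < t -> 0 <= cA t.
Proof.
move=> t0; rewrite mulr_ge0 ?(ltW cpi_gt0)//; apply: Rintegral_ge0 => l _.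
exact: ltW (hA_gt0 l t0).
Qed.

Lemma pk_le t q : 0 < t -> `|pk t q| <= cA t.
Proof.
move=> t0; apply: le_trans (pk_bound q t0) _; rewrite ler_piMr ?cA_ge0//.
by rewrite expR_le1 oppr_le0 divr_ge0 ?r2_ge0// mulr_ge0// ltW.
Qed.

Lemma measurable_hK_joint t : 0 < t ->
  measurable_fun setT (fun w : R * R => hK t w.1 w.2).
Proof.
move=> t0; have mA := measurable_hA t0; have mB := measurable_hB t0.
have mA2 : measurable_fun setT (fun w : R * R => hA t w.2) by exact: (measurableT_comp mA measurable_snd).
have mB2 : measurable_fun setT (fun w : R * R => hB t w.2) by exact: (measurableT_comp mB measurable_snd).
by rewrite /hK; mfun.
Qed.

Lemma measurable_pk t : 0 < t -> measurable_fun setT (pk t).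
Proof.
move=> t0; rewrite /pk.
apply: measurable_funM; first exact: measurable_cst.
pose h (w : heis R * R) := hK t (w.1.1.1 ^+ 2 + w.1.1.2 ^+ 2) w.2.
have mh : measurable_fun setT h.
  apply: (measurableT_comp (measurable_hK_joint t0) (g := fun w : heis R * R => (w.1.1.1 ^+ 2 + w.1.1.2 ^+ 2, w.2))).
  by mfun.
(* Measurability of partial integrals is available for nonnegative integrands: 1 + cos is used in
   place of cos, and the integral of [h] is subtracted afterwards. *)
pose g1 (w : heis R * R) := (1 + cos (w.2 * w.1.2)) * h w.
have mg1 : measurable_fun setT g1 by rewrite /g1; mfun.
have h0 w : (0 <= (h w)%:E)%E by rewrite lee_fin ltW// hK_gt0.
have g10 w : (0 <= (g1 w)%:E)%E.
  rewrite lee_fin; apply: mulr_ge0; last exact: ltW (hK_gt0 _ _ t0).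
  by have := cos_geN1 (w.2 * w.1.2); lra.
have mf1 := @measurable_fun_fubini_tonelli_F _ _ _ _ R mu (EFin \o g1) (iffRL (measurable_EFinP _ _) mg1) g10.
have mf2 := @measurable_fun_fubini_tonelli_F _ _ _ _ R mu (EFin \o h) (iffRL (measurable_EFinP _ _) mh) h0.
have fm := @fine_measurable R setT measurableT.
have m1 := measurableT_comp fm mf1; have m2 := measurableT_comp fm mf2.
have := measurable_funB m1 m2; apply: eq_measurable_fun => q _ /=.
have r0 := r2_ge0 q; rewrite /fubini_F /=.
rewrite -/(Rintegral mu setT (fun l => g1 (q, l))) -/(Rintegral mu setT (fun l => h (q, l))).
have -> : (fun l => g1 (q, l)) = fun l => hK t (q.1.1 ^+ 2 + q.1.2 ^+ 2) l + cos (l * q.2) * hK t (q.1.1 ^+ 2 + q.1.2 ^+ 2) l.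
  by apply/funext => l; rewrite /g1 /h /= mulrDl mul1r.
rewrite RintegralD//; last 2 first.
- exact: integrable_hK.
- exact: integrable_cos_hK.
by rewrite /h /= addrC addKr.
Qed.

Lemma pk_cvg t (q_ : nat -> heis R) (q : heis R) : 0 < t ->
  (q_ n).1.1 @[n --> \oo] --> q.1.1 -> (q_ n).1.2 @[n --> \oo] --> q.1.2 ->
  (q_ n).2 @[n --> \oo] --> q.2 -> pk t (q_ n) @[n --> \oo] --> pk t q.
Proof.
move=> t0 c1 c2 c3; rewrite /pk; apply: cvgM; first exact: cvg_cst.
apply: (Rintegral_dominated (g := hA t)); last exact: integrable_hA.
- by move=> n; have mk := measurable_hK ((q_ n).1.1 ^+ 2 + (q_ n).1.2 ^+ 2) t0; mfun.
- move=> l; apply: cvgM.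
    have h : l * (q_ n).2 @[n --> \oo] --> l * q.2 by apply: cvgM => //; exact: cvg_cst.
    exact: (cvg_comp _ _ h (@continuous_cos R _)).
  apply: cvgM; first exact: cvg_cst.
  have h : - (((q_ n).1.1 ^+ 2 + (q_ n).1.2 ^+ 2) / 4 * hB t l) @[n --> \oo] -->
      - ((q.1.1 ^+ 2 + q.1.2 ^+ 2) / 4 * hB t l).
    apply: cvgN; apply: cvgM; last exact: cvg_cst.
    apply: cvgM; last exact: cvg_cst.
    by apply: cvgD; rewrite expr2; under eq_fun do rewrite expr2; apply: cvgM.
  exact: (cvg_comp _ _ h (@continuous_expR R _)).
- move=> n l; rewrite normrM (ger0_norm (ltW (hK_gt0 _ l t0))).
  apply: le_trans (hK_le_hA l t0 (r2_ge0 (q_ n))); rewrite ler_piMl ?cos_max//.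
  exact: ltW (hK_gt0 _ l t0).
Qed.

Lemma hA_set1 t l : l != 0 -> hA t l = l / sinh (l * t).
Proof. by move=> /negbTE l0; rewrite /hA l0. Qed.

Lemma heat_kernelE t q : 0 < t -> heat_kernel t q = pk t q.
Proof.
move=> t0; case: q => [[x y] z]; rewrite /heat_kernel /pk /= [X in _ - X]mul0r subr0 div1r.
congr (_ * _).
set r := x ^+ 2 + y ^+ 2.
pose g l := cos (l * z) * hK t r l.
have mk := measurable_hK r t0.
have mg : measurable_fun setT g by rewrite /g; mfun.
rewrite /Rintegral -(integral_mu1 (f := EFin \o g)); last exact/measurable_EFinP.
have mg1 : measurable_fun (setT `\ (0 : R)) (fun l => (g l)%:E).
  by apply: measurable_funTS; exact/measurable_EFinP.
have mD : measurable (setT `\ (0 : R)) by apply: measurableD.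
(* At [l = 0] the integrand of [heat_kernel] evaluates to 0 but [g] does not; deleting this null
   point from the integral of [g] reconciles them. *)
rewrite -(integral_setD1 mD mg1) [in RHS]integral_mkcond.
congr fine; apply: eq_integral => l _; rewrite patchE.
have [->|l0] := eqVneq l 0.
  rewrite ifF; last by apply/negP => /set_mem [_]; apply.
  by rewrite !mul0r /=; rewrite !(mulr0, mul0r, subr0, addr0, oppr0, subrr, mulrN, mulNr).
rewrite ifT; last by apply/mem_set; split => //; exact/eqP.
rewrite /g /= /hK /hB (hA_set1 t l0) /coth /=.
congr EFin; rewrite !(mulr0, mul0r, mul1r, mulr1, subr0, addr0, add0r, sub0r, oppr0) expR0 cos0 sin0.
rewrite !(mulr0, mul0r, mul1r, mulr1, subr0, addr0, add0r, sub0r, oppr0).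
rewrite -mulrA; congr (_ * (_ * expR (- _))); ring.
Qed.

End kernel.

(** * Positivity of the heat kernel *)

Section interface.
Context {R : realType}.
Local Notation mu := (@mu1 R).

Lemma ge0_integral_lebesgue3 (f : heis R -> \bar R) : measurable_fun setT f ->
  (forall q, 0 <= f q)%E -> (\int[lebesgue3 R]_q f q = \int[mu3]_q f q)%E.
Proof.
move=> mf f0.
pose l2 := prodm (leb R) (leb R).
transitivity (\int[leb R]_x \int[leb R]_y \int[leb R]_z f (x, y, z))%E.
  rewrite -[(lebesgue3 R)]/(prodm l2 (leb R) : set (heis R) -> \bar R).
  rewrite (fubini_tonelli1 (m1 := l2) (m2 := leb R) f mf f0).
  rewrite (fubini_tonelli1 (m1 := leb R) (m2 := leb R) (fubini_F (leb R) f)).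
  - by [].
  - exact: measurable_fun_fubini_tonelli_F.
  - by move=> w; apply: integral_ge0.
rewrite (ge0_integral3 mf f0).
have mz x y : measurable_fun setT (fun z => f (x, y, z)).
  by apply: (measurableT_comp mf (g := fun z => (x, y, z))); mfun.
have my x : measurable_fun setT (fun y => \int[mu]_z f (x, y, z))%E.
  by apply: (measurableT_comp (ge0_measurable_int_z mf f0) (g := fun y => (x, y))); mfun.
transitivity (\int[leb R]_x \int[mu]_y \int[mu]_z f (x, y, z))%E; last first.
  apply: ge0_integral_mu1; first exact: ge0_measurable_int_yz.
  by move=> x; apply: integral_ge0 => y _; apply: integral_ge0.
apply: eq_integral => x _.
transitivity (\int[leb R]_y \int[mu]_z f (x, y, z))%E.
  by apply: eq_integral => y _; apply: ge0_integral_mu1.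
by apply: ge0_integral_mu1 => // y; apply: integral_ge0.
Qed.

Lemma Rintegral_lebesgue3 (f : heis R -> R) : measurable_fun setT f ->
  Rintegral (lebesgue3 R) setT f = Rintegral mu3 setT f.
Proof.
move=> mf; have mE : measurable_fun setT (EFin \o f) by exact/measurable_EFinP.
rewrite /Rintegral; congr fine; rewrite integralE [RHS]integralE.
have -> : (\int[lebesgue3 R]_x (fun x => (f x)%:E)^\+ x = \int[mu3]_x (fun x => (f x)%:E)^\+ x)%E.
  by apply: ge0_integral_lebesgue3 => //; exact: measurable_funepos.
have -> // : (\int[lebesgue3 R]_x (fun x => (f x)%:E)^\- x = \int[mu3]_x (fun x => (f x)%:E)^\- x)%E.
by apply: ge0_integral_lebesgue3 => //; exact: measurable_funeneg.
Qed.

(** Topology and sigma-algebra of [heis R] are formed separately as products. An open set is the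
    union of the rational cubes that it contains, a countable union of measurable sets. *)
Lemma continuous_measurable3 (f : heis R -> R) : continuous f -> measurable_fun setT f.
Proof.
move=> cf; apply: (measurability _ (RGenOpens.measurableE R)).
move=> _ [_ [a [b ->] <-]]; rewrite setTI.
have : open (f @^-1` `]a, b[%classic).
  by move/continuousP : cf; apply; exact: interval_open.
set U := f @^-1` _ => oU.
pose bx (u v w r : rat) : set (heis R) :=
  (ball (ratr u : R) (ratr r) `*` ball (ratr v : R) (ratr r)) `*` ball (ratr w : R) (ratr r).
have mbx u v w r : measurable (bx u v w r).
  by apply: measurableX; [apply: measurableX|]; exact: measurable_ball.
pose F u v w r := if pselect (bx u v w r `<=` U) then bx u v w r else set0.
have mF u v w r : measurable (F u v w r) by rewrite /F; case: pselect => h; [exact: mbx|exact: measurable0].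
have -> : U = \bigcup_u \bigcup_v \bigcup_w \bigcup_r F u v w r; last first.
  by do 4 (apply: bigcupT_measurable_rat => ?).
apply/seteqP; split; last first.
  move=> q [u _ [v _ [w _ [r _]]]]; rewrite /F; case: pselect => [h|//]; exact: h.
move=> [[x y] z] Uq.
have /nbhs_ballP[e /= e0 he] : nbhs (x, y, z) U by exact: open_nbhs_nbhs.
(* A radius below e/2: the rational centre lies within [r] of the point, so the cube stays in the
   ball of radius [e]. *)
have [r] := @rat_in_itvoo R 0 (e / 2) (divr_gt0 e0 (ltr0n _ 2)).
rewrite in_itv /= => /andP[r0 re].
have pick (c : R) : exists u : rat, `|ratr u - c| < ratr r.
  have [u] := @rat_in_itvoo R (c - ratr r) (c + ratr r) ltac:(lra).
  by rewrite in_itv /= => /andP[u1 u2]; exists u; rewrite ltr_norml; apply/andP; split; lra.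
have [u hu] := pick x; have [v hv] := pick y; have [w hw] := pick z.
exists u => //; exists v => //; exists w => //; exists r => //.
rewrite /F; case: pselect => [?|]; first by split; [split|].
case; move=> [[x' y'] z'] [[/= h1 h2] h3]; apply: he.
have aux (s s' : R) (k : rat) : `|ratr k - s| < ratr r -> ball (ratr k : R) (ratr r) s' -> `|s - s'| < e.
  rewrite /ball /= !ltr_norml => /andP[? ?] /andP[? ?]; apply/andP; split; lra.
by split; [split|]; rewrite /ball /=; [apply: aux hu h1|apply: aux hv h2|apply: aux hw h3].
Qed.

End interface.

(** * Directional derivatives and Gaussian test functions *)

Section directional.
Context {R : realType}.
Implicit Types (p v : heis R).

Lemma is_derive_line (f : heis R -> R) p v (d : R) :
  is_derive (0 : R) 1 (fun h : R => f (h *: v + p)) d -> is_derive p v f d.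
Proof.
move=> [d1 d2]; apply: DeriveDef; first exact/derivable1P.
transitivity ('D_1 (fun h : R => f (h *: v + p)) 0); last exact: d2.
rewrite /derive; set g1 := fun h => h^-1 *: _; set g2 := fun h => h^-1 *: _.
suff -> : g1 = g2 by [].
by apply/funext => h; rewrite /g1 /g2 /= addr0 scale0r add0r [_%:A]mulr1.
Qed.

(** Bridge from second-order increments to derivatives: this is how [taylor] functions acquire their
    [hgrad]. *)
Lemma is_derive_of_quadratic (f : heis R -> R) p v (d c : R) :
  (forall h : R, `|f (h *: v + p) - f p - h * d| <= c * h ^+ 2) -> is_derive p v f d.
Proof.
move=> hc.
have lim : h^-1 *: ((f \o shift p) (h *: v) - f p) @[h --> (0 : R)^'] --> d.
  apply/cvgrPdist_le => e e0; near=> h.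
  have h0 : h != 0 by near: h; exact: nbhs_dnbhs_neq.
  rewrite /= (_ : d - _ = - (h^-1 * (f (h *: v + p) - f p - h * d))); last first.
    by rewrite /GRing.scale /=; field.
  rewrite normrN normrM normfV ler_pdivrMl ?normr_gt0//.
  apply: le_trans (hc h) _; rewrite -(real_normK (num_real h)) expr2 mulrCA ler_wpM2l//.
  have c1 : 0 < `|c| + 1 by rewrite ltr_wpDl.
  apply: (@le_trans _ _ ((`|c| + 1) * `|h|)).
    by rewrite ler_wpM2r//; have := ler_norm c; lra.
  rewrite -ler_pdivlMl// mulrC; apply: ltW.
  near: h; apply: dnbhs0_lt; exact: divr_gt0.
apply: DeriveDef; first by apply/cvg_ex; exists d.
exact: cvg_lim lim.
Unshelve. all: by end_near. Qed.

Lemma partialE i (f g : heis R -> R) : (forall p, is_derive p (axis i) f (g p)) -> partial i f = g.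
Proof. by move=> h; apply/funext => p; rewrite /partial; exact: derive_val. Qed.

Lemma hgradE (f : heis R -> R) p d0 d1 d2 :
  is_derive p (axis 0) f d0 -> is_derive p (axis 1) f d1 -> is_derive p (axis 2) f d2 ->
  hgrad f p = Num.sqrt ((d0 - p.1.2 / 2 * d2) ^+ 2 + (d1 + p.1.1 / 2 * d2) ^+ 2).
Proof.
case: p => [[x y] z] e0 e1 e2; rewrite /hgrad /Xfield /Yfield /partial /=.
by rewrite !derive_val.
Qed.

Lemma continuous_x : continuous (fun q : heis R => q.1.1).
Proof. by move=> q; exact: (cvg_comp _ _ (@cvg_fst _ _ _ _ _) (@cvg_fst _ _ _ _ _)). Qed.
Lemma continuous_y : continuous (fun q : heis R => q.1.2).
Proof. by move=> q; exact: (cvg_comp _ _ (@cvg_fst _ _ _ _ _) (@cvg_snd _ _ _ _ _)). Qed.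
Lemma continuous_z : continuous (fun q : heis R => q.2).
Proof. by move=> q; exact: (@cvg_snd _ _ _ _ _). Qed.

Let lin_derive (a b : R) : is_derive (0 : R) 1 (fun h : R => h * a + b) a.
Proof. by apply: is_derive_eq; rewrite /GRing.scale /=; ring. Qed.

Lemma is_derive_x p v : is_derive p v (fun q : heis R => q.1.1) v.1.1.
Proof. by apply: is_derive_line; exact: lin_derive. Qed.
Lemma is_derive_y p v : is_derive p v (fun q : heis R => q.1.2) v.1.2.
Proof. by apply: is_derive_line; exact: lin_derive. Qed.
Lemma is_derive_z p v : is_derive p v (fun q : heis R => q.2) v.2.
Proof. by apply: is_derive_line; exact: lin_derive. Qed.

Lemma norm_xyz p : [/\ `|p.1.1| <= `|p|, `|p.1.2| <= `|p| & `|p.2| <= `|p|].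
Proof.
by rewrite !prod_normE !le_max !lexx ?orbT.
Qed.

Definition gE (a b : R) (q : heis R) : R :=
  expR (- (a * q.1.1 ^+ 2 + a * q.1.2 ^+ 2 + b * q.2 ^+ 2)).

Lemma is_derive_gE a b p v : is_derive p v (gE a b)
  ((-2) * (a * p.1.1 * v.1.1 + a * p.1.2 * v.1.2 + b * p.2 * v.2) * gE a b p).
Proof.
apply: is_derive_line.
pose P (h : R) := - (a * (h * v.1.1 + p.1.1) ^+ 2 + a * (h * v.1.2 + p.1.2) ^+ 2 + b * (h * v.2 + p.2) ^+ 2).
have eP : is_derive (0 : R) 1 P ((-2) * (a * p.1.1 * v.1.1 + a * p.1.2 * v.1.2 + b * p.2 * v.2)).
  have e1 := lin_derive v.1.1 p.1.1; have e2 := lin_derive v.1.2 p.1.2; have e3 := lin_derive v.2 p.2.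
  by rewrite /P; apply: is_derive_eq; rewrite /GRing.scale /= !mul0r !add0r; ring.
have := is_derive1_comp (is_derive_expR (P 0)) eP; rewrite mulrC.
by rewrite {2}/P !mul0r !add0r.
Qed.

(* The functions obtained from constants, coordinates and one Gaussian by sums
   and products: closed under partial derivatives, with polynomial growth. *)
Inductive gauss_alg (a b : R) : (heis R -> R) -> Prop :=
| ga_cst c : gauss_alg a b (fun=> c)
| ga_x : gauss_alg a b (fun q => q.1.1)
| ga_y : gauss_alg a b (fun q => q.1.2)
| ga_z : gauss_alg a b (fun q => q.2)
| ga_E : gauss_alg a b (gE a b)
| ga_D f g : gauss_alg a b f -> gauss_alg a b g -> gauss_alg a b (fun q => f q + g q)
| ga_M f g : gauss_alg a b f -> gauss_alg a b g -> gauss_alg a b (fun q => f q * g q).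

Lemma gauss_alg_continuous a b f : gauss_alg a b f -> continuous f.
Proof.
elim=> {f} [c|||||f g _ cf _ cg|f g _ cf _ cg].
- by move=> q; exact: cvg_cst.
- exact: continuous_x.
- exact: continuous_y.
- exact: continuous_z.
- move=> q; have h : - (a * r.1.1 ^+ 2 + a * r.1.2 ^+ 2 + b * r.2 ^+ 2) @[r --> q] -->
    - (a * q.1.1 ^+ 2 + a * q.1.2 ^+ 2 + b * q.2 ^+ 2).
    apply: cvgN; apply: cvgD; first apply: cvgD.
    + by apply: cvgM; [exact: cvg_cst|rewrite expr2; under eq_fun do rewrite expr2; apply: cvgM; exact: continuous_x].
    + by apply: cvgM; [exact: cvg_cst|rewrite expr2; under eq_fun do rewrite expr2; apply: cvgM; exact: continuous_y].
    + by apply: cvgM; [exact: cvg_cst|rewrite expr2; under eq_fun do rewrite expr2; apply: cvgM; exact: continuous_z].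
  exact: (cvg_comp _ _ h (@continuous_expR R _)).
- by move=> q; apply: cvgD; [exact: cf|exact: cg].
- by move=> q; apply: cvgM; [exact: cf|exact: cg].
Qed.

Lemma gauss_alg_derive a b f i : gauss_alg a b f ->
  exists2 g, gauss_alg a b g & forall p, is_derive p (axis i) f (g p).
Proof.
elim=> {f} [c|||||f g _ [f' hf df] _ [g' hg dg]|f g sf [f' hf df] sg [g' hg dg]].
- by exists (fun=> 0); [exact: ga_cst|move=> p; exact: is_derive_cst].
- by exists (fun=> (axis i : heis R).1.1); [exact: ga_cst|move=> p; exact: is_derive_x].
- by exists (fun=> (axis i : heis R).1.2); [exact: ga_cst|move=> p; exact: is_derive_y].
- by exists (fun=> (axis i : heis R).2); [exact: ga_cst|move=> p; exact: is_derive_z].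
- exists (fun p => (-2) * (a * p.1.1 * (axis i : heis R).1.1 + a * p.1.2 * (axis i : heis R).1.2 + b * p.2 * (axis i : heis R).2) * gE a b p).
    by repeat first [exact: ga_cst|exact: ga_x|exact: ga_y|exact: ga_z|exact: ga_E|apply: ga_D|apply: ga_M].
  by move=> p; exact: is_derive_gE.
- by exists (fun q => f' q + g' q); [exact: ga_D|move=> p; exact: is_deriveD].
- exists (fun q => f q * g' q + g q * f' q); first by apply: ga_D; exact: ga_M.
  by move=> p; have := is_deriveM (df p) (dg p).
Qed.

Lemma gauss_alg_growth a b f : 0 <= a -> 0 <= b -> gauss_alg a b f -> exists c k, 0 <= c /\
  forall p, `|f p| <= c * (1 + `|p|) ^+ k.
Proof.
move=> a0 b0.
have n1 p : 1 <= 1 + `|p| by rewrite lerDl.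
elim=> {f} [c|||||f g _ [c [k [c0 hf]]] _ [d [m [d0 hg]]]|f g _ [c [k [c0 hf]]] _ [d [m [d0 hg]]]].
- by exists `|c|, 0%N; split => // p; rewrite expr0 mulr1.
- by exists 1, 1%N; split => // p; rewrite mul1r expr1; have [h _ _] := norm_xyz p; lra.
- by exists 1, 1%N; split => // p; rewrite mul1r expr1; have [_ h _] := norm_xyz p; lra.
- by exists 1, 1%N; split => // p; rewrite mul1r expr1; have [_ _ h] := norm_xyz p; lra.
- exists 1, 0%N; split => // p; rewrite expr0 mulr1 ger0_norm ?expR_ge0// expR_le1 oppr_le0.
  by rewrite !addr_ge0// mulr_ge0// sqr_ge0.
- exists (c + d), (k + m)%N; split; first exact: addr_ge0.
  move=> p; apply: le_trans (ler_normD _ _) _; rewrite mulrDl; apply: lerD.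
    by apply: le_trans (hf p) _; rewrite ler_wpM2l// ler_weXn2l// leq_addr.
  by apply: le_trans (hg p) _; rewrite ler_wpM2l// ler_weXn2l// leq_addl.
- exists (c * d), (k + m)%N; split; first exact: mulr_ge0.
  move=> p; rewrite normrM exprD mulrACA; apply: ler_pM => //.
Qed.

Lemma gauss_alg_partials a b f s : gauss_alg a b f -> gauss_alg a b (partials s f).
Proof.
move=> sf; elim: s => //= i s IH.
by have [g sg dg] := gauss_alg_derive i IH; rewrite (partialE dg).
Qed.

Lemma gauss_alg_smooth a b f : 0 <= a -> 0 <= b -> gauss_alg a b f -> smooth_polynomial_growth f.
Proof.
move=> a0 b0 sf; split=> s; have sg := gauss_alg_partials s sf.
- split; first exact: gauss_alg_continuous sg.
  move=> i p; have [g _ dg] := gauss_alg_derive i sg.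
  exact: (@ex_derive _ _ _ _ _ _ _ (dg p)).
- by have [c [k [_ h]]] := gauss_alg_growth a0 b0 sg; exists c, k.
Qed.

Lemma axisE : [/\ axis 0 = (1, 0, 0) :> heis R, axis 1 = (0, 1, 0) :> heis R & axis 2 = (0, 0, 1) :> heis R].
Proof. by split. Qed.

Lemma hgrad_gE a b p : hgrad (gE a b) p =
  2 * gE a b p * Num.sqrt ((- a * p.1.1 + p.1.2 / 2 * (b * p.2)) ^+ 2 + (a * p.1.2 + p.1.1 / 2 * (b * p.2)) ^+ 2).
Proof.
have [a0 a1 a2] := axisE.
rewrite (hgradE (is_derive_gE a b p _) (is_derive_gE a b p _) (is_derive_gE a b p _)).
rewrite a0 a1 a2 /= !(mulr0, mulr1, addr0, add0r).
set s := gE a b p; have s0 : 0 <= s by exact: expR_ge0.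
set u := - a * p.1.1 + p.1.2 / 2 * (b * p.2); set v := a * p.1.2 + p.1.1 / 2 * (b * p.2).
have -> : 2 * s = Num.sqrt ((2 * s) ^+ 2) by rewrite sqrtr_sqr ger0_norm// mulr_ge0.
rewrite -sqrtrM ?sqr_ge0//; congr Num.sqrt; rewrite /u /v; by field.
Qed.

End directional.

Section constant.
Context {R : realType}.

(** The bound at [t = 0], where [heat] is the identity, for the coordinate x at the origin, whose
    horizontal gradient has length 1. In particular C is positive and can be divided out in
    [pk_ge0]. *)
Lemma optimal_ge1 (C : R) : gradient_bound C -> 1 <= C.
Proof.
move=> /(_ 0 (fun q => q.1.1) (lexx 0) (gauss_alg_smooth ler01 ler01 (ga_x 1 1)) (0, 0, 0)).
rewrite /heat eqxx (hgradE (is_derive_x _ _) (is_derive_x _ _) (is_derive_x _ _)).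
by have [-> -> ->] := @axisE R; rewrite /= !mulr0 subr0 addr0 expr1n expr0n /= addr0 sqrtr1 mulr1.
Qed.

End constant.

Section products.
Context {R : realType}.
Local Notation mu := (@mu1 R).

Lemma integral_prod3 (f g h : R -> R) :
  (forall x, 0 <= f x) -> (forall x, 0 <= g x) -> (forall x, 0 <= h x) ->
  mu.-integrable setT (EFin \o f) -> mu.-integrable setT (EFin \o g) ->
  mu.-integrable setT (EFin \o h) ->
  (\int[mu3]_q (f q.1.1 * g q.1.2 * h q.2)%:E =
    (Rintegral mu setT f * Rintegral mu setT g * Rintegral mu setT h)%:E)%E.
Proof.
move=> f0 g0 h0 fi gi hi.
have mf := integrable_meas fi; have mg := integrable_meas gi; have mh := integrable_meas hi.
have mF : measurable_fun setT (fun q : heis R => (f q.1.1 * g q.1.2 * h q.2)%:E).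
  apply/measurable_EFinP.
  have m1 : measurable_fun setT (fun q : heis R => f q.1.1) by apply: (measurableT_comp mf (g := fun q : heis R => q.1.1)); mfun.
  have m2 : measurable_fun setT (fun q : heis R => g q.1.2) by apply: (measurableT_comp mg (g := fun q : heis R => q.1.2)); mfun.
  have m3 : measurable_fun setT (fun q : heis R => h q.2) by apply: (measurableT_comp mh (g := fun q : heis R => q.2)); mfun.
  by mfun.
rewrite (ge0_integral3 mF); last by move=> q; rewrite lee_fin !mulr_ge0.
have Z k (e : R -> R) : mu.-integrable setT (EFin \o e) ->
  (\int[mu]_x (k * e x)%:E = (k * Rintegral mu setT e)%:E)%E.
  move=> ei; rewrite (EFin_Rintegral (integrable_scale k ei)); congr EFin.
  exact: RintegralZl.
transitivity (\int[mu]_x ((Rintegral mu setT g * Rintegral mu setT h) * f x)%:E)%E; last first.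
  by rewrite Z//; congr EFin; ring.
apply: eq_integral => x _.
transitivity (\int[mu]_y ((f x * Rintegral mu setT h) * g y)%:E)%E; last first.
  by rewrite Z//; congr EFin; ring.
apply: eq_integral => y _ /=; rewrite (Z (f x * g y) h hi); congr EFin; ring.
Qed.

Lemma integrable_prod3 (f g h : R -> R) :
  (forall x, 0 <= f x) -> (forall x, 0 <= g x) -> (forall x, 0 <= h x) ->
  mu.-integrable setT (EFin \o f) -> mu.-integrable setT (EFin \o g) ->
  mu.-integrable setT (EFin \o h) ->
  mu3.-integrable setT (EFin \o (fun q : heis R => f q.1.1 * g q.1.2 * h q.2)).
Proof.
move=> f0 g0 h0 fi gi hi.
have mf := integrable_meas fi; have mg := integrable_meas gi; have mh := integrable_meas hi.
apply: ge0_integrable_EFin (integral_prod3 f0 g0 h0 fi gi hi).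
- have m1 : measurable_fun setT (fun q : heis R => f q.1.1) by apply: (measurableT_comp mf (g := fun q : heis R => q.1.1)); mfun.
  have m2 : measurable_fun setT (fun q : heis R => g q.1.2) by apply: (measurableT_comp mg (g := fun q : heis R => q.1.2)); mfun.
  have m3 : measurable_fun setT (fun q : heis R => h q.2) by apply: (measurableT_comp mh (g := fun q : heis R => q.2)); mfun.
  by mfun.
- by move=> q; rewrite !mulr_ge0.
Qed.

Definition box3 : set (heis R) :=
  (`](0 : R), 1[%classic `*` `](0 : R), 1[%classic) `*` `](0 : R), 1[%classic.

Lemma mu3_box : mu3 box3 = 1%E.
Proof.
have i1 : @mu1 R `](0 : R), 1[%classic = 1%E.
  by rewrite /mu1 lebesgue_measure_itv /= lte_fin ltr01 oppr0 adde0.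
have i2 : (mu2 : set (R * R) -> \bar R) (`](0 : R), 1[%classic `*` `](0 : R), 1[%classic) = 1%E.
  by apply: etrans; first apply: product_measure1E => //; rewrite /= i1 mule1.
apply: etrans; first apply: product_measure1E => //; first exact: measurableX.
by rewrite /= i1 mule1; exact: i2.
Qed.

End products.

Lemma Rintegral_gt0 d (T : measurableType d) (R : realType) (m : {measure set T -> \bar R})
  (f : T -> R) (A : set T) : m.-integrable setT (EFin \o f) -> (forall x, 0 <= f x) ->
  measurable A -> (0 < m A)%E -> (forall x, A x -> 0 < f x) -> 0 < Rintegral m setT f.
Proof.
move=> fi f0 mA mA0 fA; rewrite lt_neqAle Rintegral_ge0// andbT; apply/eqP => z0.
have mf : measurable_fun setT (EFin \o f) by exact: measurable_int fi.
have := @ae_eq_integral_abs _ T R m setT measurableT (EFin \o f) mf.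
have -> : (\int[m]_(x in setT) `|(EFin \o f) x| = 0)%E.
  have hp x : (`|(EFin \o f) x| = (f x)%:E)%E by rewrite /= ger0_norm.
  by under eq_integral do rewrite hp; rewrite (EFin_Rintegral fi) -z0.
move=> [/(_ erefl) [N [mN N0 sN]] _].
have : (m A <= m N)%E.
  apply: le_measure; rewrite ?inE//; apply: subset_trans sN => x Ax /=.
  by move=> /(_ I) [] /eqP; rewrite gt_eqF// fA.
by rewrite N0 leNgt mA0.
Qed.

Section positivity.
Context {R : realType}.
Implicit Types (p q : heis R) (t : R).
Local Notation mu := (@mu1 R).

Definition hinv (q : heis R) : heis R := (- q.1.1, - q.1.2, - q.2).

Lemma hmulKV p q : hmul p (hmul (hinv p) q) = q.
Proof.
case: p => [[a b] c]; case: q => [[x y] z] /=.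
by congr (_, _, _); field.
Qed.

Lemma hmulVK p q : hmul (hinv p) (hmul p q) = q.
Proof.
case: p => [[a b] c]; case: q => [[x y] z] /=.
by congr (_, _, _); field.
Qed.

Lemma dilVK (r : R) q : r != 0 -> dil r^-1 (dil r q) = q.
Proof.
case: q => [[x y] z] r0; rewrite /dil /tri /= !addr0 !mulKf//.
by rewrite exprVn mulKf// expf_neq0.
Qed.

Lemma heatE t (f : heis R -> R) p : 0 < t -> measurable_fun setT f ->
  heat t f p = Rintegral mu3 setT (fun q => f (hmul p q) * pk t q).
Proof.
move=> t0 mf; rewrite /heat gt_eqF//.
have -> : (fun q => f (hmul p q) * heat_kernel t q) = (fun q => f (hmul p q) * pk t q).
  by apply/funext => q; rewrite heat_kernelE.
apply: Rintegral_lebesgue3; have mk := measurable_pk t0.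
by apply: measurable_funM => //; exact: (measurableT_comp mf (measurable_hmul p)).
Qed.

(** The horizontal gradient norm of [gE 1 1], see [hgrad_gE]: the profile of the bumps. *)
Let G (q : heis R) : R := 2 * gE 1 1 q *
  Num.sqrt ((- 1 * q.1.1 + q.1.2 / 2 * (1 * q.2)) ^+ 2 + (1 * q.1.2 + q.1.1 / 2 * (1 * q.2)) ^+ 2).

Lemma measurable_sqrt d (T : measurableType d) (f : T -> R) :
  measurable_fun setT f -> measurable_fun setT (fun x => Num.sqrt (f x)).
Proof.
by move=> mf; apply: (measurableT_comp (continuous_measurable_fun (@sqrt_continuous R)) mf).
Qed.

Lemma sqrt_add_sqr_le (u v : R) : Num.sqrt (u ^+ 2 + v ^+ 2) <= `|u| + `|v|.
Proof.
rewrite -[leRHS]ger0_norm ?addr_ge0// -sqrtr_sqr ler_wsqrtr//.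
rewrite -(real_normK (num_real u)) -(real_normK (num_real v)).
have := normr_ge0 u; have := normr_ge0 v; nra.
Qed.

Let measurable_gE a b : measurable_fun setT (gE a b : heis R -> R).
Proof. by rewrite /gE; mfun. Qed.

Let mG : measurable_fun setT G.
Proof.
have m1 := measurable_gE 1 1; rewrite /G.
by apply: measurable_funM; [mfun|apply: measurable_sqrt; mfun].
Qed.

Let iG : mu3.-integrable setT (EFin \o G).
Proof.
pose e (x : R) := gexp (2^-1) x.
have e0 x : 0 <= e x by exact: gexp_ge0.
have ei : mu.-integrable setT (EFin \o e) by apply: integrable_gexp; rewrite invr_gt0.
(* 80 = 2 (4 + 16 + 4 + 16): the square root is bounded by |x| + |y||z| + |y| + |x||z|, and each
   linear factor costs 4 by [gexp_lin_le]. *)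
apply: (integrable_dom (g := fun q => 80 * (e q.1.1 * e q.1.2 * e q.2))) => //; last first.
  exact/integrable_scale/integrable_prod3.
move=> q; set x := q.1.1; set y := q.1.2; set z := q.2.
have gg : gE 1 1 q = gexp 1 x * gexp 1 y * gexp 1 z.
  by rewrite /gE /gexp -!expRD; congr expR; rewrite !mul1r; ring.
have g0 : 0 <= gE 1 1 q by exact: expR_ge0.
rewrite ger0_norm; last by rewrite mulr_ge0 ?sqrtr_ge0// mulr_ge0.
apply: (@le_trans _ _ (2 * gE 1 1 q * (`|x| + `|y| * `|z| + (`|y| + `|x| * `|z|)))).
  rewrite /G ler_wpM2l ?mulr_ge0//.
  apply: le_trans (sqrt_add_sqr_le _ _) _; apply: lerD.
    apply: le_trans (ler_normD _ _) _; rewrite mulN1r normrN lerD2l mul1r !normrM.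
    rewrite (@ger0_norm _ (2^-1)) ?invr_ge0// -/y -/z.
    by have := mulr_ge0 (normr_ge0 y) (normr_ge0 z); nra.
  apply: le_trans (ler_normD _ _) _; rewrite mul1r lerD2l mul1r !normrM.
  rewrite (@ger0_norm _ (2^-1)) ?invr_ge0// -/x -/z.
  by have := mulr_ge0 (normr_ge0 x) (normr_ge0 z); nra.
rewrite gg.
have lx := gexp_lin_le x; have ly := gexp_lin_le y; have lz := gexp_lin_le z.
have ge u : gexp 1 u <= e u by rewrite ler_expR lerN2 ler_wpM2r ?sqr_ge0//; lra.
have gx := ge x; have gy := ge y; have gz := ge z.
have x0 := gexp_ge0 1 x; have y0 := gexp_ge0 1 y; have z0 := gexp_ge0 1 z.
have ex := e0 x; have ey := e0 y; have ez := e0 z.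
rewrite -/(e x) in lx; rewrite -/(e y) in ly; rewrite -/(e z) in lz.
have T1 : (`|x| * gexp 1 x) * gexp 1 y * gexp 1 z <= (4 * e x) * e y * e z.
  by apply: ler_pM => //; rewrite ?mulr_ge0//; apply: ler_pM => //; rewrite ?mulr_ge0.
have T2 : gexp 1 x * (`|y| * gexp 1 y) * gexp 1 z <= e x * (4 * e y) * e z.
  by apply: ler_pM => //; rewrite ?mulr_ge0//; apply: ler_pM => //; rewrite ?mulr_ge0.
have T3 : gexp 1 x * (`|y| * gexp 1 y) * (`|z| * gexp 1 z) <= e x * (4 * e y) * (4 * e z).
  by apply: ler_pM => //; rewrite ?mulr_ge0//; apply: ler_pM => //; rewrite ?mulr_ge0.
have T4 : (`|x| * gexp 1 x) * gexp 1 y * (`|z| * gexp 1 z) <= (4 * e x) * e y * (4 * e z).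
  by apply: ler_pM => //; rewrite ?mulr_ge0//; apply: ler_pM => //; rewrite ?mulr_ge0.
have t0 : 0 <= e x * e y * e z by rewrite !mulr_ge0.
lra.
Qed.

Let G_ge0 q : 0 <= G q.
Proof. by rewrite /G mulr_ge0 ?sqrtr_ge0// mulr_ge0// expR_ge0. Qed.

Let G_gt0 : 0 < Rintegral mu3 setT G.
Proof.
apply: (Rintegral_gt0 (A := box3)) => //.
- by rewrite /box3; apply: measurableX => //; apply: measurableX.
- by apply: (@eq_ind_r _ 1%E (fun v => (0 < v)%E) _ _ (@mu3_box R)); exact: lte01.
- move=> [[x y] z] [[/= hx hy] hz].
  move: hx hy hz; rewrite !in_itv /= => /andP[x0 x1] /andP[y0 y1] /andP[z0 z1].
  rewrite /G /= mulr_gt0//; first by rewrite mulr_gt0// expR_gt0.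
  rewrite sqrtr_gt0 ltr_wpDl ?sqr_ge0// exprn_gt0// !mul1r addr_gt0// mulr_gt0// divr_gt0//.
Qed.

Lemma pk_dil_cvg t q0 q : 0 < t ->
  pk t (hmul q0 (dil (n.+1%:R^-1) q)) @[n --> \oo] --> pk t q0.
Proof.
move=> t0.
have hn : (n.+1%:R^-1 : R) @[n --> \oo] --> 0 by exact: cvg_harmonic.
apply: pk_cvg => //; case: q0 => [[a b] c]; case: q => [[x y] z] /=.
- rewrite -[X in _ --> X]addr0; apply: cvgD; first exact: cvg_cst.
  rewrite -[X in _ --> X](mul0r x); under eq_fun do rewrite addr0.
  by apply: cvgM => //; exact: cvg_cst.
- rewrite -[X in _ --> X]addr0; apply: cvgD; first exact: cvg_cst.
  rewrite -[X in _ --> X](mul0r y); under eq_fun do rewrite addr0.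
  by apply: cvgM => //; exact: cvg_cst.
- have hk k (u : R) : (n.+1%:R^-1) ^+ k.+1 * u @[n --> \oo] --> (0 : R).
    elim: k u => [|k IH] u.
      rewrite -[X in _ --> X](mul0r u); under eq_fun do rewrite expr1.
      by apply: cvgM => //; exact: cvg_cst.
    rewrite -[X in _ --> X](mul0r 0); under eq_fun do rewrite exprS -mulrA.
    by apply: cvgM.
  rewrite [X in X @ _ --> _](_ : _ = (fun n : nat => c + n.+1%:R^-1 ^+ 2 * z +
      n.+1%:R^-1 ^+ 1 * (2^-1 * (a * y - b * x)))); last first.
    by apply/funext => n; rewrite expr1 !addr0; ring.
  rewrite -[X in _ --> X]addr0; apply: cvgD; last exact: (hk 0%N).
  rewrite -[X in _ --> X]addr0; apply: cvgD; last exact: (hk 1%N).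
  exact: cvg_cst.
Qed.

(* The gradient bound at [hinv q0], applied to Gaussians concentrating at the identity,
   says [0 <= \int |grad F| p_t] for bumps [|grad F|] concentrating at [q0] after
   translation. *)
Theorem pk_ge0 (C : R) : gradient_bound C -> forall t q, 0 < t -> 0 <= pk t q.
Proof.
move=> hC t q0 t0; have C1 := optimal_ge1 hC.
have mk := measurable_pk t0.
pose q_ (n : nat) q := hmul q0 (dil (n.+1%:R^-1) q).
have mq n : measurable_fun setT (q_ n).
  exact: (measurableT_comp (measurable_hmul q0) (measurable_dil _)).
pose H (n : nat) q : R := G q * pk t (q_ n q).
have iH n : mu3.-integrable setT (EFin \o H n).
  apply: (integrable_dom (g := fun q => cA t * G q)); last exact: (integrable_scale _ iG).
  - apply: measurable_funM; [exact: mG|exact: (measurableT_comp mk (mq n))].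
  - move=> q; rewrite normrM (ger0_norm (G_ge0 q)) mulrC ler_wpM2r//; exact: pk_le.
have H0 n : 0 <= Rintegral mu3 setT (H n).
  pose r : R := n.+1%:R; have r0 : 0 < r by rewrite ltr0n.
  (* [F] is [gE 1 1] composed with [dil r]: it concentrates at the identity, and its gradient norm
     is [r] times the dilated profile. *)
  pose F := gE (r ^+ 2) (r ^+ 4) : heis R -> R.
  have r20 : 0 <= r ^+ 2 by rewrite exprn_ge0// ltW.
  have r40 : 0 <= r ^+ 4 by rewrite exprn_ge0// ltW.
  have := hC t F (ltW t0) (gauss_alg_smooth r20 r40 (ga_E _ _)) (hinv q0).
  move=> /(le_trans (sqrtr_ge0 _)); rewrite pmulr_rge0; last by apply: lt_le_trans C1.
  have hgE p : hgrad F p = r * G (dil r p).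
    rewrite hgrad_gE /G /dil /tri /= !addr0.
    have -> : gE 1 1 (r * p.1.1, r * p.1.2, r ^+ 2 * p.2) = F p.
      by rewrite /F /gE /=; congr expR; ring.
    transitivity (2 * F p * Num.sqrt (r ^+ 2 *
        ((- 1 * (r * p.1.1) + r * p.1.2 / 2 * (1 * (r ^+ 2 * p.2))) ^+ 2 +
         (1 * (r * p.1.2) + r * p.1.1 / 2 * (1 * (r ^+ 2 * p.2))) ^+ 2))).
      by congr (_ * Num.sqrt _); field.
    by rewrite sqrtrM ?sqr_ge0// sqrtr_sqr gtr0_norm//; ring.
  have mhg : measurable_fun setT (hgrad F).
    rewrite (funext hgE); apply: measurable_funM => //.
    exact: (measurableT_comp mG (measurable_dil r)).
  rewrite (heatE (hinv q0) t0 mhg).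
  pose psi q := dil r (hmul (hinv q0) q).
  have -> : (fun q => hgrad F (hmul (hinv q0) q) * pk t q) = (fun q => r * (H n \o psi) q).
    apply/funext => q; rewrite hgE /H /psi /q_ /= mulrA; congr (_ * pk t _).
    rewrite -[LHS](hmulKV q0); congr hmul.
    by rewrite dilVK// lt0r_neq0.
  have tr (g : heis R -> \bar R) : measurable_fun setT g -> (forall x, 0 <= g x)%E ->
      (\int[mu3]_x g (psi x) = (r ^+ 4)^-1%:E * \int[mu3]_x g x)%E.
    move=> mg g0; rewrite -(ge0_integral_dil r0 mg g0).
    have := ge0_integral_hmul (hinv q0) (measurableT_comp mg (measurable_dil r)) (fun q => g0 _).
    exact.
  have mpsi : measurable_fun setT psi by exact: (measurableT_comp (measurable_dil r) (measurable_hmul _)).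
  have r4V : 0 <= (r ^+ 4)^-1 by rewrite invr_ge0.
  have iHp := integrable_transfer mpsi r4V tr (iH n).
  have -> : Rintegral mu3 setT (fun q => r * (H n \o psi) q) = r * ((r ^+ 4)^-1 * Rintegral mu3 setT (H n)).
    by rewrite -(Rintegral_transfer tr (iH n)); exact: (RintegralZl _ measurableT iHp).
  have r40' : 0 < (r ^+ 4)^-1 by rewrite invr_gt0 exprn_gt0.
  by rewrite (pmulr_rge0 _ r0) (pmulr_rge0 _ r40').
have cH : Rintegral mu3 setT (H n) @[n --> \oo] --> Rintegral mu3 setT (fun q => G q * pk t q0).
  apply: (Rintegral_dominated (g := fun q => cA t * G q)).
  - by move=> n; exact: integrable_meas (iH n).
  - move=> q; apply: cvgM; first exact: cvg_cst.
    exact: pk_dil_cvg.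
  - move=> n q; rewrite /H normrM (ger0_norm (G_ge0 q)) mulrC ler_wpM2r//; exact: pk_le.
  - exact: (integrable_scale _ iG).
(* In the limit the kernel factors out as [pk t q0], against a profile of positive integral. *)
have : 0 <= Rintegral mu3 setT (fun q => G q * pk t q0).
  by apply: (cvgr_to_ge cH); exact: nearW.
by rewrite RintegralZr// pmulr_rge0.
Qed.

End positivity.

(** * Fourier inversion in the vertical variable *)

Section fatou_bound.
Context d (T : measurableType d) (R : realType) (m : {measure set T -> \bar R}).

Lemma fatou_bound (f_ : nat -> T -> R) (f : T -> R) (M : R) :
  (forall n, measurable_fun setT (f_ n)) -> (forall n x, 0 <= f_ n x) ->
  (forall x, f_ n x @[n --> \oo] --> f x) ->
  (forall n, (\int[m]_x (f_ n x)%:E <= M%:E)%E) -> (\int[m]_x (f x)%:E <= M%:E)%E.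
Proof.
move=> mf f0 cf hM.
have mE n : measurable_fun setT (fun x => (f_ n x)%:E) by apply/measurable_EFinP.
have := @fatou _ _ _ m setT measurableT (fun n x => (f_ n x)%:E) mE (fun n x _ => f0 n x).
have -> : (\int[m]_x limn_einf (fun n => (f_ n x)%:E) = \int[m]_x (f x)%:E)%E.
  apply: eq_integral => x _.
  have c : ((f_ n x)%:E @[n --> \oo] --> (f x)%:E)%classic.
    by apply: cvg_EFin; [exact: nearW|exact: cf].
  by have [-> _] := cvg_limn_einf_sup c.
move=> h; apply: (le_trans h); rewrite limn_einf_lim; apply: lime_le; first exact: is_cvg_einfs.
apply: nearW => n; apply: le_trans (hM n).
by apply: ereal_inf_lbound; exists n => //=.
Qed.

Lemma le_integrable_EFin (f : T -> R) (M : R) : measurable_fun setT f ->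
  (forall x, 0 <= f x) -> (\int[m]_x (f x)%:E <= M%:E)%E ->
  m.-integrable setT (EFin \o f) /\ Rintegral m setT f <= M.
Proof.
move=> mf f0 hM; have fi : m.-integrable setT (EFin \o f).
  apply/integrableP; split; first exact/measurable_EFinP.
  under eq_integral do rewrite /= ger0_norm//.
  by apply: le_lt_trans hM _; exact: ltry.
by split => //; rewrite -lee_fin -EFin_Rintegral.
Qed.

End fatou_bound.

Section fubini.
Context d1 d2 (T1 : measurableType d1) (T2 : measurableType d2) (R : realType)
  (m1 : {sigma_finite_measure set T1 -> \bar R})
  (m2 : {sigma_finite_measure set T2 -> \bar R}).

Lemma Rfubini1 (F : T1 * T2 -> R) : (prodm m1 m2).-integrable setT (EFin \o F) ->
  (forall x, m2.-integrable setT (EFin \o (fun y => F (x, y)))) ->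
  Rintegral (prodm m1 m2) setT F = Rintegral m1 setT (fun x => Rintegral m2 setT (fun y => F (x, y))).
Proof.
move=> Fi F1; rewrite /Rintegral; congr fine.
rewrite -(@integral12_prod_meas1 _ _ _ _ _ m1 m2 _ Fi).
by apply: eq_integral => x _; rewrite /fubini_F /= (EFin_Rintegral (F1 x)).
Qed.

Lemma Rfubini (F : T1 * T2 -> R) : (prodm m1 m2).-integrable setT (EFin \o F) ->
  (forall x, m2.-integrable setT (EFin \o (fun y => F (x, y)))) ->
  (forall y, m1.-integrable setT (EFin \o (fun x => F (x, y)))) ->
  Rintegral m1 setT (fun x => Rintegral m2 setT (fun y => F (x, y))) =
  Rintegral m2 setT (fun y => Rintegral m1 setT (fun x => F (x, y))).
Proof.
move=> Fi F1 F2; rewrite /Rintegral; congr fine.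
have := @Fubini _ _ _ _ _ m1 m2 _ Fi; rewrite /fubini_F /fubini_G => h.
transitivity (\int[m1]_x \int[m2]_y (F (x, y))%:E)%E.
  by apply: eq_integral => x _; rewrite (EFin_Rintegral (F1 x)).
rewrite h; by apply: eq_integral => x _; rewrite /= (EFin_Rintegral (F2 x)).
Qed.

Lemma integrable_prod (f : T1 -> R) (g : T2 -> R) : m1.-integrable setT (EFin \o f) ->
  m2.-integrable setT (EFin \o g) ->
  (prodm m1 m2).-integrable setT (EFin \o (fun w : T1 * T2 => f w.1 * g w.2)).
Proof.
move=> fi gi; have mf := integrable_meas fi; have mg := integrable_meas gi.
have mh : measurable_fun setT (fun w : T1 * T2 => f w.1 * g w.2).
  apply: measurable_funM; [exact: (measurableT_comp mf measurable_fst)|exact: (measurableT_comp mg measurable_snd)].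
have mh' : measurable_fun setT (fun w : T1 * T2 => `|(f w.1 * g w.2)%:E|%E).
  by apply: measurableT_comp => //; exact/measurable_EFinP.
apply/integrableP; split; first exact/measurable_EFinP.
rewrite (fubini_tonelli1 (m1 := m1) (m2 := m2) (fun w => `|(f w.1 * g w.2)%:E|%E) mh' (fun w => abse_ge0 _)).
rewrite /fubini_F /=.
under eq_integral => x _.
  under eq_integral do rewrite normrM EFinM.
  rewrite ge0_integralZl//; last first.
    by apply/measurable_EFinP; apply: measurableT_comp.
  rewrite (EFin_Rintegral (integrable_norm gi)) -EFinM mulrC.
  over.
have := integrable_scale (Rintegral m2 setT (fun y => `|g y|)) (integrable_norm fi).
by move=> h; rewrite (EFin_Rintegral h) ltry.
Qed.

End fubini.

Section inversion.
Context {R : realType}.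
Local Notation mu := (@mu1 R).
Variables (K P : R -> R) (t : R).
Hypotheses (cK : continuous K) (iK : mu.-integrable setT (EFin \o K)).
Hypotheses (K0 : forall l, 0 <= K l) (Kt : forall l, K l <= t^-1).
Hypothesis K_even : forall l, K (- l) = K l.
Hypothesis PE : forall z, P z = cpi * Rintegral mu setT (fun l => cos (l * z) * K l).

Let mK : measurable_fun setT K. Proof. exact: continuous_measurable_fun. Qed.

Let icos z : mu.-integrable setT (EFin \o (fun l => cos (l * z) * K l)).
Proof.
apply: (integrable_dom (g := K)); [by mfun| |exact: iK].
by move=> l; rewrite normrM (ger0_norm (K0 l)); apply: (ler_piMl (K0 l)); exact: cos_max.
Qed.

Lemma Rintegral_gexp_cos2 a m l : 0 < a ->
  Rintegral mu setT (fun z => gexp a z * cos (m * z) * cos (l * z)) =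
  Num.sqrt (pi / a) / 2 * (expR (- ((l + m) ^+ 2 / (4 * a))) + expR (- ((l - m) ^+ 2 / (4 * a)))).
Proof.
move=> a0.
have e : (fun z => gexp a z * cos (m * z) * cos (l * z)) =
    (fun z => 2^-1 * (gexp a z * cos ((l + m) * z)) + 2^-1 * (gexp a z * cos ((l - m) * z))) :> (R -> R).
  by apply/funext => z; rewrite mulrDl mulrBl cosD cosB; field.
have i1 := integrable_gexp_cos (l + m) a0; have i2 := integrable_gexp_cos (l - m) a0.
rewrite e (RintegralD measurableT (integrable_scale _ i1) (integrable_scale _ i2)).
rewrite (RintegralZl _ measurableT i1) (RintegralZl _ measurableT i2) !Rintegral_gexp_cos//.
by field.
Qed.

Let Gs a k : R := expR (- (k ^+ 2 / (4 * a))).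

Let iKGs a m : 0 < a -> mu.-integrable setT (EFin \o (fun l => K l * Gs a (l + m))).
Proof.
move=> a0; apply: (integrable_dom (g := K)) => //; first by rewrite /Gs; mfun.
move=> l; rewrite normrM (ger0_norm (K0 l)) (ger0_norm (expR_ge0 _)); apply: ler_piMr => //.
by rewrite expR_le1 oppr_le0 divr_ge0 ?sqr_ge0// mulr_ge0// ltW.
Qed.

Let KGs_sym a m : 0 < a -> Rintegral mu setT (fun l => K l * Gs a (l + m)) =
  Rintegral mu setT (fun l => K l * Gs a (l - m)).
Proof.
move=> a0; have n1 : (-1 : R) != 0 by rewrite oppr_eq0 oner_eq0.
have := Rintegral_aff 0 n1 (iKGs m a0); rewrite normrN1 invr1 mul1r => <-.
apply: eq_Rintegral => l _; rewrite mulN1r addr0 K_even; congr (_ * _).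
by rewrite /Gs; have -> : (- l + m) ^+ 2 = (l - m) ^+ 2 by ring.
Qed.

(* The Gaussian factor legitimates Fubini before [P] is known to be integrable. *)
Lemma fourier_reg h m : 0 < h ->
  Rintegral mu setT (fun z => gexp (h ^+ 2 / 4) z * cos (m * z) *
     P z) =
  2 * cpi * Num.sqrt pi * Rintegral mu setT (fun v => K (h * v + m) * gexp 1 v).
Proof.
(* The Gaussian of rate h^2/4 has a Fourier transform of width [h]: after the substitution l = h v +
   m it becomes e^(-v^2). *)
move=> h0; set a := h ^+ 2 / 4; have a0 : 0 < a by rewrite divr_gt0// exprn_gt0.
pose F (w : R * R) := gexp a w.1 * cos (m * w.1) * (cos (w.2 * w.1) * K w.2).
have mK2 : measurable_fun setT (fun w : R * R => K w.2) by exact: (measurableT_comp mK measurable_snd).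
have mF : measurable_fun setT F by rewrite /F /gexp; mfun.
have Fb w : `|F w| <= gexp a w.1 * K w.2.
  rewrite /F normrM [X in X * _]normrM [X in _ * X]normrM (ger0_norm (gexp_ge0 a w.1)) (ger0_norm (K0 w.2)).
  apply: ler_pM; rewrite ?mulr_ge0 ?gexp_ge0//.
  - by apply: ler_piMr; [exact: gexp_ge0|exact: cos_max].
  - by apply: ler_piMl => //; exact: cos_max.
have iF : mu2.-integrable setT (EFin \o F).
  by apply: (integrable_dom mF Fb); apply: integrable_prod => //; exact: integrable_gexp.
have iF1 z : mu.-integrable setT (EFin \o (fun l => F (z, l))).
  by apply: (integrable_dom (g := fun l => gexp a z * K l));
   [rewrite /F /=; mfun|move=> l; exact: Fb|exact: integrable_scale].
have iF2 l : mu.-integrable setT (EFin \o (fun z => F (z, l))).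
  apply: (integrable_dom (g := fun z => K l * gexp a z));
   [by rewrite /F /gexp /=; mfun|by move=> z; rewrite mulrC; exact: Fb|].
  by apply: integrable_scale; exact: integrable_gexp.
transitivity (Rintegral mu setT (fun z => cpi * Rintegral mu setT (fun l => F (z, l)))).
  apply: eq_Rintegral => z _; rewrite PE /F /= (RintegralZl _ measurableT (icos z)); ring.
have iFF : mu.-integrable setT (EFin \o (fun z => Rintegral mu setT (fun l => F (z, l)))).
  have := integrable_fubini_F iF; rewrite /fubini_F; apply: eq_integrable => // z _.
  by rewrite /= (EFin_Rintegral (iF1 z)).
rewrite (RintegralZl _ measurableT iFF) (Rfubini iF iF1 iF2).
have i1 := iKGs m a0; have i2 := iKGs (- m) a0.
transitivity (cpi * Rintegral mu setT (fun l => Num.sqrt (pi / a) / 2 * (K l * Gs a (l + m) + K l * Gs a (l - m)))).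
  congr (_ * _); apply: eq_Rintegral => l _.
  transitivity (Rintegral mu setT (fun z => K l * (gexp a z * cos (m * z) * cos (l * z)))).
    by apply: eq_Rintegral => z _; rewrite /F /=; ring.
  rewrite RintegralZl//; last first.
    apply: (integrable_dom (g := gexp a)); [by rewrite /gexp; mfun| |exact: integrable_gexp].
    move=> z; rewrite !normrM (ger0_norm (gexp_ge0 a z)) -mulrA ler_piMr ?gexp_ge0//.
    by rewrite mulr_ile1// cos_max.
  by rewrite Rintegral_gexp_cos2// /Gs; ring.
rewrite (RintegralZl _ measurableT (integrable_add i1 i2)) (RintegralD measurableT i1 i2) KGs_sym//.
have := Rintegral_aff m (lt0r_neq0 h0) i2; rewrite (gtr0_norm h0) => e.
have -> : Rintegral mu setT (fun l => K l * Gs a (l - m)) =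
   h * Rintegral mu setT (fun v => K (h * v + m) * gexp 1 v).
  apply: (@mulfI _ h^-1); first by rewrite invr_eq0 lt0r_neq0.
  rewrite [RHS](mulKf (lt0r_neq0 h0)) -e; apply: eq_Rintegral => v _; congr (_ * _).
  by rewrite /Gs /gexp /a; congr (expR (- _)); field; exact: lt0r_neq0.
have -> : Num.sqrt (pi / a) = 2 / h * Num.sqrt pi.
  have -> : (pi : R) / a = (2 / h) ^+ 2 * pi by rewrite /a; field; exact: lt0r_neq0.
  by rewrite sqrtrM ?sqr_ge0// sqrtr_sqr ger0_norm// divr_ge0// ltW.
by field; exact: lt0r_neq0.
Qed.

Hypothesis P0 : forall z, 0 <= P z.
Hypothesis mP : measurable_fun setT P.

Let hn (n : nat) : R := n.+1%:R^-1.
Let hn0 n : 0 < hn n. Proof. by rewrite invr_gt0. Qed.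
Let hn_cvg : hn n @[n --> \oo] --> (0 : R). Proof. exact: cvg_harmonic. Qed.

Let reg_cvg z : gexp (hn n ^+ 2 / 4) z @[n --> \oo] --> (1 : R).
Proof.
have h2 : hn n ^+ 2 @[n --> \oo] --> (0 : R).
  by rewrite -[X in _ --> X](mul0r 0); under eq_fun do rewrite expr2; exact: cvgM.
have h : - (hn n ^+ 2 / 4 * z ^+ 2) @[n --> \oo] --> (0 : R).
  rewrite -[X in _ --> X]oppr0; apply: cvgN; rewrite -[X in _ --> X](mul0r (z ^+ 2)).
  apply: cvgM; last exact: cvg_cst.
  by rewrite -[X in _ --> X](mul0r (4^-1)); apply: cvgM => //; exact: cvg_cst.
rewrite -[X in _ --> X]expR0; exact: (cvg_comp _ _ h (@continuous_expR R _)).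
Qed.

(* Positivity of [P] upgrades the regularised bound at frequency 0 to integrability,
   by Fatou. *)
Lemma integrable_transform : mu.-integrable setT (EFin \o P).
Proof.
pose M := 2 * cpi * Num.sqrt pi * (t^-1 * Num.sqrt pi).
suff /(le_integrable_EFin mP P0)[] : (\int[mu]_z (P z)%:E <= M%:E)%E by [].
have mg a : measurable_fun setT (gexp a : R -> R) by exact: measurable_gexp.
have mreg n : measurable_fun setT (fun z => gexp (hn n ^+ 2 / 4) z * P z) by exact: measurable_funM.
apply: (fatou_bound (f_ := fun n z => gexp (hn n ^+ 2 / 4) z * P z)).
- exact: mreg.
- by move=> n z; rewrite mulr_ge0// gexp_ge0.
- by move=> z; rewrite -[X in _ --> X]mul1r; apply: cvgM; [exact: reg_cvg|exact: cvg_cst].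
- move=> n.
  have Pb z : P z <= cpi * Rintegral mu setT K.
    rewrite PE (ler_pM2l cpi_gt0); apply: le_Rintegral => //.
    by move=> l _; apply: ler_piMl => //; exact: cos_le1.
  have a0 : 0 < hn n ^+ 2 / 4 by rewrite divr_gt0// exprn_gt0.
  have ireg : mu.-integrable setT (EFin \o (fun z => gexp (hn n ^+ 2 / 4) z * P z)).
    apply: (integrable_dom (g := fun z => cpi * Rintegral mu setT K * gexp (hn n ^+ 2 / 4) z)) => //.
      by move=> z; rewrite ger0_norm ?mulr_ge0 ?gexp_ge0// mulrC ler_wpM2r// gexp_ge0.
    by apply: integrable_scale; exact: integrable_gexp.
  rewrite (EFin_Rintegral ireg) lee_fin.
  have -> : Rintegral mu setT (fun z => gexp (hn n ^+ 2 / 4) z * P z) =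
      Rintegral mu setT (fun z => gexp (hn n ^+ 2 / 4) z * cos (0 * z) * P z).
    by apply: eq_Rintegral => z _; rewrite mul0r cos0 mulr1.
  rewrite (fourier_reg 0 (hn0 n)) ler_wpM2l//.
    by rewrite mulr_ge0 ?sqrtr_ge0// mulr_ge0// ltW// cpi_gt0.
  have g1 := integrable_gexp (@ltr01 R).
  apply: (@le_trans _ _ (Rintegral mu setT (fun v => t^-1 * gexp 1 v))).
    have mKh : measurable_fun setT (fun v => K (hn n * v + 0)) by apply: (measurableT_comp mK (g := fun v => hn n * v + 0)); mfun.
    apply: le_Rintegral => //; [|exact: integrable_scale|by move=> v _; rewrite ler_wpM2r ?gexp_ge0].
    apply: (integrable_dom (g := fun v => t^-1 * gexp 1 v)); [exact: measurable_funM| |exact: integrable_scale].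
    by move=> v; rewrite ger0_norm ?mulr_ge0 ?gexp_ge0// ler_wpM2r ?gexp_ge0.
  by rewrite (RintegralZl _ measurableT g1) (Rintegral_gexp ltr01) divr1.
Qed.

(** Let h tend to 0 in [fourier_reg]: on the left [P] itself is the majorant, on the right
    [K (h v + m)] tends to [K m]. The constant is 2 [cpi] sqrt pi sqrt pi = 1/(4 pi). *)
Lemma fourier_inversion m : Rintegral mu setT (fun z => cos (m * z) * P z) = K m / (4 * pi).
Proof.
have mg a : measurable_fun setT (gexp a : R -> R) by exact: measurable_gexp.
have iP := integrable_transform.
have c1 : Rintegral mu setT (fun z => gexp (hn n ^+ 2 / 4) z * cos (m * z) * P z) @[n --> \oo] -->
    Rintegral mu setT (fun z => cos (m * z) * P z).
  apply: (Rintegral_dominated (g := P)) => //.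
  - by move=> n; have h := mg (hn n ^+ 2 / 4); mfun.
  - move=> z; rewrite -[X in _ --> X * P z]mul1r; apply: cvgM; last exact: cvg_cst.
    by apply: cvgM; [exact: reg_cvg|exact: cvg_cst].
  - move=> n z; rewrite !normrM (ger0_norm (P0 z)); apply: ler_piMl => //.
    rewrite mulr_ile1 ?cos_max// ger0_norm ?gexp_ge0// expR_le1 oppr_le0 mulr_ge0 ?sqr_ge0//.
    by rewrite divr_ge0// sqr_ge0.
have c2 : 2 * cpi * Num.sqrt pi * Rintegral mu setT (fun v => K (hn n * v + m) * gexp 1 v) @[n --> \oo] -->
    2 * cpi * Num.sqrt pi * Rintegral mu setT (fun v => K m * gexp 1 v).
  apply: cvgM; first exact: cvg_cst.
  apply: (Rintegral_dominated (g := fun v => t^-1 * gexp 1 v)).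
  - move=> n; apply: measurable_funM => //; apply: (measurableT_comp mK (g := fun v => hn n * v + m)); mfun.
  - move=> v; apply: cvgM; last exact: cvg_cst.
    have h : hn n * v + m @[n --> \oo] --> m.
      rewrite -[X in _ --> X]add0r; apply: cvgD; last exact: cvg_cst.
      by rewrite -[X in _ --> X](mul0r v); apply: cvgM => //; exact: cvg_cst.
    exact: (cvg_comp _ _ h (@cK m)).
  - by move=> n v; rewrite ger0_norm ?mulr_ge0 ?gexp_ge0// ler_wpM2r ?gexp_ge0.
  - by apply: integrable_scale; exact: integrable_gexp.
have e : (fun n => Rintegral mu setT (fun z => gexp (hn n ^+ 2 / 4) z * cos (m * z) * P z)) =
   (fun n => 2 * cpi * Num.sqrt pi * Rintegral mu setT (fun v => K (hn n * v + m) * gexp 1 v)).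
  by apply/funext => n; exact: fourier_reg.
rewrite e in c1; have := cvg_unique (@norm_hausdorff _ R) c1 c2 => ->.
have g1 := integrable_gexp (@ltr01 R).
rewrite (RintegralZl _ measurableT g1) (Rintegral_gexp ltr01) divr1.
have pi0 : (pi : R) != 0 by rewrite lt0r_neq0// pi_gt0.
transitivity (2 * cpi * Num.sqrt pi ^+ 2 * K m); first by ring.
rewrite sqr_sqrtr ?pi_ge0// /cpi; move: pi0; generalize (pi : R) => p pn0; field; rewrite ?pn0//.
Qed.

End inversion.

(** * Moments of the heat kernel *)

Section z_transform.
Context {R : realType}.
Local Notation mu := (@mu1 R).

Lemma hK_gexp t x y m :
  hK t (x ^+ 2 + y ^+ 2) m = hA t m * gexp (hB t m / 4) x * gexp (hB t m / 4) y :> R.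
Proof. by rewrite /hK /gexp -[RHS]mulrA -expRD; congr (_ * expR _); field. Qed.

Lemma hA0 t : hA t 0 = t^-1 :> R. Proof. by rewrite /hA eqxx. Qed.
Lemma hB0 t : hB t 0 = t^-1 :> R. Proof. by rewrite /hB hA0 mul0r cosh0 mulr1. Qed.

Hypothesis pk_ge0 : forall (t : R) q, 0 < t -> 0 <= pk t q.
Variables (t x y : R).
Hypothesis t0 : 0 < t.

Lemma measurable_pk_z : measurable_fun setT (fun z : R => pk t (x, y, z)).
Proof. by apply: (measurableT_comp (measurable_pk t0) (g := fun z' : R => (x, y, z'))); mfun. Qed.

Let r0 : 0 <= x ^+ 2 + y ^+ 2. Proof. exact: (r2_ge0 (x, y, 0)). Qed.

Lemma integrable_pk_z : mu.-integrable setT (EFin \o (fun z => pk t (x, y, z))).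
Proof.
apply: (@integrable_transform R (hK t (x ^+ 2 + y ^+ 2)) _ t).
- exact: continuous_hK.
- exact: integrable_hK.
- by move=> l; exact: ltW (hK_gt0 _ l t0).
- by move=> l; exact: le_trans (hK_le_hA l t0 r0) (hA_le l t0).
- by move=> l; exact: hK_even.
- by [].
- by move=> z; exact: pk_ge0.
- exact: measurable_pk_z.
Qed.

Lemma pk_fourier m : Rintegral mu setT (fun z => cos (m * z) * pk t (x, y, z)) =
  hK t (x ^+ 2 + y ^+ 2) m / (4 * pi).
Proof.
apply: (@fourier_inversion R (hK t (x ^+ 2 + y ^+ 2)) _ t).
- exact: continuous_hK.
- exact: integrable_hK.
- by move=> l; exact: ltW (hK_gt0 _ l t0).
- by move=> l; exact: le_trans (hK_le_hA l t0 r0) (hA_le l t0).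
- by move=> l; exact: hK_even.
- by [].
- by move=> z; exact: pk_ge0.
- exact: measurable_pk_z.
Qed.

Lemma pk_even z : pk t (x, y, - z) = pk t (x, y, z).
Proof.
rewrite /pk /=; congr (_ * _); apply: eq_Rintegral => l _.
by rewrite mulrN cosN.
Qed.

Let bounded_pk (g : R -> R) : measurable_fun setT g -> (forall z, `|g z| <= 1) ->
  mu.-integrable setT (EFin \o (fun z => g z * pk t (x, y, z))).
Proof.
move=> mg g1; have mk := measurable_pk_z; apply: (integrable_dom (g := fun z => pk t (x, y, z))).
- exact: measurable_funM.
- by move=> z; rewrite normrM (ger0_norm (pk_ge0 _ t0)); apply: (ler_piMl (pk_ge0 _ t0)).
- exact: integrable_pk_z.
Qed.

Lemma integrable_cos_pk_z c m :
  mu.-integrable setT (EFin \o (fun z => cos (m * (c - z)) * pk t (x, y, z))).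
Proof. by apply: bounded_pk; [mfun|move=> z; exact: cos_max]. Qed.

Lemma pk_fourier_shift c m : Rintegral mu setT (fun z => cos (m * (c - z)) * pk t (x, y, z)) =
  cos (m * c) * hK t (x ^+ 2 + y ^+ 2) m / (4 * pi).
Proof.
have i1 : mu.-integrable setT (EFin \o (fun z => cos (m * z) * pk t (x, y, z))).
  by apply: bounded_pk; [mfun|move=> z; exact: cos_max].
have i2 : mu.-integrable setT (EFin \o (fun z => sin (m * z) * pk t (x, y, z))).
  by apply: bounded_pk; [mfun|move=> z; exact: sin_max].
have -> : (fun z => cos (m * (c - z)) * pk t (x, y, z)) =
    (fun z => cos (m * c) * (cos (m * z) * pk t (x, y, z)) +
              sin (m * c) * (sin (m * z) * pk t (x, y, z))).
  by apply/funext => z; rewrite mulrBr cosB; ring.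
rewrite (RintegralD measurableT (integrable_scale _ i1) (integrable_scale _ i2)).
rewrite (RintegralZl _ measurableT i1) (RintegralZl _ measurableT i2) pk_fourier.
rewrite (Rintegral_odd i2); last by move=> z; rewrite pk_even mulrN sinN mulNr.
by rewrite mulr0 addr0 mulrA.
Qed.

End z_transform.

Section moments.
Context {R : realType}.
Local Notation mu := (@mu1 R).
Hypothesis pk_ge0 : forall (t : R) q, 0 < t -> 0 <= pk t q.
Variable t : R.
Hypothesis t0 : 0 < t.

Let b : R := (4 * t)^-1.
Let b0 : 0 < b. Proof. by rewrite invr_gt0 mulr_gt0. Qed.

Let integral_scale k (e : R -> R) : mu.-integrable setT (EFin \o e) ->
  (\int[mu]_x (k * e x)%:E = (k * Rintegral mu setT e)%:E)%E.
Proof. by move=> ei; rewrite (EFin_Rintegral (integrable_scale k ei)) (RintegralZl _ measurableT ei). Qed.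

(** At frequency 0 [pk_fourier] says that the horizontal marginal of [pk t] is the planar Gaussian
    of rate 1/(4 t), so horizontal moments factor. *)
Lemma integral_xy_pk (f g : R -> R) : (forall x, 0 <= f x) -> (forall x, 0 <= g x) ->
  measurable_fun setT f -> measurable_fun setT g ->
  mu.-integrable setT (EFin \o (fun x => f x * gexp b x)) ->
  mu.-integrable setT (EFin \o (fun x => g x * gexp b x)) ->
  (\int[mu3]_q (f q.1.1 * g q.1.2 * pk t q)%:E =
   ((4 * pi * t)^-1 * Rintegral mu setT (fun x => f x * gexp b x)
     * Rintegral mu setT (fun x => g x * gexp b x))%:E)%E.
Proof.
move=> f0 g0 mf mg fi gi; have mk := measurable_pk t0.
have mF : measurable_fun setT (fun q : heis R => (f q.1.1 * g q.1.2 * pk t q)%:E).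
  apply/measurable_EFinP.
  have m1 : measurable_fun setT (fun q : heis R => f q.1.1) by apply: (measurableT_comp mf (g := fun q : heis R => q.1.1)); mfun.
  have m2 : measurable_fun setT (fun q : heis R => g q.1.2) by apply: (measurableT_comp mg (g := fun q : heis R => q.1.2)); mfun.
  by apply: measurable_funM => //; exact: measurable_funM.
have F0 (q : heis R) : (0 <= (f q.1.1 * g q.1.2 * pk t q)%:E)%E by rewrite lee_fin; exact: (mulr_ge0 (mulr_ge0 (f0 _) (g0 _)) (pk_ge0 _ t0)).
rewrite (ge0_integral3 mF F0).
transitivity (\int[mu]_x ((4 * pi * t)^-1 * Rintegral mu setT (fun y => g y * gexp b y) * (f x * gexp b x))%:E)%E.
  apply: eq_integral => x _.
  transitivity (\int[mu]_y (((4 * pi * t)^-1 * (f x * gexp b x)) * (g y * gexp b y))%:E)%E.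
    apply: eq_integral => y _; apply: etrans; first exact: (integral_scale (f x * g y) (integrable_pk_z pk_ge0 x y t0)).
    congr EFin.
    have := pk_fourier pk_ge0 x y t0 0.
    have -> : (fun z => cos (0 * z) * pk t (x, y, z)) = (fun z => pk t (x, y, z)).
      by apply/funext => z; rewrite mul0r cos0 mul1r.
    move=> ->; rewrite hK_gexp hA0 hB0.
    have -> : t^-1 / 4 = b by rewrite /b invfM mulrC.
    have pin0 : (pi : R) != 0 by rewrite lt0r_neq0// pi_gt0.
    move: pin0; generalize (pi : R) => p pn0; field; rewrite ?pn0 ?(lt0r_neq0 t0)//.
  by rewrite (integral_scale _ gi); congr EFin; ring.
by rewrite (integral_scale _ fi); congr EFin; ring.
Qed.

Let sqrtE : Num.sqrt (pi / b) * Num.sqrt (pi / b) = 4 * pi * t.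
Proof.
rewrite -expr2 sqr_sqrtr; last by rewrite divr_ge0 ?pi_ge0// ltW.
by rewrite /b; field; rewrite lt0r_neq0.
Qed.

Let c0 : 4 * pi * t != 0. Proof. by rewrite !mulf_neq0 ?lt0r_neq0// pi_gt0. Qed.

Let i0 : mu.-integrable setT (EFin \o (fun x => 1 * gexp b x)).
Proof. by apply: integrable_scale; exact: integrable_gexp. Qed.
Let R0 : Rintegral mu setT (fun x => 1 * gexp b x) = Num.sqrt (pi / b).
Proof. by under eq_Rintegral do rewrite mul1r; exact: Rintegral_gexp. Qed.

Let mcst1 : measurable_fun setT (fun _ : R => 1 : R). Proof. by []. Qed.
Let mpow n : measurable_fun setT (fun x : R => x ^+ n). Proof. by mfun. Qed.
Let pow20 (x : R) : 0 <= x ^+ 2. Proof. exact: sqr_ge0. Qed.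
Let pow40 (x : R) : 0 <= x ^+ 4. Proof. by rewrite (exprM x 2 2); exact: sqr_ge0. Qed.
Let one0 (x : R) : 0 <= (1 : R). Proof. exact: ler01. Qed.

Let int_pk : (\int[mu3]_q (pk t q)%:E = 1%:E)%E.
Proof.
have h := integral_xy_pk one0 one0 mcst1 mcst1 i0 i0; rewrite R0 in h.
transitivity (\int[mu3]_q (1 * 1 * pk t q)%:E)%E; first by apply: eq_integral => q _; rewrite !mul1r.
by rewrite h; congr EFin; rewrite -mulrA sqrtE mulVf.
Qed.

Lemma integrable_pk : mu3.-integrable setT (EFin \o (pk t)).
Proof.
by apply: (ge0_integrable_EFin (measurable_pk t0) _ int_pk) => q; exact: pk_ge0.
Qed.

Lemma Rintegral_pk : Rintegral mu3 setT (pk t) = 1.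
Proof. by rewrite /Rintegral int_pk. Qed.

Let g2 := integrable_gexp2 b0.
Let g4 := integrable_gexp4 b0.

Let val2 : (4 * pi * t)^-1 * ((2 * b)^-1 * Num.sqrt (pi / b)) * Num.sqrt (pi / b) = 2 * t.
Proof.
rewrite [(2 * b)^-1 * _]mulrC -mulrA (mulrAC (Num.sqrt _)) sqrtE mulrA mulVf// mul1r.
by rewrite /b; field; rewrite lt0r_neq0.
Qed.

Let mom (F : heis R -> R) c : measurable_fun setT F -> (forall q, 0 <= F q) ->
  (\int[mu3]_q (F q * pk t q)%:E = c%:E)%E ->
  mu3.-integrable setT (EFin \o (fun q => F q * pk t q)) /\
  Rintegral mu3 setT (fun q => F q * pk t q) = c.
Proof.
move=> mF F0 h; have mk := measurable_pk t0; split.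
  apply: (ge0_integrable_EFin _ _ h) => [|q]; first exact: measurable_funM.
  by rewrite mulr_ge0// pk_ge0.
by rewrite /Rintegral h.
Qed.

Lemma pk_x2 : mu3.-integrable setT (EFin \o (fun q => q.1.1 ^+ 2 * pk t q)) /\
  Rintegral mu3 setT (fun q => q.1.1 ^+ 2 * pk t q) = 2 * t.
Proof.
apply: mom; [by mfun|by move=> q; exact: sqr_ge0|].
have h := integral_xy_pk pow20 one0 (mpow 2) mcst1 g2 i0; rewrite R0 (Rintegral_gexp2 b0) val2 in h.
by rewrite -h; apply: eq_integral => q _; rewrite mulr1.
Qed.

Lemma pk_y2 : mu3.-integrable setT (EFin \o (fun q => q.1.2 ^+ 2 * pk t q)) /\
  Rintegral mu3 setT (fun q => q.1.2 ^+ 2 * pk t q) = 2 * t.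
Proof.
apply: mom; [by mfun|by move=> q; exact: sqr_ge0|].
have h := integral_xy_pk one0 pow20 mcst1 (mpow 2) i0 g2.
rewrite R0 (Rintegral_gexp2 b0) mulrAC val2 in h.
by rewrite -h; apply: eq_integral => q _; rewrite mul1r.
Qed.

Let val4 : (4 * pi * t)^-1 * (16 / b ^+ 2 * Num.sqrt (pi / b)) * Num.sqrt (pi / b) = 256 * t ^+ 2.
Proof.
rewrite [16 / b ^+ 2 * _]mulrC -mulrA (mulrAC (Num.sqrt _)) sqrtE mulrA mulVf// mul1r.
by rewrite /b; field; rewrite lt0r_neq0.
Qed.

(** 256 is the value of [16 / b ^+ 2] at b = 1/(4 t), divided by t^2. The exact moment is 12 t^2;
    fourth moments enter the error terms, where the order t^2 is what counts. *)
Lemma pk_x4 : mu3.-integrable setT (EFin \o (fun q => q.1.1 ^+ 4 * pk t q)) /\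
  Rintegral mu3 setT (fun q => q.1.1 ^+ 4 * pk t q) <= 256 * t ^+ 2.
Proof.
have h := integral_xy_pk pow40 one0 (mpow 4) mcst1 g4 i0; rewrite R0 in h.
have /mom[||//i ->] : (\int[mu3]_q (q.1.1 ^+ 4 * pk t q)%:E = ((4 * pi * t)^-1 *
     Rintegral mu setT (fun x => x ^+ 4 * gexp b x) * Num.sqrt (pi / b))%:E)%E.
- by rewrite -h; apply: eq_integral => q _; rewrite mulr1.
- by mfun.
- by move=> q; exact: pow40.
split => //; rewrite -val4 ler_wpM2r ?sqrtr_ge0// ler_wpM2l ?Rintegral_gexp4_le//.
by rewrite invr_ge0 ltW// mulr_gt0// mulr_gt0// pi_gt0.
Qed.

Lemma pk_y4 : mu3.-integrable setT (EFin \o (fun q => q.1.2 ^+ 4 * pk t q)) /\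
  Rintegral mu3 setT (fun q => q.1.2 ^+ 4 * pk t q) <= 256 * t ^+ 2.
Proof.
have h := integral_xy_pk one0 pow40 mcst1 (mpow 4) i0 g4; rewrite R0 mulrAC in h.
have /mom[||//i ->] : (\int[mu3]_q (q.1.2 ^+ 4 * pk t q)%:E = ((4 * pi * t)^-1 *
     Rintegral mu setT (fun x => x ^+ 4 * gexp b x) * Num.sqrt (pi / b))%:E)%E.
- by rewrite -h; apply: eq_integral => q _; rewrite mul1r.
- by mfun.
- by move=> q; exact: pow40.
split => //; rewrite -val4 ler_wpM2r ?sqrtr_ge0// ler_wpM2l ?Rintegral_gexp4_le//.
by rewrite invr_ge0 ltW// mulr_gt0// mulr_gt0// pi_gt0.
Qed.

Lemma integrable_cos_pk h : mu3.-integrable setT (EFin \o (fun q => cos (h * q.2) * pk t q)).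
Proof.
have mk := measurable_pk t0; apply: (integrable_dom (g := pk t)); last exact: integrable_pk.
  by apply: measurable_funM => //; mfun.
by move=> q; rewrite normrM (ger0_norm (pk_ge0 q t0)); apply: (ler_piMl (pk_ge0 q t0)); exact: cos_max.
Qed.

(** Levy's stochastic area formula: the planar Gaussian integral of [pk_fourier] gives hA/hB =
    1/cosh. *)
Lemma pk_cos h : Rintegral mu3 setT (fun q => cos (h * q.2) * pk t q) = (cosh (h * t))^-1.
Proof.
have iz w : mu.-integrable setT (EFin \o (fun z => cos (h * z) * pk t (w, z))).
  case: w => x y; have := integrable_cos_pk_z pk_ge0 x y t0 0 h.
  by apply: eq_integrable => // z _; rewrite /= sub0r mulrN cosN.
rewrite (Rfubini1 (integrable_cos_pk h) iz) /=.
have pin0 : (pi : R) != 0 by rewrite lt0r_neq0// pi_gt0.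
set a := hB t h / 4; have a0 : 0 < a by rewrite divr_gt0// hB_gt0.
have ga := integrable_gexp a0.
pose k := hA t h / (4 * pi).
transitivity (Rintegral mu2 setT (fun w : R * R => k * (gexp a w.1 * gexp a w.2))).
  apply: eq_Rintegral => -[x y] _; rewrite (pk_fourier pk_ge0 x y t0 h) hK_gexp /k -/a /=.
  by move: (pi : R) pin0 => p pn0; field; rewrite ?pn0.
have i2 : mu2.-integrable setT (EFin \o (fun w : R * R => gexp a w.1 * gexp a w.2)) by exact: integrable_prod.
rewrite (RintegralZl _ measurableT i2) (Rfubini1 i2); last by move=> x /=; exact: integrable_scale.
transitivity (k * Rintegral mu setT (fun x => Rintegral mu setT (gexp a) * gexp a x)).
  congr (_ * _); apply: eq_Rintegral => x _ /=; rewrite (RintegralZl _ measurableT ga); exact: mulrC.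
rewrite (RintegralZl _ measurableT ga) Rintegral_gexp// -expr2 sqr_sqrtr; last by rewrite divr_ge0 ?pi_ge0// ltW.
rewrite /k /a /hB; have A0 := lt0r_neq0 (hA_gt0 h t0); have C0 := lt0r_neq0 (cosh_gt0 (h * t)).
by move: (pi : R) pin0 => p pn0; field; rewrite A0 C0 pn0.
Qed.

Lemma inv_cosh_ge (u : R) : 1 - u ^+ 2 / 2 <= (cosh u)^-1.
Proof.
elim/(@ge0_even_ind R): u => [u|/=|u u0]; first by rewrite coshN sqrrN.
  by rewrite cosh0 expr0n /= mul0r subr0 invr1.
have c0' := cosh_gt0 u; rewrite -[X in _ <= X]mul1r ler_pdivlMr//.
(* With u = 2 v, S = sinh v, C = cosh v and C^2 - S^2 = 1 the claim becomes S^2 <= v^2 (C^2 + S^2),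
   which follows from S <= v C. *)
set v := u / 2; have v0 : 0 <= v by rewrite divr_ge0// ltW.
have -> : u = v + v by rewrite /v; field.
rewrite coshD; have s := sinh_le_cosh v0; have s0 := sinh_ge0 v0; have c1 := cosh_ge1 v.
have cs : cosh v * cosh v - sinh v * sinh v = 1.
  by have := coshD v (- v); rewrite subrr cosh0 coshN sinhN mulrN => <-.
have : sinh v ^+ 2 <= (v * cosh v) ^+ 2 by rewrite lerXn2r ?nnegrE// mulr_ge0//; lra.
move: (sinh v) (cosh v) s s0 c1 cs => S C s s0 c1 cs h.
have : 0 <= v ^+ 2 * S ^+ 2 by rewrite mulr_ge0 ?sqr_ge0.
nra.
Qed.

Lemma cos_taylor (u : R) : `|2 * (1 - cos u) - u ^+ 2| <= u ^+ 4 / 12.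
Proof.
elim/(@ge0_even_ind R): u => [u|/=|u u0]; first by rewrite cosN sqrrN -[4%N]/(2 * 2)%N !exprM sqrrN.
  by rewrite cos0 subrr mulr0 !expr0n /= subrr normr0 mul0r.
have dc (x : R) := is_derive_cos x; have ds (x : R) := is_derive_sin x.
have s1 (x : R) : 0 <= x -> 0 <= x - sin x.
  have d (z : R) : is_derive z (1 : R) (fun x => x - sin x) (1 - cos z).
    by have := ds z => e; apply: is_derive_eq.
  have g (z : R) : 0 <= z -> 0 <= 1 - cos z by move=> _; rewrite subr_ge0 cos_le1.
  by move=> /(ge0_derive_le d g); rewrite sin0 subrr.
have c1 (x : R) : 0 <= x -> 0 <= x ^+ 2 / 2 - 1 + cos x.
  have d (z : R) : is_derive z (1 : R) (fun x => x ^+ 2 / 2 - 1 + cos x) (z - sin z).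
    by have := dc z => e; apply: is_derive_eq; rewrite /GRing.scale /=; field.
  by move=> /(ge0_derive_le d s1); rewrite cos0 expr0n /= mul0r sub0r addNr.
have s2 (x : R) : 0 <= x -> 0 <= sin x - x + x ^+ 3 / 6.
  have d (z : R) : is_derive z (1 : R) (fun x => sin x - x + x ^+ 3 / 6) (z ^+ 2 / 2 - 1 + cos z).
    by have := ds z => e; apply: is_derive_eq; rewrite /GRing.scale /=; field.
  by move=> /(ge0_derive_le d c1); rewrite sin0 expr0n /= mul0r subrr addr0.
have c2 (x : R) : 0 <= x -> 0 <= x ^+ 4 / 24 - x ^+ 2 / 2 + 1 - cos x.
  have d (z : R) : is_derive z (1 : R) (fun x => x ^+ 4 / 24 - x ^+ 2 / 2 + 1 - cos x) (sin z - z + z ^+ 3 / 6).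
    by have := dc z => e; apply: is_derive_eq; rewrite /GRing.scale /=; field.
  by move=> /(ge0_derive_le d s2); rewrite cos0 !expr0n /= !mul0r subrr add0r subrr.
have := c1 u (ltW u0); have := c2 u (ltW u0); have : 0 <= u ^+ 4 by exact: pow40.
by move=> h1 h2 h3; rewrite ler_norml; apply/andP; split; lra.
Qed.

(* Fatou along [2 n^2 (1 - cos (z / n))], whose expectation is explicit. *)
Lemma pk_z2 : mu3.-integrable setT (EFin \o (fun q => q.2 ^+ 2 * pk t q)) /\
  Rintegral mu3 setT (fun q => q.2 ^+ 2 * pk t q) <= t ^+ 2.
Proof.
have mk := measurable_pk t0.
apply: le_integrable_EFin.
- by apply: measurable_funM => //; mfun.
- by move=> q; rewrite mulr_ge0 ?sqr_ge0// pk_ge0.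
pose hn (n : nat) : R := n.+1%:R^-1.
have hn0 n : 0 < hn n by rewrite invr_gt0.
pose c n q : R := 2 / hn n ^+ 2 * (1 - cos (hn n * q.2)) * pk t q.
have ic n q : c n q = 2 / hn n ^+ 2 * (pk t q - cos (hn n * q.2) * pk t q).
  by rewrite /c -mulrA; congr (_ * _); ring.
have iF n : mu3.-integrable setT (EFin \o (fun q => pk t q - cos (hn n * q.2) * pk t q)).
  by apply: integrable_sub; [exact: integrable_pk|exact: integrable_cos_pk].
apply: (fatou_bound (f_ := c)).
- move=> n; rewrite (funext (ic n)); exact: integrable_meas (integrable_scale _ (iF n)).
- move=> n q; apply: mulr_ge0; last exact: pk_ge0.
  by apply: mulr_ge0; [rewrite divr_ge0// sqr_ge0|rewrite subr_ge0 cos_le1].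
- move=> q; apply: cvgM; last exact: cvg_cst.
  have hz : (fun n => q.2 ^+ 4 / 12 * hn n ^+ 2) @ \oo --> (0 : R).
    rewrite -[X in _ --> X](mulr0 (q.2 ^+ 4 / 12)); apply: cvgM; first exact: cvg_cst.
    rewrite -[X in _ --> X](mul0r 0); under eq_fun do rewrite expr2.
    by apply: cvgM; exact: cvg_harmonic.
  have hd : (fun n => 2 / hn n ^+ 2 * (1 - cos (hn n * q.2)) - q.2 ^+ 2) @ \oo --> (0 : R).
    apply: norm_cvg0; apply: (squeeze_cvgr _ _ hz); last exact: cvg_cst.
    apply: nearW => n; rewrite normr_ge0 /=.
    have h0 := lt0r_neq0 (hn0 n).
    have -> : 2 / hn n ^+ 2 * (1 - cos (hn n * q.2)) - q.2 ^+ 2 =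
      (hn n ^+ 2)^-1 * (2 * (1 - cos (hn n * q.2)) - (hn n * q.2) ^+ 2) by field.
    have p0 : 0 < (hn n ^+ 2)^-1 by rewrite invr_gt0 exprn_gt0.
    rewrite normrM (gtr0_norm p0) mulrC -ler_pdivlMr// invrK.
    apply: le_trans (cos_taylor _) _; rewrite le_eqVlt; apply/orP; left; apply/eqP; ring.
  by apply/subr_cvg0; exact: hd.
- move=> n; rewrite (@eq_integral _ _ _ mu3 setT (fun q => (2 / hn n ^+ 2 * (pk t q - cos (hn n * q.2) * pk t q))%:E)); last by move=> q _; rewrite ic.
  rewrite (EFin_Rintegral (integrable_scale _ (iF n))) lee_fin (RintegralZl _ measurableT (iF n)).
  rewrite (RintegralB measurableT integrable_pk (integrable_cos_pk _)) Rintegral_pk pk_cos.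
  have := inv_cosh_ge (hn n * t); set v := (cosh _)^-1 => hv.
  have h0 := hn0 n.
  rewrite mulrAC ler_pdivrMr ?exprn_gt0//.
  have -> : t ^+ 2 * hn n ^+ 2 = (hn n * t) ^+ 2 by ring.
  lra.
Qed.

(** Degree 4 for the dilations: enough to dominate the largest integrands met below, such as
    [hrem q ^+ 2] and the majorant [E3]. *)
Definition weight (q : heis R) : R := 1 + q.1.1 ^+ 4 + q.1.2 ^+ 4 + q.2 ^+ 2.

Lemma weight_ge1 q : 1 <= weight q.
Proof. by rewrite /weight; have := pow40 q.1.1; have := pow40 q.1.2; have := pow20 q.2; lra. Qed.

Lemma measurable_weight : measurable_fun setT weight. Proof. by rewrite /weight; mfun. Qed.

Lemma integrable_weight : mu3.-integrable setT (EFin \o (fun q => weight q * pk t q)).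
Proof.
have [i1 _] := pk_x4; have [i2 _] := pk_y4; have [i3 _] := pk_z2.
have := integrable_add (integrable_add (integrable_add integrable_pk i1) i2) i3.
by apply: eq_integrable => // q _; rewrite /= /weight !mulrDl mul1r.
Qed.

Lemma integrable_adm (F : heis R -> R) (C : R) : measurable_fun setT F ->
  (forall q, `|F q| <= C * weight q) -> mu3.-integrable setT (EFin \o (fun q => F q * pk t q)).
Proof.
move=> mF hF; have mk := measurable_pk t0.
apply: (integrable_dom (g := fun q => C * (weight q * pk t q))).
- exact: measurable_funM.
- by move=> q; rewrite normrM (ger0_norm (pk_ge0 q t0)) mulrA ler_wpM2r ?pk_ge0.
- exact: integrable_scale integrable_weight.
Qed.

Lemma pk_rho q : pk t (rho q) = pk t q.
Proof. by rewrite /pk /rho /= sqrrN (addrC (q.1.2 ^+ 2)). Qed.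

(** Source of the vanishing moments: [rho] changes the sign of xy, and [rho] applied twice changes
    that of x. *)
Lemma Rintegral_rho_pk (F : heis R -> R) : mu3.-integrable setT (EFin \o (fun q => F q * pk t q)) ->
  Rintegral mu3 setT (fun q => F (rho q) * pk t q) = Rintegral mu3 setT (fun q => F q * pk t q).
Proof.
move=> iF.
have tr (g : heis R -> \bar R) : measurable_fun setT g -> (forall x, 0 <= g x)%E ->
    (\int[mu3]_x g (rho x) = 1%:E * \int[mu3]_x g x)%E.
  by move=> mg g0; rewrite ge0_integral_rho// mul1e.
have := Rintegral_transfer tr iF; rewrite mul1r => <-.
by apply: eq_Rintegral => q _; rewrite /= pk_rho.
Qed.

Let int_x : mu3.-integrable setT (EFin \o (fun q => q.1.1 * pk t q)).
Proof.
apply: (integrable_adm (C := 1)); [by mfun|move=> q; rewrite mul1r /weight].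
have := pow20 q.2; have := pow40 q.1.2; have := sqr_ge0 (q.1.1 ^+ 2 - 2^-1).
have := sqr_ge0 (q.1.1 - 2^-1); have := sqr_ge0 (q.1.1 + 2^-1).
by move=> *; rewrite ler_norml; apply/andP; split; nra.
Qed.

Let int_xy : mu3.-integrable setT (EFin \o (fun q => (q.1.1 * q.1.2) * pk t q)).
Proof.
apply: (integrable_adm (C := 1)); [by mfun|move=> q; rewrite mul1r /weight].
have := pow20 q.2; have := sqr_ge0 (q.1.2 ^+ 2 - 2^-1); have := sqr_ge0 (q.1.1 ^+ 2 - 2^-1).
have := sqr_ge0 (q.1.1 - q.1.2); have := sqr_ge0 (q.1.1 + q.1.2).
by move=> *; rewrite ler_norml; apply/andP; split; nra.
Qed.

Lemma pk_x : Rintegral mu3 setT (fun q => q.1.1 * pk t q) = 0.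
Proof.
have i1 := Rintegral_rho_pk int_x.
have iy : mu3.-integrable setT (EFin \o (fun q => (rho q).1.1 * pk t q)).
  apply: (integrable_adm (C := 1)); [by rewrite /rho; mfun|move=> q; rewrite mul1r /weight /rho /=].
  have := pow20 q.2; have := pow40 q.1.1; have := sqr_ge0 (q.1.2 ^+ 2 - 2^-1).
  have := sqr_ge0 (q.1.2 - 2^-1); have := sqr_ge0 (q.1.2 + 2^-1).
  by move=> *; rewrite ler_norml; apply/andP; split; nra.
have := Rintegral_rho_pk (F := fun q => (rho q).1.1) iy; rewrite i1.
have -> : (fun q : heis R => (rho (rho q)).1.1 * pk t q) = (fun q => - 1 * (q.1.1 * pk t q)).
  by apply/funext => q; rewrite /rho /=; ring.
by rewrite (RintegralZl _ measurableT int_x); lra.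
Qed.

Lemma pk_y : Rintegral mu3 setT (fun q => q.1.2 * pk t q) = 0.
Proof. by rewrite -[RHS]pk_x -(Rintegral_rho_pk int_x). Qed.

Lemma pk_xy : Rintegral mu3 setT (fun q => (q.1.1 * q.1.2) * pk t q) = 0.
Proof.
have := Rintegral_rho_pk (F := fun q => q.1.1 * q.1.2) int_xy.
have -> : (fun q : heis R => (rho q).1.1 * (rho q).1.2 * pk t q) = (fun q => - 1 * ((q.1.1 * q.1.2) * pk t q)).
  by apply/funext => q; rewrite /rho /=; ring.
by rewrite (RintegralZl _ measurableT int_xy); lra.
Qed.

End moments.

(** * The Chapman-Kolmogorov identity *)

Section gaussian_product.
Context {R : realType}.
Local Notation mu := (@mu1 R).
Variables (al be d phi k : R).
Hypotheses (al0 : 0 < al) (be0 : 0 < be).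

Let f y : R := gexp al y * gexp be (d - y) * cos (phi + k * y).

Lemma integrable_gauss_product : mu.-integrable setT (EFin \o f).
Proof.
apply: (integrable_dom (g := gexp al)); [by rewrite /f /gexp; mfun| |exact: integrable_gexp].
move=> y; rewrite /f 2!normrM (ger0_norm (gexp_ge0 al y)) (ger0_norm (gexp_ge0 be (d - y))) -mulrA.
apply: (ler_piMr (gexp_ge0 al y)); rewrite mulr_ile1 ?cos_max ?gexp_ge0//.
by rewrite /gexp expR_le1 oppr_le0 mulr_ge0 ?sqr_ge0// ltW.
Qed.

(** Complete the square: the product of the two Gaussians is a Gaussian of rate [al + be] centred at
    [m]. After centring, the sine part of the phase is odd and integrates to 0. *)
Lemma Rintegral_gauss_product : Rintegral mu setT f =
  gexp (al * be / (al + be)) d * (Num.sqrt (pi / (al + be)) *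
    expR (- (k ^+ 2 / (4 * (al + be)))) * cos (phi + k * d * (be / (al + be)))).
Proof.
set si := al + be; have si0 : 0 < si by exact: addr_gt0.
have sin0' := lt0r_neq0 si0.
pose m := be * d / si.
have := Rintegral_aff m (oner_neq0 R) integrable_gauss_product; rewrite normr1 invr1 mul1r => <-.
have ic := integrable_gexp_cos k si0.
have is_ : mu.-integrable setT (EFin \o (fun w => gexp si w * sin (k * w))).
  apply: (integrable_dom (g := gexp si)); [by rewrite /gexp; mfun| |exact: integrable_gexp].
  by move=> y; rewrite normrM (ger0_norm (gexp_ge0 _ _)); apply: (ler_piMr (gexp_ge0 _ _)); exact: sin_max.
pose c := gexp (al * be / si) d.
transitivity (Rintegral mu setT (fun w => c * cos (phi + k * m) * (gexp si w * cos (k * w))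
   + (- (c * sin (phi + k * m))) * (gexp si w * sin (k * w)))).
  apply: eq_Rintegral => w _; rewrite /f mul1r.
  have -> : gexp al (w + m) * gexp be (d - (w + m)) = c * gexp si w.
    rewrite /c /gexp -!expRD; congr expR; rewrite /m.
    have -> : al = si - be by rewrite /si; ring.
    by field.
  have -> : phi + k * (w + m) = (phi + k * m) + k * w by ring.
  by rewrite cosD; ring.
rewrite (RintegralD measurableT (integrable_scale _ ic) (integrable_scale _ is_)).
rewrite (RintegralZl _ measurableT ic) (RintegralZl _ measurableT is_).
rewrite (Rintegral_odd is_); last first.
  by move=> x; rewrite /gexp sqrrN mulrN sinN mulrN.
rewrite Rintegral_gexp_cos// mulr0 addr0.
have -> : k * m = k * d * (be / si) by rewrite /m; field.
by rewrite /c; ring.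
Qed.

End gaussian_product.

Section chapman_kolmogorov.
Context {R : realType}.
Local Notation mu := (@mu1 R).
Hypothesis pk_ge0 : forall (t : R) q, 0 < t -> 0 <= pk t q.
Variables (s t : R).
Hypotheses (s0 : 0 < s) (t0 : 0 < t).

(** What the vertical integration leaves of the convolution at frequency [l], up to a constant; the
    phase carries the area term of [hmul (hinv a) b]. *)
Let Fw (bx by_ bz : R) (w : R * R) (l : R) : R :=
  cos (l * (bz + 2^-1 * (w.2 * bx - w.1 * by_))) *
  (hK s (w.1 ^+ 2 + w.2 ^+ 2) l * hK t ((bx - w.1) ^+ 2 + (by_ - w.2) ^+ 2) l).

Let mhK' (u : R) d (T : measurableType d) (f g : T -> R) : 0 < u -> measurable_fun setT f ->
  measurable_fun setT g -> measurable_fun setT (fun x => hK u (f x) (g x)).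
Proof.
by move=> u0 mf mg; apply: (measurableT_comp (measurable_hK_joint u0) (g := fun x => (f x, g x))); mfun.
Qed.

Let Fw_meas bx by_ bz : measurable_fun setT (fun v : (R * R) * R => Fw bx by_ bz v.1 v.2).
Proof.
have h1 := @mhK' s _ (R * R * R)%type (fun v => v.1.1 ^+ 2 + v.1.2 ^+ 2) (fun v => v.2) s0 ltac:(mfun) ltac:(mfun).
have h2 := @mhK' t _ (R * R * R)%type (fun v => (bx - v.1.1) ^+ 2 + (by_ - v.1.2) ^+ 2) (fun v => v.2) t0 ltac:(mfun) ltac:(mfun).
have h3 := measurable_funM h1 h2.
by apply: measurable_funM h3; mfun.
Qed.

Let gs := (4 * s)^-1.
Let gs0 : 0 < gs. Proof. by rewrite invr_gt0 mulr_gt0. Qed.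

Let Fw_bound bx by_ bz w l : `|Fw bx by_ bz w l| <= (gexp gs w.1 * gexp gs w.2) * (s^-1 * hA t l).
Proof.
have r0 : 0 <= w.1 ^+ 2 + w.2 ^+ 2 by rewrite addr_ge0 ?sqr_ge0.
have r0' : 0 <= (bx - w.1) ^+ 2 + (by_ - w.2) ^+ 2 by rewrite addr_ge0 ?sqr_ge0.
set r := _ + _ in r0; set r' := _ + _ in r0'.
have K1 := hK_gt0 r l s0; have K2 := hK_gt0 r' l t0.
have e : gexp gs w.1 * gexp gs w.2 = expR (- (r / (4 * s))).
  by rewrite /gexp -expRD /gs /r; congr expR; field; exact: lt0r_neq0.
rewrite /Fw normrM (ger0_norm (mulr_ge0 (ltW K1) (ltW K2))).
apply: (le_trans (ler_piMl (mulr_ge0 (ltW K1) (ltW K2)) (cos_max _))).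
rewrite e [X in _ <= X]mulrA; apply: ler_pM; [exact: (ltW K1)|exact: (ltW K2)| |exact: (hK_le_hA l t0 r0')].
apply: le_trans (hK_le l s0 r0) _; rewrite ler_wpM2l ?expR_ge0//; exact: hA_le.
Qed.

Let normM_le (u v c : R) : 0 <= u -> `|v| <= c -> `|u * v| <= c * u.
Proof. by move=> u0 vc; rewrite normrM (ger0_norm u0) mulrC ler_wpM2r. Qed.

Let iG2 : mu2.-integrable setT (EFin \o (fun w : R * R => gexp gs w.1 * gexp gs w.2)).
Proof. by apply: integrable_prod; exact: integrable_gexp. Qed.

Let iFw bx by_ bz : (prodm mu2 mu).-integrable setT (EFin \o (fun v : (R * R) * R => Fw bx by_ bz v.1 v.2)).
Proof.
have i2 := integrable_prod iG2 (integrable_scale s^-1 (integrable_hA t0)).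
exact: (integrable_dom (Fw_meas bx by_ bz) (fun v => Fw_bound bx by_ bz v.1 v.2) i2).
Qed.

Let iFw1 bx by_ bz w : mu.-integrable setT (EFin \o (fun l => Fw bx by_ bz w l)).
Proof.
apply: (integrable_dom _ (fun l => Fw_bound bx by_ bz w l)).
  by apply: (measurableT_comp (Fw_meas bx by_ bz) (g := fun l => (w, l))); mfun.
by do 2 apply: integrable_scale; exact: integrable_hA.
Qed.

Let iFw2 bx by_ bz l : mu2.-integrable setT (EFin \o (fun w => Fw bx by_ bz w l)).
Proof.
apply: (integrable_dom (g := fun w => (s^-1 * hA t l) * (gexp gs w.1 * gexp gs w.2))).
- by apply: (measurableT_comp (Fw_meas bx by_ bz) (g := fun w => (w, l))); mfun.
- by move=> w; rewrite mulrC; exact: Fw_bound.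
- exact: integrable_scale.
Qed.

Let Fw_int bx by_ bz l : Rintegral mu2 setT (fun w => Fw bx by_ bz w l) =
  4 * pi * (cos (l * bz) * hK (s + t) (bx ^+ 2 + by_ ^+ 2) l).
Proof.
set al := hB s l / 4; have al0 : 0 < al by rewrite divr_gt0// hB_gt0.
set be := hB t l / 4; have be0 : 0 < be by rewrite divr_gt0// hB_gt0.
set si := al + be; have si0 : 0 < si by exact: addr_gt0.
have sn0 := lt0r_neq0 si0.
have FE x y : Fw bx by_ bz (x, y) l = (hA s l * hA t l * (gexp al x * gexp be (bx - x))) *
    (gexp al y * gexp be (by_ - y) * cos ((l * bz - l * x * by_ / 2) + (l * bx / 2) * y)).
  rewrite /Fw /= !hK_gexp -/al -/be.
  have -> : l * (bz + 2^-1 * (y * bx - x * by_)) = (l * bz - l * x * by_ / 2) + (l * bx / 2) * y by field.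
  ring.
rewrite (Rfubini1 (iFw2 bx by_ bz l)); last first.
  move=> x; have := integrable_scale (hA s l * hA t l * (gexp al x * gexp be (bx - x)))
    (integrable_gauss_product by_ (l * bz - l * x * by_ / 2) (l * bx / 2) al0 be0).
  by apply: eq_integrable => // y _; rewrite /= FE.
(* The integration in y returns the constant [E1] and a phase that is again affine in x, so the same
   Gaussian lemma applies a second time. *)
pose E1 : R := gexp (al * be / si) by_ * (Num.sqrt (pi / si) * expR (- ((l * bx / 2) ^+ 2 / (4 * si)))).
pose psi : R := l * bz + l * bx / 2 * by_ * (be / si).
transitivity (Rintegral mu setT (fun x => (hA s l * hA t l * E1) *
    (gexp al x * gexp be (bx - x) * cos (psi + (- (l * by_ / 2)) * x)))).
  apply: eq_Rintegral => x _.
  transitivity (Rintegral mu setT (fun y => (hA s l * hA t l * (gexp al x * gexp be (bx - x))) *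
    (gexp al y * gexp be (by_ - y) * cos ((l * bz - l * x * by_ / 2) + (l * bx / 2) * y)))).
    by apply: eq_Rintegral => y _; rewrite FE.
  rewrite (RintegralZl _ measurableT (integrable_gauss_product _ _ _ al0 be0)) Rintegral_gauss_product// -/si.
  have -> : l * bz - l * x * by_ / 2 + l * bx / 2 * by_ * (be / si) = psi + (- (l * by_ / 2)) * x.
    by rewrite /psi; field.
  by rewrite /E1; ring.
rewrite (RintegralZl _ measurableT (integrable_gauss_product _ _ _ al0 be0)) Rintegral_gauss_product// -/si.
(* The phase shifts caused by the two integrations cancel. *)
have -> : psi + - (l * by_ / 2) * bx * (be / si) = l * bz by rewrite /psi; field.
have sq : Num.sqrt (pi / si) * Num.sqrt (pi / si) = pi / si.
  by rewrite -expr2 sqr_sqrtr// divr_ge0 ?pi_ge0// ltW.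
have hsum := hAB_sum l s0 t0; have hadd := hB_add l s0 t0.
have B : hB s l + hB t l = 4 * si by rewrite /si /al /be; field.
transitivity (hA s l * hA t l * (Num.sqrt (pi / si) * Num.sqrt (pi / si)) * cos (l * bz) *
  ((gexp (al * be / si) bx * expR (- ((- (l * by_ / 2)) ^+ 2 / (4 * si)))) *
   (gexp (al * be / si) by_ * expR (- ((l * bx / 2) ^+ 2 / (4 * si)))))).
  by rewrite /E1; ring.
rewrite sq -hsum B hK_gexp.
(* The two integrations leave the same rate in [bx] and in [by_]; [hB_add] identifies it with the
   rate at time [s + t]. *)
have e : al * be / si + l ^+ 2 / (16 * si) = hB (s + t) l / 4.
  have -> : al * be / si + l ^+ 2 / (16 * si) = (hB s l * hB t l + l ^+ 2) / (16 * si).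
    by rewrite /al /be; field.
  by rewrite hadd B; field.
have -> : (gexp (al * be / si) bx * expR (- ((- (l * by_ / 2)) ^+ 2 / (4 * si)))) *
   (gexp (al * be / si) by_ * expR (- ((l * bx / 2) ^+ 2 / (4 * si)))) =
   gexp (hB (s + t) l / 4) bx * gexp (hB (s + t) l / 4) by_.
  by rewrite -e /gexp -!expRD; congr expR; field.
by field.
Qed.

(* After the Fourier transform in [z] the convolution becomes a planar Gaussian
   integral; [hAB_sum] and [hB_add] are the addition rules for coth it requires. *)
Lemma pk_convolution b : Rintegral mu3 setT (fun a => pk s a * pk t (hmul (hinv a) b)) = pk (s + t) b.
Proof.
case: b => [[bx by_] bz].
have ms := measurable_pk s0; have mt := measurable_pk t0.
have minv : measurable_fun setT (fun a : heis R => hmul (hinv a) (bx, by_, bz)).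
  by rewrite /hinv /=; mfun.
have mm : measurable_fun setT (fun a => pk s a * pk t (hmul (hinv a) (bx, by_, bz))).
  exact: (measurable_funM ms (measurableT_comp mt minv)).
have bd a : `|pk s a * pk t (hmul (hinv a) (bx, by_, bz))| <= cA t * pk s a.
  exact: (normM_le (pk_ge0 a s0) (pk_le _ t0)).
rewrite Rfubini1; last 2 first.
- exact: (integrable_dom mm bd (integrable_scale (cA t) (integrable_pk pk_ge0 s0))).
- case=> x y; have mk3 : measurable_fun setT (fun z : R => (x, y, z)) by mfun.
  exact: (integrable_dom (measurableT_comp mm mk3) (fun z => bd (x, y, z))
    (integrable_scale (cA t) (integrable_pk_z pk_ge0 x y s0))).
transitivity (Rintegral mu2 setT (fun w => cpi / (4 * pi) * Rintegral mu setT (fun l => Fw bx by_ bz w l))).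
  apply: eq_Rintegral => -[x y] _.
  set c := bz + 2^-1 * (y * bx - x * by_).
  pose K' l : R := hK t ((bx - x) ^+ 2 + (by_ - y) ^+ 2) l.
  have K'0 l : 0 <= K' l by exact: ltW (hK_gt0 _ l t0).
  have r0 : 0 <= (bx - x) ^+ 2 + (by_ - y) ^+ 2 by rewrite addr_ge0 ?sqr_ge0.
  have iK' : mu.-integrable setT (EFin \o K') by exact: integrable_hK.
  have mK' : measurable_fun setT K' by exact: measurable_hK.
  have mz := measurable_pk_z x y s0.
  have iz := integrable_pk_z pk_ge0 x y s0.
  pose G (v : R * R) := pk s (x, y, v.1) * (cos (v.2 * (c - v.1)) * K' v.2).
  have mG : measurable_fun setT G.
    have h1 : measurable_fun setT (fun v : R * R => pk s (x, y, v.1)) by exact: (measurableT_comp mz measurable_fst).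
    have h2 : measurable_fun setT (fun v : R * R => K' v.2) by exact: (measurableT_comp mK' measurable_snd).
    by rewrite /G; mfun.
  have Gb v : `|G v| <= pk s (x, y, v.1) * K' v.2.
    rewrite /G normrM (ger0_norm (pk_ge0 _ s0)) ler_wpM2l ?pk_ge0// normrM (ger0_norm (K'0 _)).
    by apply: (ler_piMl (K'0 _)); exact: cos_max.
  have iG : mu2.-integrable setT (EFin \o G).
    by apply: (integrable_dom mG Gb); exact: (integrable_prod iz iK').
  have iG1 z : mu.-integrable setT (EFin \o (fun l => G (z, l))).
    have mk2 : measurable_fun setT (fun l : R => (z, l)) by mfun.
    exact: (integrable_dom (measurableT_comp mG mk2) (fun l => Gb (z, l)) (integrable_scale (pk s (x, y, z)) iK')).
  have iG2' l : mu.-integrable setT (EFin \o (fun z => G (z, l))).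
    apply: (integrable_dom (g := fun z => K' l * pk s (x, y, z))); last exact: (integrable_scale (K' l) iz).
      by apply: (measurableT_comp mG (g := fun z => (z, l))); mfun.
    by move=> z; rewrite mulrC; exact: Gb.
  have icos z : mu.-integrable setT (EFin \o (fun l => cos (l * (c - z)) * K' l)) by exact: integrable_cos_hK.
  have iGG : mu.-integrable setT (EFin \o (fun z => Rintegral mu setT (fun l => G (z, l)))).
    have := integrable_fubini_F iG; rewrite /fubini_F; apply: eq_integrable => // z _.
    by rewrite /= (EFin_Rintegral (iG1 z)).
  transitivity (Rintegral mu setT (fun z => cpi * Rintegral mu setT (fun l => G (z, l)))).
    apply: eq_Rintegral => z _; rewrite /G /= (RintegralZl _ measurableT (icos z)) /hinv /= {2}/pk /=.
    have -> : - z + bz + 2^-1 * (- x * by_ - - y * bx) = c - z by rewrite /c; ring.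
    by rewrite (addrC (- x)) (addrC (- y)) /K'; ring.
  rewrite (RintegralZl _ measurableT iGG) (Rfubini iG iG1 iG2') -mulrA; congr (_ * _).
  rewrite -(RintegralZl _ measurableT (iFw1 bx by_ bz (x, y))).
  apply: eq_Rintegral => l _; rewrite /G /=.
  transitivity (Rintegral mu setT (fun z => K' l * (cos (l * (c - z)) * pk s (x, y, z)))).
    by apply: eq_Rintegral => z _; ring.
  rewrite (RintegralZl _ measurableT (integrable_cos_pk_z pk_ge0 x y s0 c l)) pk_fourier_shift//.
  by rewrite /Fw /= -/c /K'; ring.
have iFF : mu2.-integrable setT (EFin \o (fun w => Rintegral mu setT (fun l => Fw bx by_ bz w l))).
  have := integrable_fubini_F (iFw bx by_ bz); rewrite /fubini_F; apply: eq_integrable => // z _.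
  by rewrite /= (EFin_Rintegral (iFw1 bx by_ bz z)).
rewrite (RintegralZl _ measurableT iFF).
rewrite (Rfubini (F := fun v => Fw bx by_ bz v.1 v.2) (iFw bx by_ bz) (iFw1 bx by_ bz) (iFw2 bx by_ bz)).
transitivity (cpi / (4 * pi) * Rintegral mu setT
    (fun l : R => 4 * pi * (cos (l * bz) * hK (s + t) (bx ^+ 2 + by_ ^+ 2) l))).
  by congr (_ * _); apply: eq_Rintegral => l _; exact: Fw_int.
have st0 := addr_gt0 s0 t0.
rewrite (RintegralZl _ measurableT (integrable_cos_hK _ st0 (r2_ge0 (bx, by_, bz)))) /pk /=.
have : (pi : R) != 0 by rewrite lt0r_neq0// pi_gt0.
by move: (pi : R) => p p0; field; rewrite p0.
Qed.

Lemma pk_scale q : pk t q = (t ^+ 2)^-1 * pk 1 (dil (Num.sqrt t)^-1 q).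
Proof.
have rt0 : 0 < Num.sqrt t by rewrite sqrtr_gt0.
have sq : Num.sqrt t ^+ 2 = t by rewrite sqr_sqrtr// ltW.
have tn0 := lt0r_neq0 t0.
have sqV : (Num.sqrt t)^-1 ^+ 2 = t^-1 by rewrite exprVn sq.
case: q => [[x y] z]; rewrite /pk /dil /tri /= !addr0 sqV !exprMn sqV -mulrDr.
set r := x ^+ 2 + y ^+ 2; have r0 : 0 <= r by exact: (r2_ge0 (x, y, z)).
have r0' : 0 <= t^-1 * r by rewrite mulr_ge0// invr_ge0 ltW.
have ic : mu.-integrable setT (EFin \o (fun l => cos (l * (t^-1 * z)) * hK 1 (t^-1 * r) l)) by exact: integrable_cos_hK.
have := Rintegral_aff 0 tn0 ic; rewrite (gtr0_norm t0) => h.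
have -> : (t ^+ 2)^-1 = t^-1 * t^-1 by rewrite expr2 invfM.
rewrite mulrCA; congr (_ * _); rewrite -mulrA -h.
have ic' := integrable_aff 0 tn0 ic.
rewrite -(RintegralZl _ measurableT ic'); apply: eq_Rintegral => l _.
rewrite addr0 /hK (hA_scale l t0) (hB_scale l t0) (mulrC t l).
have -> : l * t * (t^-1 * z) = l * z by field.
have -> : r / 4 * (t^-1 * hB 1 (l * t)) = t^-1 * r / 4 * hB 1 (l * t) by ring.
ring.
Qed.

End chapman_kolmogorov.

(** * The heat semigroup on bounded functions *)

Section composition.
Context {R : realType}.
Local Notation mu := (@mu1 R).
Local Notation mu6 := (prodm (prodm (prodm mu mu) mu) (prodm (prodm mu mu) mu)).
Hypothesis pk_ge0 : forall (t : R) q, 0 < t -> 0 <= pk t q.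

Lemma hmulE (a q : heis R) : hmul a q =
  (a.1.1 + q.1.1, a.1.2 + q.1.2, a.2 + q.2 + 2^-1 * (a.1.1 * q.1.2 - a.1.2 * q.1.1)).
Proof. by case: a => [[? ?] ?]; case: q => [[? ?] ?]. Qed.

Lemma hmulA (a b c : heis R) : hmul (hmul a b) c = hmul a (hmul b c).
Proof. by rewrite !hmulE /=; congr (_, _, _); ring. Qed.

Lemma measurable_hmul2 : measurable_fun setT (fun w : heis R * heis R => hmul w.1 w.2).
Proof.
have -> : (fun w : heis R * heis R => hmul w.1 w.2) = (fun w => (w.1.1.1 + w.2.1.1, w.1.1.2 + w.2.1.2,
  w.1.2 + w.2.2 + 2^-1 * (w.1.1.1 * w.2.1.2 - w.1.1.2 * w.2.1.1))) by apply/funext => w; rewrite hmulE.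
by mfun.
Qed.

(** For a fixed first component the map is a left translation, which preserves Lebesgue measure. *)
Lemma ge0_integral_comp (G : heis R * heis R -> R) : measurable_fun setT G -> (forall w, 0 <= G w) ->
  (\int[mu6]_w (G (w.1, hmul w.1 w.2))%:E = \int[mu6]_w (G w)%:E)%E.
Proof.
move=> mG G0.
have mG' : measurable_fun setT (fun w => (G w)%:E) by apply/measurable_EFinP.
have mh : measurable_fun setT (fun w : heis R * heis R => (w.1, hmul w.1 w.2)).
  by apply: measurable_fun_pair; [exact: measurable_fst|exact: measurable_hmul2].
have G0' w : (0 <= (G w)%:E)%E by rewrite lee_fin.
have -> := @fubini_tonelli1 _ _ _ _ R _ _ _ mG' G0'.
have -> := @fubini_tonelli1 _ _ _ _ R _ _ _ (measurableT_comp mG' mh) (fun w => G0' _).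
apply: eq_integral => a _; rewrite /fubini_F /=.
have ma : measurable_fun setT (fun q => (G (a, q))%:E).
  by apply: (measurableT_comp mG' (g := fun q => (a, q))); exact: measurable_fun_pair.
exact: (ge0_integral_hmul a ma (fun q => G0' (a, q))).
Qed.

Variables (s t : R).
Hypotheses (s0 : 0 < s) (t0 : 0 < t).
Let st0 : 0 < s + t. Proof. exact: addr_gt0. Qed.
Let ms := measurable_pk s0.
Let mt := measurable_pk t0.
Let mst := measurable_pk st0.

Let F6 (phi : heis R -> R) (w : heis R * heis R) : R := phi (hmul w.1 w.2) * (pk s w.1 * pk t w.2).

Let mF6 (phi : heis R -> R) : measurable_fun setT phi -> measurable_fun setT (F6 phi).
Proof.
move=> mphi; apply: (measurable_funM (measurableT_comp mphi measurable_hmul2)).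
exact: (measurable_funM (measurableT_comp ms measurable_fst) (measurableT_comp mt measurable_snd)).
Qed.

Lemma measurable_hinv_hmul : measurable_fun setT (fun w : heis R * heis R => hmul (hinv w.1) w.2).
Proof.
have mi : measurable_fun setT (fun w : heis R * heis R => (hinv w.1, w.2)) by rewrite /hinv; mfun.
exact: (measurableT_comp measurable_hmul2 mi).
Qed.

Let ge0_comp (phi : heis R -> R) : measurable_fun setT phi -> (forall b, 0 <= phi b) ->
  (\int[mu6]_w (F6 phi w)%:E = \int[mu3]_b (phi b * pk (s + t) b)%:E)%E.
Proof.
move=> mphi phi0.
pose G (w : heis R * heis R) := phi w.2 * (pk s w.1 * pk t (hmul (hinv w.1) w.2)).
have mG : measurable_fun setT G.
  apply: (measurable_funM (measurableT_comp mphi measurable_snd)).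
  exact: (measurable_funM (measurableT_comp ms measurable_fst) (measurableT_comp mt measurable_hinv_hmul)).
have G0 w : 0 <= G w by exact: (mulr_ge0 (phi0 _) (mulr_ge0 (pk_ge0 _ s0) (pk_ge0 _ t0))).
have mG' : measurable_fun setT (fun w => (G w)%:E) by apply/measurable_EFinP.
have G0' w : (0 <= (G w)%:E)%E by rewrite lee_fin.
transitivity (\int[mu6]_w (G w)%:E)%E.
  apply: etrans; last exact: (ge0_integral_comp mG G0).
  apply: eq_integral => w _.
  by rewrite /F6 /G; cbn [fst snd]; rewrite hmulVK.
have -> := @fubini_tonelli2 _ _ _ _ R _ _ _ mG' G0'.
apply: eq_integral => b _; rewrite /fubini_G /=.
have mm : measurable_fun setT (fun a => pk s a * pk t (hmul (hinv a) b)).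
  apply: (measurable_funM ms); apply: (measurableT_comp mt).
  apply: (measurableT_comp measurable_hinv_hmul (g := fun a => (a, b))); exact: measurable_fun_pair.
have ii : mu3.-integrable setT (EFin \o (fun a => pk s a * pk t (hmul (hinv a) b))).
  apply: (integrable_dom mm _ (integrable_scale (cA t) (integrable_pk pk_ge0 s0))) => a.
  have h (u v c : R) : 0 <= u -> `|v| <= c -> `|u * v| <= c * u.
    by move=> u0 vc; rewrite normrM (ger0_norm u0) mulrC ler_wpM2r.
  exact: (h _ _ _ (pk_ge0 a s0) (pk_le _ t0)).
rewrite (EFin_Rintegral (integrable_scale (phi b) ii)) (RintegralZl _ measurableT ii).
by rewrite pk_convolution.
Qed.

Let comp_int (phi : heis R -> R) : measurable_fun setT phi ->
  mu3.-integrable setT (EFin \o (fun b => phi b * pk (s + t) b)) -> mu6.-integrable setT (EFin \o F6 phi).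
Proof.
move=> mphi /integrableP[_ iphi]; apply/integrableP; split; first by apply/measurable_EFinP; exact: mF6.
have mabs : measurable_fun setT (fun b => `|phi b|) by exact: (measurableT_comp (@normr_measurable _ setT) mphi).
have e : (\int[mu6]_w `|(F6 phi w)%:E| = \int[mu6]_w (F6 (fun b => `|phi b|) w)%:E)%E.
  apply: eq_integral => w _; rewrite /F6 /=; congr EFin.
  rewrite (normrM (phi _)); congr (_ * _); exact: (ger0_norm (mulr_ge0 (pk_ge0 _ s0) (pk_ge0 _ t0))).
rewrite [X in (X < _)%E]e (ge0_comp mabs (fun b => normr_ge0 _)).
apply: le_lt_trans iphi; rewrite le_eqVlt; apply/orP; left; apply/eqP.
apply: eq_integral => b _ /=; congr EFin.
by rewrite (normrM (phi b)) (ger0_norm (pk_ge0 b st0)).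
Qed.

(** A product of independent points with densities p_s and p_t has density p_(s+t). [ge0_comp]
    covers nonnegative [phi]; a signed one is written as (|phi| + phi) - |phi|. *)
Lemma pk_comp (phi : heis R -> R) : measurable_fun setT phi ->
  mu3.-integrable setT (EFin \o (fun b => phi b * pk (s + t) b)) ->
  mu6.-integrable setT (EFin \o (fun w => phi (hmul w.1 w.2) * (pk s w.1 * pk t w.2))) /\
  Rintegral mu6 setT (fun w => phi (hmul w.1 w.2) * (pk s w.1 * pk t w.2)) =
  Rintegral mu3 setT (fun b => phi b * pk (s + t) b).
Proof.
move=> mphi iphi; split; first exact: comp_int.
have mabs : measurable_fun setT (fun b => `|phi b|) by exact: (measurableT_comp (@normr_measurable _ setT) mphi).
have iabs : mu3.-integrable setT (EFin \o (fun b => `|phi b| * pk (s + t) b)).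
  have := integrable_norm iphi; apply: eq_integrable => // b _ /=.
  by rewrite (normrM (phi b)) (ger0_norm (pk_ge0 b st0)).
have isum : mu3.-integrable setT (EFin \o (fun b => (`|phi b| + phi b) * pk (s + t) b)).
  have := integrable_add iabs iphi; apply: eq_integrable => // b _ /=.
  by rewrite mulrDl.
have msum : measurable_fun setT (fun b => `|phi b| + phi b) by exact: measurable_funD.
have ler_normDr (u : R) : 0 <= `|u| + u by have := ler_norm (- u); rewrite normrN; lra.
have E (psi : heis R -> R) : measurable_fun setT psi -> (forall b, 0 <= psi b) ->
    Rintegral mu6 setT (F6 psi) = Rintegral mu3 setT (fun b => psi b * pk (s + t) b).
  by move=> mp p0; rewrite /Rintegral ge0_comp.
have e1 := E _ mabs (fun b => normr_ge0 _).
have e2 := E _ msum (fun b => ler_normDr (phi b)).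
transitivity (Rintegral mu6 setT (fun w => F6 (fun b => `|phi b| + phi b) w - F6 (fun b => `|phi b|) w)).
  have alg (a b c : R) : b * c = (a + b) * c - a * c by ring.
  by apply: eq_Rintegral => w _; exact: alg.
apply: etrans; first exact: (RintegralB measurableT (comp_int msum isum) (comp_int mabs iabs)).
rewrite e1 e2; apply: etrans; first exact: (esym (RintegralB measurableT isum iabs)).
have alg (a b c : R) : (a + b) * c - a * c = b * c by ring.
by apply: eq_Rintegral => b _; exact: alg.
Qed.

End composition.

Section expectation.
Context {R : realType}.
Local Notation mu := (@mu1 R).
Hypothesis pk_ge0 : forall (t : R) q, 0 < t -> 0 <= pk t q.
Implicit Types (F G : heis R -> R) (t : R).

Definition Ex t F := Rintegral mu3 setT (fun q => F q * pk t q).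

(** A bound by [weight] gives integrability against [pk t] for every t > 0 at once, so the rules for
    [Ex] carry this single side condition. *)
Definition adm F := measurable_fun setT F /\ exists C : R, forall q, `|F q| <= C * weight q.

Lemma adm_le F G : measurable_fun setT F -> (forall q, `|F q| <= G q) -> adm G -> adm F.
Proof.
move=> mF FG [mG [C hC]]; split => //; exists C => q; apply: le_trans (FG q) _.
exact: le_trans (ler_norm _) (hC q).
Qed.

Lemma admD F G : adm F -> adm G -> adm (fun q => F q + G q).
Proof.
move=> [mF [C hC]] [mG [D hD]]; split; first exact: measurable_funD.
by exists (C + D) => q; rewrite mulrDl; apply: le_trans (ler_normD _ _) _; exact: lerD.
Qed.

Lemma admM F G (C : R) : measurable_fun setT F -> (forall q, `|F q| <= C) -> adm G ->
  adm (fun q => F q * G q).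
Proof.
move=> mF FC [mG [D hD]]; split; first exact: measurable_funM.
by exists (C * D) => q; rewrite normrM -mulrA; exact: ler_pM.
Qed.

Lemma admZ F k : adm F -> adm (fun q => k * F q).
Proof. by move=> aF; exact: (admM (C := `|k|) (measurable_cst k)). Qed.

Lemma admB F G : adm F -> adm G -> adm (fun q => F q - G q).
Proof.
move=> aF /(admZ (-1)) aG; have := admD aF aG.
by under eq_fun do rewrite mulN1r.
Qed.

Lemma adm_abs F : adm F -> adm (fun q => `|F q|).
Proof.
move=> [mF [C hC]]; split; first exact: (measurableT_comp (@normr_measurable _ setT) mF).
by exists C => q; rewrite normr_id.
Qed.

Lemma adm_bnd F (C : R) : measurable_fun setT F -> (forall q, `|F q| <= C) -> adm F.
Proof.
move=> mF hF; split => //; exists C => q; apply: le_trans (hF q) _.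
by rewrite ler_peMr ?weight_ge1//; exact: le_trans (hF q).
Qed.

Lemma adm_cst (c : R) : adm (fun=> c).
Proof. by apply: (@adm_bnd _ `|c|). Qed.

Let w_ge (q : heis R) : [/\ 0 <= q.1.1 ^+ 4, 0 <= q.1.2 ^+ 4 & 0 <= q.2 ^+ 2].
Proof. by rewrite -[4%N]/(2 * 2)%N !exprM !sqr_ge0. Qed.

Let adm1 F : measurable_fun setT F -> (forall q, `|F q| <= weight q) -> adm F.
Proof. by move=> mF hF; split => //; exists 1 => q; rewrite mul1r. Qed.

Lemma adm_x4 : adm (fun q => q.1.1 ^+ 4).
Proof.
by apply: adm1; [mfun|move=> q; have [? ? ?] := w_ge q; rewrite ger0_norm// /weight; lra].
Qed.
Lemma adm_y4 : adm (fun q => q.1.2 ^+ 4).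
Proof.
by apply: adm1; [mfun|move=> q; have [? ? ?] := w_ge q; rewrite ger0_norm// /weight; lra].
Qed.
Lemma adm_z2 : adm (fun q => q.2 ^+ 2).
Proof.
by apply: adm1; [mfun|move=> q; have [? ? ?] := w_ge q; rewrite ger0_norm// /weight; lra].
Qed.
Lemma adm_x2 : adm (fun q => q.1.1 ^+ 2).
Proof.
apply: adm1; [mfun|move=> q; have [? ? ?] := w_ge q; rewrite ger0_norm ?sqr_ge0// /weight].
by have := sqr_ge0 (q.1.1 ^+ 2 - 1); nra.
Qed.
Lemma adm_y2 : adm (fun q => q.1.2 ^+ 2).
Proof.
apply: adm1; [mfun|move=> q; have [? ? ?] := w_ge q; rewrite ger0_norm ?sqr_ge0// /weight].
by have := sqr_ge0 (q.1.2 ^+ 2 - 1); nra.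
Qed.
Let lin_le (u : R) : `|u| <= 1 + u ^+ 2.
Proof. by rewrite ler_norml; have := sqr_ge0 (u - 1); have := sqr_ge0 (u + 1); move=> *; apply/andP; split; nra. Qed.
Lemma adm_x : adm (fun q => q.1.1).
Proof. by apply: (adm_le _ (fun q => lin_le q.1.1)); [mfun|apply: admD adm_x2; exact: adm_cst]. Qed.
Lemma adm_y : adm (fun q => q.1.2).
Proof. by apply: (adm_le _ (fun q => lin_le q.1.2)); [mfun|apply: admD adm_y2; exact: adm_cst]. Qed.
Lemma adm_z : adm (fun q => q.2).
Proof. by apply: (adm_le _ (fun q => lin_le q.2)); [mfun|apply: admD adm_z2; exact: adm_cst]. Qed.
Lemma adm_xy : adm (fun q => q.1.1 * q.1.2).
Proof.
apply: (adm_le (G := fun q => q.1.1 ^+ 2 + q.1.2 ^+ 2)); [by mfun| |exact: admD adm_x2 adm_y2].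
move=> q; rewrite ler_norml; have := sqr_ge0 (q.1.1 - q.1.2); have := sqr_ge0 (q.1.1 + q.1.2).
by move=> *; apply/andP; split; nra.
Qed.

Section fixed_time.
Variable t : R.
Hypothesis t0 : 0 < t.

Lemma adm_integrable F : adm F -> mu3.-integrable setT (EFin \o (fun q => F q * pk t q)).
Proof. by move=> [mF [C hC]]; exact: (integrable_adm pk_ge0 t0 mF hC). Qed.

Lemma ExD F G : adm F -> adm G -> Ex t (fun q => F q + G q) = Ex t F + Ex t G.
Proof.
move=> aF aG; rewrite /Ex -(RintegralD measurableT (adm_integrable aF) (adm_integrable aG)).
by apply: eq_Rintegral => q _; rewrite mulrDl.
Qed.

Lemma ExB F G : adm F -> adm G -> Ex t (fun q => F q - G q) = Ex t F - Ex t G.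
Proof.
move=> aF aG; rewrite /Ex -(RintegralB measurableT (adm_integrable aF) (adm_integrable aG)).
by apply: eq_Rintegral => q _; rewrite mulrBl.
Qed.

Lemma ExZ F k : adm F -> Ex t (fun q => k * F q) = k * Ex t F.
Proof.
move=> aF; rewrite /Ex -(RintegralZl _ measurableT (adm_integrable aF)).
by apply: eq_Rintegral => q _; rewrite mulrA.
Qed.

Lemma Ex_cst c : Ex t (fun=> c) = c.
Proof.
by rewrite /Ex (RintegralZl _ measurableT (integrable_pk pk_ge0 t0)) Rintegral_pk// mulr1.
Qed.

Lemma Ex_le F G : adm F -> adm G -> (forall q, F q <= G q) -> Ex t F <= Ex t G.
Proof.
move=> aF aG FG; apply: (le_Rintegral measurableT (adm_integrable aF) (adm_integrable aG)) => q _.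
exact: (ler_wpM2r (pk_ge0 q t0)).
Qed.

Lemma Ex_norm F G : adm F -> adm G -> (forall q, `|F q| <= G q) -> `|Ex t F| <= Ex t G.
Proof.
move=> aF aG FG; rewrite ler_norml; apply/andP; split.
  rewrite -mulN1r -(ExZ _ aG); apply: Ex_le => //; first exact: admZ.
  by move=> q; have := FG q; rewrite ler_norml mulN1r => /andP[].
by apply: Ex_le => // q; exact: le_trans (ler_norm _) (FG q).
Qed.

Lemma Ex_ge0 F : adm F -> (forall q, 0 <= F q) -> 0 <= Ex t F.
Proof. by move=> aF F0; rewrite -(Ex_cst 0); apply: Ex_le => //; exact: adm_cst. Qed.

Lemma Ex_bnd F (C : R) : measurable_fun setT F -> (forall q, `|F q| <= C) -> `|Ex t F| <= C.
Proof.
move=> mF FC; rewrite -[leRHS]Ex_cst; apply: Ex_norm => //; [exact: adm_bnd FC|exact: adm_cst].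
Qed.

Lemma eq_Ex F G : (forall q, F q = G q) -> Ex t F = Ex t G.
Proof. by move=> /funext ->. Qed.

Lemma measurable_Ex (Phi : heis R * heis R -> R) (C : R) : measurable_fun setT Phi ->
  (forall w, `|Phi w| <= C * weight w.2) -> measurable_fun setT (fun y => Ex t (fun q => Phi (y, q))).
Proof.
move=> mPhi hC.
have mw := measurable_weight (R := R); have mk := measurable_pk t0.
have mw2 : measurable_fun setT (fun w : heis R * heis R => weight w.2) by exact: (measurableT_comp mw measurable_snd).
have mk2 : measurable_fun setT (fun w : heis R * heis R => pk t w.2) by exact: (measurableT_comp mk measurable_snd).
(* Adding [C * weight] makes the integrand nonnegative, as Tonelli's measurability statement
   demands; its mean is a constant, subtracted at the end. *)
pose G (w : heis R * heis R) := (Phi w + C * weight w.2) * pk t w.2.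
have mG : measurable_fun setT (fun w => (G w)%:E).
  apply/measurable_EFinP; apply: (measurable_funM _ mk2); apply: (measurable_funD mPhi).
  exact: (measurable_funM (measurable_cst C) mw2).
have G0 w : (0 <= (G w)%:E)%E.
  rewrite lee_fin; apply: (mulr_ge0 _ (pk_ge0 _ t0)).
  by have := hC w; rewrite ler_norml => /andP[+ _]; lra.
have m0 := @measurable_fun_fubini_tonelli_F _ _ _ _ R mu3 _ mG G0.
have m1 := measurableT_comp (@fine_measurable R setT measurableT) m0.
have := measurable_funB m1 (measurable_cst (C * Ex t (@weight R))).
apply: eq_measurable_fun => y _; rewrite /fubini_F /=.
have aP : adm (fun q => Phi (y, q)).
  split; last by exists C => q; exact: hC.
  by apply: (measurableT_comp mPhi (g := fun q => (y, q))); exact: measurable_fun_pair.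
have aw : adm (@weight R).
  by split => //; exists 1 => q; rewrite mul1r ger0_norm// (le_trans ler01)// weight_ge1.
rewrite -(ExZ C aw) -/(Rintegral mu3 setT (fun q => G (y, q))).
rewrite -[X in X - _]/(Ex t (fun q => Phi (y, q) + C * weight q)) ExD//; last exact: admZ.
by rewrite addrK.
Qed.

End fixed_time.

Definition Pt t F y := Ex t (fun q => F (hmul y q)).

Lemma measurable_Pt t F (C : R) : 0 < t -> measurable_fun setT F -> (forall q, `|F q| <= C) ->
  measurable_fun setT (Pt t F).
Proof.
move=> t0 mF FC; apply: (@measurable_Ex t t0 (fun w => F (hmul w.1 w.2)) C).
  exact: (measurableT_comp mF measurable_hmul2).
by move=> w; apply: le_trans (FC _) _; rewrite ler_peMr ?weight_ge1//; exact: le_trans (FC w.1).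
Qed.

Lemma Pt_bnd t F (C : R) y : 0 < t -> measurable_fun setT F -> (forall q, `|F q| <= C) -> `|Pt t F y| <= C.
Proof.
move=> t0 mF FC; apply: (Ex_bnd t0) => //; exact: (measurableT_comp mF (measurable_hmul y)).
Qed.

Lemma Pt_add s t F (C : R) y : 0 < s -> 0 < t -> measurable_fun setT F -> (forall q, `|F q| <= C) ->
  Pt s (Pt t F) y = Pt (s + t) F y.
Proof.
move=> s0 t0 mF FC; have st0 := addr_gt0 s0 t0.
pose phi b := F (hmul y b).
have mphi : measurable_fun setT phi by exact: (measurableT_comp mF (measurable_hmul y)).
have aphi : adm phi by exact: (adm_bnd mphi (fun q => FC _)).
have [i6 e6] := pk_comp pk_ge0 s0 t0 mphi (adm_integrable st0 aphi).
rewrite /Pt {3}/Ex -/phi -e6 (Rfubini1 i6).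
  rewrite {1}/Ex; apply: eq_Rintegral => a _ /=.
  have aa : adm (fun q => F (hmul (hmul y a) q)).
    by apply: (adm_bnd (C := C)) => //; exact: (measurableT_comp mF (measurable_hmul _)).
  rewrite /Ex mulrC -(RintegralZl _ measurableT (adm_integrable t0 aa)).
  by apply: eq_Rintegral => q _; rewrite /phi hmulA; exact: mulrCA.
move=> a; cbn [fst snd].
have aa : adm (fun q => F (hmul (hmul y a) q)).
  by apply: (adm_bnd (C := C)) => //; exact: (measurableT_comp mF (measurable_hmul _)).
have := integrable_scale (pk s a) (adm_integrable t0 aa).
by apply: eq_integrable => // q _; rewrite /= /phi hmulA; congr EFin; exact: mulrCA.
Qed.

End expectation.

(** * Second-order expansions and small-time covariance *)

Section taylor.
Context {R : realType}.
Local Notation mu := (@mu1 R).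
Implicit Types (F U V : heis R -> R) (M t : R) (y h q : heis R).

(* [U1], [U2], [U3] stand for [X F], [Y F], [Z F]. Stated by increments, this class is
   preserved by [Pt] without differentiating under the integral. *)
Record taylor F U1 U2 U3 M : Prop := Taylor {
  ty_m : measurable_fun setT F;
  ty_m1 : measurable_fun setT U1;
  ty_m2 : measurable_fun setT U2;
  ty_m3 : measurable_fun setT U3;
  ty_b : forall y, `|F y| <= M;
  ty_b1 : forall y, `|U1 y| <= M;
  ty_b2 : forall y, `|U2 y| <= M;
  ty_b3 : forall y, `|U3 y| <= M;
  ty_exp : forall y h, `|F (hmul y h) - F y - h.1.1 * U1 y - h.1.2 * U2 y - h.2 * U3 y| <=
    M * (h.1.1 ^+ 2 + h.1.2 ^+ 2 + h.2 ^+ 2) }.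

Let scaleE3 (h a b c x y z : R) : h *: ((a, b, c) : heis R) + (x, y, z) = (h * a + x, h * b + y, h * c + z).
Proof. by []. Qed.

(** The Euclidean line through [y] along an axis is [hmul y h] for increments [h] with a
    compensating vertical part. This puts terms in [U3] into the partial derivatives, and they drop
    out again in [Xfield] and [Yfield]. *)
Lemma taylor_hgrad F U1 U2 U3 M y : taylor F U1 U2 U3 M ->
  hgrad F y = Num.sqrt (U1 y ^+ 2 + U2 y ^+ 2).
Proof.
move=> T; have [a0 a1 a2] := @axisE R.
have ex := ty_exp T y.
pose d0 := U1 y + y.1.2 / 2 * U3 y; pose d1 := U2 y - y.1.1 / 2 * U3 y.
have e0 : is_derive y (axis 0) F d0.
  apply: (is_derive_of_quadratic (c := M * (1 + (y.1.2 / 2) ^+ 2))) => h.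
  have -> : h *: axis 0 + y = hmul y (h, 0, h * (y.1.2 / 2)).
    rewrite a0 hmulE; case: y {ex d0 d1 T} => [[x y] z].
    by rewrite scaleE3 /=; congr (_, _, _); field.
  have := ex (h, 0, h * (y.1.2 / 2)); rewrite /= /d0; set A := F _ => hA.
  have -> : A - F y - h * (U1 y + y.1.2 / 2 * U3 y) =
    A - F y - h * U1 y - 0 * U2 y - h * (y.1.2 / 2) * U3 y by ring.
  by apply: le_trans hA _; rewrite le_eqVlt; apply/orP; left; apply/eqP; ring.
have e1 : is_derive y (axis 1) F d1.
  apply: (is_derive_of_quadratic (c := M * (1 + (y.1.1 / 2) ^+ 2))) => h.
  have -> : h *: axis 1 + y = hmul y (0, h, - (h * (y.1.1 / 2))).
    rewrite a1 hmulE; case: y {ex d0 d1 e0 T} => [[x y] z].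
    by rewrite scaleE3 /=; congr (_, _, _); field.
  have := ex (0, h, - (h * (y.1.1 / 2))); rewrite /= /d1; set A := F _ => hA.
  have -> : A - F y - h * (U2 y - y.1.1 / 2 * U3 y) =
    A - F y - 0 * U1 y - h * U2 y - - (h * (y.1.1 / 2)) * U3 y by ring.
  by apply: le_trans hA _; rewrite le_eqVlt; apply/orP; left; apply/eqP; ring.
have e2 : is_derive y (axis 2) F (U3 y).
  apply: (is_derive_of_quadratic (c := M)) => h.
  have -> : h *: axis 2 + y = hmul y (0, 0, h).
    rewrite a2 hmulE; case: y {ex d0 d1 e0 e1 T} => [[x y] z].
    by rewrite scaleE3 /=; congr (_, _, _); field.
  have := ex (0, 0, h); rewrite /=; set A := F _ => hA.
  have -> : A - F y - h * U3 y = A - F y - 0 * U1 y - 0 * U2 y - h * U3 y by ring.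
  by apply: le_trans hA _; rewrite le_eqVlt; apply/orP; left; apply/eqP; ring.
rewrite (hgradE e0 e1 e2) /d0 /d1; congr (Num.sqrt (_ ^+ 2 + _ ^+ 2)); ring.
Qed.

Lemma taylor_M_ge0 F U1 U2 U3 M : taylor F U1 U2 U3 M -> 0 <= M.
Proof. by move=> T; exact: le_trans (ty_b T (0, 0, 0)). Qed.

(** Homogeneous of degree 2 for the dilations, so that its mean under [pk t] is of order t. The term
    linear in |z| is there because a first-order vertical variation has degree 2 and counts as
    remainder. *)
Definition hrem q : R := 2 * `|q.2| + q.1.1 ^+ 2 + q.1.2 ^+ 2.

Lemma hrem_ge0 q : 0 <= hrem q.
Proof. by rewrite /hrem !addr_ge0 ?sqr_ge0// mulr_ge0. Qed.

(* Vertical increments are bounded by [2 M |z|]: by the expansion if [|z| <= 1],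
   by boundedness otherwise. *)
Lemma taylor_horizontal F U1 U2 U3 M y h : taylor F U1 U2 U3 M ->
  `|F (hmul y h) - F y - h.1.1 * U1 y - h.1.2 * U2 y| <= M * hrem h.
Proof.
move=> T; have M0 := taylor_M_ge0 T.
pose y' := hmul y (h.1.1, h.1.2, 0).
have -> : hmul y h = hmul y' (0, 0, h.2).
  by rewrite /y' !hmulE /=; congr (_, _, _); ring.
have := ty_exp T y (h.1.1, h.1.2, 0); have := ty_exp T y' (0, 0, h.2); rewrite /= -/y'.
have := ty_b T (hmul y' (0, 0, h.2)); have := ty_b T y'; have := ty_b3 T y'.
move: (F (hmul y' (0, 0, h.2))) (F y') (U3 y') (U1 y') (U2 y') (F y) (U1 y) (U2 y) (U3 y) => A B u3 u1 u2 C v1 v2 v3.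
move=> b3 bB bA; rewrite !mul0r !subr0 !expr0n /= !addr0 !add0r => e1 e2.
have e3 : `|A - B| <= 2 * M * `|h.2|.
  have [c1|c1] := lerP `|h.2| 1.
    have c2 : h.2 ^+ 2 <= `|h.2|.
      by rewrite -(real_normK (num_real h.2)) expr2; apply: ler_piMr.
    have m3 : `|h.2 * u3| <= M * `|h.2| by rewrite normrM mulrC; apply: ler_wpM2r.
    have m4 : M * h.2 ^+ 2 <= M * `|h.2| by apply: ler_wpM2l.
    have := le_trans (ler_normD (A - B - h.2 * u3) (h.2 * u3)) (lerD (le_trans e1 m4) m3).
    by rewrite subrK; lra.
  apply: le_trans (ler_normB _ _) _; apply: le_trans (lerD bA bB) _.
  by have : M * 1 <= M * `|h.2| by [apply: ler_wpM2l => //; exact: ltW]; lra.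
have := le_trans (ler_normD _ _) (lerD e3 e2).
have -> : A - B + (B - C - h.1.1 * v1 - h.1.2 * v2) = A - C - h.1.1 * v1 - h.1.2 * v2 by ring.
by move=> /le_trans; apply; rewrite /hrem le_eqVlt; apply/orP; left; apply/eqP; ring.
Qed.

Hypothesis pk_ge0 : forall (t : R) q, 0 < t -> 0 <= pk t q.

Lemma Ex_x2 t : 0 < t -> Ex t (fun q => q.1.1 ^+ 2) = 2 * t.
Proof. by move=> t0; have [_] := pk_x2 pk_ge0 t0. Qed.
Lemma Ex_y2 t : 0 < t -> Ex t (fun q => q.1.2 ^+ 2) = 2 * t.
Proof. by move=> t0; have [_] := pk_y2 pk_ge0 t0. Qed.
Lemma Ex_x4 t : 0 < t -> Ex t (fun q => q.1.1 ^+ 4) <= 256 * t ^+ 2.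
Proof. by move=> t0; have [_] := pk_x4 pk_ge0 t0. Qed.
Lemma Ex_y4 t : 0 < t -> Ex t (fun q => q.1.2 ^+ 4) <= 256 * t ^+ 2.
Proof. by move=> t0; have [_] := pk_y4 pk_ge0 t0. Qed.
Lemma Ex_z2 t : 0 < t -> Ex t (fun q => q.2 ^+ 2) <= t ^+ 2.
Proof. by move=> t0; have [_] := pk_z2 pk_ge0 t0. Qed.
Lemma Ex_x t : 0 < t -> Ex t (fun q => q.1.1) = 0.
Proof. by move=> t0; exact: pk_x. Qed.
Lemma Ex_y t : 0 < t -> Ex t (fun q => q.1.2) = 0.
Proof. by move=> t0; exact: pk_y. Qed.
Lemma Ex_xy t : 0 < t -> Ex t (fun q => q.1.1 * q.1.2) = 0.
Proof. by move=> t0; exact: pk_xy. Qed.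

Lemma measurable_trans F y : measurable_fun setT F -> measurable_fun setT (fun q => F (hmul y q)).
Proof. by move=> mF; exact: (measurableT_comp mF (measurable_hmul y)). Qed.

Lemma adm_trans F y M : measurable_fun setT F -> (forall q, `|F q| <= M) -> adm (fun q => F (hmul y q)).
Proof. by move=> mF hF; apply: (@adm_bnd _ _ M) => //; exact: measurable_trans. Qed.

Lemma adm_transM F G y M : measurable_fun setT F -> (forall q, `|F q| <= M) -> adm G ->
  adm (fun q => G q * F (hmul y q)).
Proof.
move=> mF hF aG; have := admM (measurable_trans y mF) (fun q => hF (hmul y q)) aG.
by under eq_fun do rewrite mulrC.
Qed.

Section fixed_time.
Variable t : R.
Hypothesis t0 : 0 < t.

Lemma adm_hrem : adm hrem.
Proof.
apply: admD adm_y2; apply: admD adm_x2; apply: admZ; exact: adm_abs adm_z.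
Qed.

Let s := Num.sqrt t.
Let s0 : 0 < s. Proof. by rewrite sqrtr_gt0. Qed.
Let s2 : s ^+ 2 = t. Proof. by rewrite sqr_sqrtr// ltW. Qed.

(** 2 |z| <= t + z^2/t, whence 6 t = t + t + 2 t + 2 t. *)
Lemma Ex_hrem : Ex t hrem <= 6 * t.
Proof.
have a1 := admD (adm_cst t) (admZ t^-1 (@adm_z2 R)).
have a2 := admD (admD a1 (@adm_x2 R)) (@adm_y2 R).
apply: (le_trans (Ex_le pk_ge0 t0 adm_hrem a2 _)).
  move=> q; rewrite /hrem lerD2r lerD2r.
  rewrite -(real_normK (num_real q.2)); have := sqr_ge0 (t - `|q.2|).
  have -> : t + t^-1 * `|q.2| ^+ 2 = (t ^+ 2 + `|q.2| ^+ 2) / t by field; exact: lt0r_neq0.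
  by rewrite ler_pdivlMr//; nra.
rewrite (ExD pk_ge0 t0 (admD a1 (@adm_x2 R)) (@adm_y2 R)) (ExD pk_ge0 t0 a1 (@adm_x2 R)).
rewrite (ExD pk_ge0 t0 (adm_cst t) (admZ t^-1 (@adm_z2 R))) (ExZ pk_ge0 t0 _ (@adm_z2 R)).
rewrite (Ex_cst pk_ge0 t0) Ex_x2// Ex_y2//.
have : t^-1 * Ex t (fun q => q.2 ^+ 2) <= t^-1 * t ^+ 2 by rewrite ler_wpM2l ?invr_ge0 ?(ltW t0)// Ex_z2.
have -> : t^-1 * t ^+ 2 = t by field; exact: lt0r_neq0.
lra.
Qed.

Let dom2 q : R := 8 * q.2 ^+ 2 + (4 * q.1.1 ^+ 4 + 4 * q.1.2 ^+ 4).
Let adom2 : adm dom2.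
Proof.
apply: (admD (admZ 8 (@adm_z2 R))); exact: (admD (admZ 4 (@adm_x4 R)) (admZ 4 (@adm_y4 R))).
Qed.
Let rem2_le q : hrem q ^+ 2 <= dom2 q.
Proof.
rewrite /hrem /dom2 -(real_normK (num_real q.2)); set c := `|_|; set a := q.1.1 ^+ 2; set b := q.1.2 ^+ 2.
have -> : q.1.1 ^+ 4 = a ^+ 2 by rewrite /a -exprM.
have -> : q.1.2 ^+ 4 = b ^+ 2 by rewrite /b -exprM.
by have := sqr_ge0 (2 * c - (a + b)); have := sqr_ge0 (a - b); nra.
Qed.

Lemma adm_hrem2 : adm (fun q => hrem q ^+ 2).
Proof.
apply: (adm_le _ _ adom2); last by move=> q; rewrite ger0_norm ?sqr_ge0.
by have [mr _] := adm_hrem; mfun.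
Qed.

(** The constant is read off from [dom2]: 2056 = 8 + 4 * 256 + 4 * 256. *)
Lemma Ex_hrem2 : Ex t (fun q => hrem q ^+ 2) <= 2056 * t ^+ 2.
Proof.
apply: (le_trans (Ex_le pk_ge0 t0 adm_hrem2 adom2 rem2_le)).
rewrite (ExD pk_ge0 t0 (admZ 8 (@adm_z2 R)) (admD (admZ 4 (@adm_x4 R)) (admZ 4 (@adm_y4 R)))).
rewrite (ExD pk_ge0 t0 (admZ 4 (@adm_x4 R)) (admZ 4 (@adm_y4 R))).
rewrite (ExZ pk_ge0 t0 _ (@adm_z2 R)) (ExZ pk_ge0 t0 _ (@adm_x4 R)) (ExZ pk_ge0 t0 _ (@adm_y4 R)).
by have := Ex_z2 t0; have := Ex_x4 t0; have := Ex_y4 t0; lra.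
Qed.

(* [y h q = (y q) (q^-1 h q)], and conjugation only shifts the vertical coordinate. *)
Lemma taylor_Pt F U1 U2 U3 M : taylor F U1 U2 U3 M ->
  taylor (Pt t F) (fun y => Ex t (fun q => U1 (hmul y q) + q.1.2 * U3 (hmul y q)))
    (fun y => Ex t (fun q => U2 (hmul y q) - q.1.1 * U3 (hmul y q)))
    (fun y => Ex t (fun q => U3 (hmul y q))) (M * (3 + 6 * t)).
Proof.
move=> T; have M0 := taylor_M_ge0 T.
have [mF m1 m2 m3 bF b1 b2 b3 ex] := T.
have w1 q : 1 <= weight q :> R by exact: weight_ge1.
have wx q : `|q.1.1| <= 2 * weight q :> R.
  have p1 : 0 <= q.1.1 ^+ 4 by rewrite (exprM _ 2 2) sqr_ge0.
  have p2 : 0 <= q.1.2 ^+ 4 by rewrite (exprM _ 2 2) sqr_ge0.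
  have := sqr_ge0 q.2; have := sqr_ge0 (q.1.1 ^+ 2 - 1); have := sqr_ge0 (q.1.1 - 1); have := sqr_ge0 (q.1.1 + 1).
  by rewrite /weight => *; rewrite ler_norml; apply/andP; split; nra.
have wy q : `|q.1.2| <= 2 * weight q :> R.
  have p1 : 0 <= q.1.1 ^+ 4 by rewrite (exprM _ 2 2) sqr_ge0.
  have p2 : 0 <= q.1.2 ^+ 4 by rewrite (exprM _ 2 2) sqr_ge0.
  have := sqr_ge0 q.2; have := sqr_ge0 (q.1.2 ^+ 2 - 1); have := sqr_ge0 (q.1.2 - 1); have := sqr_ge0 (q.1.2 + 1).
  by rewrite /weight => *; rewrite ler_norml; apply/andP; split; nra.
have mm U : measurable_fun setT U -> measurable_fun setT (fun w : heis R * heis R => U (hmul w.1 w.2)).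
  by move=> mU; exact: (measurableT_comp mU measurable_hmul2).
have aU U (mU : measurable_fun setT U) (bU : forall q, `|U q| <= M) y := adm_trans y mU bU.
have axU U (mU : measurable_fun setT U) (bU : forall q, `|U q| <= M) y := adm_transM y mU bU (@adm_x R).
have ayU U (mU : measurable_fun setT U) (bU : forall q, `|U q| <= M) y := adm_transM y mU bU (@adm_y R).
have M3 : M <= M * (3 + 6 * t) by have := mulr_ge0 M0 (ltW t0); lra.
have lin (u : R) : `|u| <= 1 + u ^+ 2.
  by rewrite ler_norml; have := sqr_ge0 (u - 1); have := sqr_ge0 (u + 1); move=> *; apply/andP; split; nra.
split.
- exact: (measurable_Pt pk_ge0 t0 mF bF).
- have m13 := mm _ m1; have m33 := mm _ m3.
  apply: (@measurable_Ex _ pk_ge0 t t0 (fun w => U1 (hmul w.1 w.2) + w.2.1.2 * U3 (hmul w.1 w.2)) (3 * M)); first by mfun.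
  move=> w; apply: le_trans (ler_normD _ _) _; rewrite normrM.
  have h1 : `|w.2.1.2| * `|U3 (hmul w.1 w.2)| <= 2 * weight w.2 * M by exact: ler_pM.
  have h2 : M * 1 <= M * weight w.2 by exact: ler_wpM2l.
  by have := b1 (hmul w.1 w.2); lra.
- have m23 := mm _ m2; have m33 := mm _ m3.
  apply: (@measurable_Ex _ pk_ge0 t t0 (fun w => U2 (hmul w.1 w.2) - w.2.1.1 * U3 (hmul w.1 w.2)) (3 * M)); first by mfun.
  move=> w; apply: le_trans (ler_normB _ _) _; rewrite normrM.
  have h1 : `|w.2.1.1| * `|U3 (hmul w.1 w.2)| <= 2 * weight w.2 * M by exact: ler_pM.
  have h2 : M * 1 <= M * weight w.2 by exact: ler_wpM2l.
  by have := b2 (hmul w.1 w.2); lra.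
- exact: (measurable_Pt pk_ge0 t0 m3 b3).
- move=> y; exact: le_trans (Pt_bnd pk_ge0 y t0 mF bF) M3.
- move=> y; have ad := admZ M (admD (adm_cst 2) (@adm_y2 R)).
  apply: (le_trans (Ex_norm pk_ge0 t0 (admD (aU _ m1 b1 y) (ayU _ m3 b3 y)) ad _)).
    move=> q; apply: le_trans (ler_normD _ _) _; rewrite normrM.
    have := ler_pM (normr_ge0 _) (normr_ge0 _) (lin q.1.2) (b3 (hmul y q)).
    by have := b1 (hmul y q); lra.
  rewrite (ExZ pk_ge0 t0 _ (admD (adm_cst 2) (@adm_y2 R))) (ExD pk_ge0 t0 (adm_cst 2) (@adm_y2 R)).
  by rewrite (Ex_cst pk_ge0 t0) Ex_y2// ler_wpM2l//; have := t0; lra.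
- move=> y; have ad := admZ M (admD (adm_cst 2) (@adm_x2 R)).
  apply: (le_trans (Ex_norm pk_ge0 t0 (admB (aU _ m2 b2 y) (axU _ m3 b3 y)) ad _)).
    move=> q; apply: le_trans (ler_normB _ _) _; rewrite normrM.
    have := ler_pM (normr_ge0 _) (normr_ge0 _) (lin q.1.1) (b3 (hmul y q)).
    by have := b2 (hmul y q); lra.
  rewrite (ExZ pk_ge0 t0 _ (admD (adm_cst 2) (@adm_x2 R))) (ExD pk_ge0 t0 (adm_cst 2) (@adm_x2 R)).
  by rewrite (Ex_cst pk_ge0 t0) Ex_x2// ler_wpM2l//; have := t0; lra.
- move=> y; exact: le_trans (Pt_bnd pk_ge0 y t0 m3 b3) M3.
- move=> y h; set a := h.1.1; set b := h.1.2; set c := h.2.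
  have a0 := aU _ mF bF (hmul y h); have a0' := aU _ mF bF y.
  have a1 := admD (aU _ m1 b1 y) (ayU _ m3 b3 y).
  have a2 := admB (aU _ m2 b2 y) (axU _ m3 b3 y).
  have a3 := aU _ m3 b3 y.
  have A1 := admB a0 a0'; have A2 := admB A1 (admZ a a1); have A3 := admB A2 (admZ b a2).
  have A4 := admB A3 (admZ c a3).
  have <- : Ex t (fun q => F (hmul (hmul y h) q) - F (hmul y q)
      - a * (U1 (hmul y q) + q.1.2 * U3 (hmul y q)) - b * (U2 (hmul y q) - q.1.1 * U3 (hmul y q))
      - c * U3 (hmul y q)) = Pt t F (hmul y h) - Pt t F y -
      a * Ex t (fun q => U1 (hmul y q) + q.1.2 * U3 (hmul y q)) -
      b * Ex t (fun q => U2 (hmul y q) - q.1.1 * U3 (hmul y q)) - c * Ex t (fun q => U3 (hmul y q)).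
    rewrite (ExB pk_ge0 t0 A3 (admZ c a3)) (ExB pk_ge0 t0 A2 (admZ b a2)) (ExB pk_ge0 t0 A1 (admZ a a1)).
    by rewrite (ExB pk_ge0 t0 a0 a0') (ExZ pk_ge0 t0 a a1) (ExZ pk_ge0 t0 b a2) (ExZ pk_ge0 t0 c a3).
  (* The factor 3 + 6 t comes from (c + a y - b x)^2 <= 3 (c^2 + a^2 y^2 + b^2 x^2), where x and y
     are coordinates of [q] with second moment 2 t. *)
  pose k := a ^+ 2 + b ^+ 2 + 3 * c ^+ 2.
  have d1 := admZ (3 * a ^+ 2) (@adm_y2 R); have d2 := admZ (3 * b ^+ 2) (@adm_x2 R).
  have d := admZ M (admD (adm_cst k) (admD d1 d2)).
  apply: (le_trans (Ex_norm pk_ge0 t0 A4 d _)).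
    move=> q; have := ex (hmul y q) (a, b, c + a * q.1.2 - b * q.1.1).
    have -> : hmul (hmul y q) (a, b, c + a * q.1.2 - b * q.1.1) = hmul (hmul y h) q.
      by rewrite /a /b /c !hmulE /=; congr (_, _, _); field.
    rewrite /=; move: (F (hmul (hmul y h) q)) (F (hmul y q)) (U1 (hmul y q)) (U2 (hmul y q)) (U3 (hmul y q)) => f1 f2 u1 u2 u3.
    have -> : f1 - f2 - a * u1 - b * u2 - (c + a * q.1.2 - b * q.1.1) * u3 =
      f1 - f2 - a * (u1 + q.1.2 * u3) - b * (u2 - q.1.1 * u3) - c * u3 by ring.
    move=> /le_trans; apply; rewrite ler_wpM2l// /k.
    have := sqr_ge0 (c - a * q.1.2); have := sqr_ge0 (c + b * q.1.1); have := sqr_ge0 (a * q.1.2 + b * q.1.1).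
    nra.
  rewrite (ExZ pk_ge0 t0 _ (admD (adm_cst k) (admD d1 d2))) (ExD pk_ge0 t0 (adm_cst k) (admD d1 d2)).
  rewrite (ExD pk_ge0 t0 d1 d2) (ExZ pk_ge0 t0 _ (@adm_y2 R)) (ExZ pk_ge0 t0 _ (@adm_x2 R)).
  rewrite (Ex_cst pk_ge0 t0) Ex_x2// Ex_y2// -[leRHS]mulrA ler_wpM2l// /k.
  have := sqr_ge0 a; have := sqr_ge0 b; have := sqr_ge0 c.
  move: (a ^+ 2) (b ^+ 2) (c ^+ 2) => A B C C0 B0 A0.
  by have := mulr_ge0 (ltW t0) C0; lra.
Qed.

Section covariance.
Variables (F U1 U2 U3 G V1 V2 V3 : heis R -> R) (M : R) (y : heis R).
Hypotheses (TF : taylor F U1 U2 U3 M) (TG : taylor G V1 V2 V3 M).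

Let Rm H W1 W2 q : R := H (hmul y q) - H y - q.1.1 * W1 y - q.1.2 * W2 y.

Let aRm H W1 W2 W3 : taylor H W1 W2 W3 M -> adm (Rm H W1 W2).
Proof.
move=> T; apply: admB; last by have := admZ (W2 y) (@adm_y R); under eq_fun do rewrite mulrC.
apply: admB; last by have := admZ (W1 y) (@adm_x R); under eq_fun do rewrite mulrC.
by apply: admB; [exact: adm_trans (ty_m T) (ty_b T)|exact: adm_cst].
Qed.

Let Ex_Rm H W1 W2 W3 : taylor H W1 W2 W3 M -> Ex t (Rm H W1 W2) = Pt t H y - H y.
Proof.
move=> T; have a0 := adm_trans y (ty_m T) (ty_b T).
have a1 := admB a0 (adm_cst (H y)).
have ax := admZ (W1 y) (@adm_x R); have ay := admZ (W2 y) (@adm_y R).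
rewrite (@eq_Ex _ t _ (fun q => H (hmul y q) - H y - W1 y * q.1.1 - W2 y * q.1.2)); last first.
  by move=> q; rewrite /Rm; ring.
rewrite (ExB pk_ge0 t0 (admB a1 ax) ay) (ExB pk_ge0 t0 a1 ax) (ExB pk_ge0 t0 a0 (adm_cst (H y))).
by rewrite (ExZ pk_ge0 t0 _ (@adm_x R)) (ExZ pk_ge0 t0 _ (@adm_y R)) (Ex_cst pk_ge0 t0) Ex_x// Ex_y// !mulr0 !subr0.
Qed.

(** The horizontal coordinates have mean 0, so only the remainder contributes, through [Ex_hrem]. *)
Lemma taylor_Pt_sub H W1 W2 W3 : taylor H W1 W2 W3 M -> `|Pt t H y - H y| <= 6 * M * t.
Proof.
move=> T; have M0 := taylor_M_ge0 T; rewrite -(Ex_Rm T).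
apply: (le_trans (Ex_norm pk_ge0 t0 (aRm T) (admZ M adm_hrem) (fun q => taylor_horizontal y q T))).
rewrite (ExZ pk_ge0 t0 _ adm_hrem) [6 * M]mulrC -mulrA; apply: ler_wpM2l => //; exact: Ex_hrem.
Qed.

(** An increment of F is a linear part [LF] plus a remainder [Rm]. The product of the linear parts
    has mean 2 t times the scalar product of the horizontal gradients, since E x^2 = E y^2 = 2 t and
    E xy = 0; [S] collects the other products. *)
Lemma heat_covariance_expansion :
  `|Pt t (fun q => F q * G q) y - Pt t F y * Pt t G y - 2 * t * (U1 y * V1 y + U2 y * V2 y)|
  <= 2100 * M ^+ 2 * (t * Num.sqrt t + t ^+ 2).
Proof.
have M0 := taylor_M_ge0 TF.
have [mF m1 m2 m3 bF b1 b2 b3 ex] := TF; have [mG n1 n2 n3 bG c1 c2 c3 ex'] := TG.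
have hF q : `|Rm F U1 U2 q| <= M * hrem q by exact: taylor_horizontal TF.
have hG q : `|Rm G V1 V2 q| <= M * hrem q by exact: taylor_horizontal TG.
pose LF q : R := q.1.1 * U1 y + q.1.2 * U2 y; pose LG q : R := q.1.1 * V1 y + q.1.2 * V2 y.
have lLe (a b u v : R) : `|u| <= M -> `|v| <= M -> `|a * u + b * v| <= M * (`|a| + `|b|).
  move=> hu hv; apply: le_trans (ler_normD _ _) _; rewrite !normrM mulrDr.
  by apply: lerD; rewrite mulrC; apply: ler_wpM2r.
have lF q : `|LF q| <= M * (`|q.1.1| + `|q.1.2|) by exact: lLe.
have lG q : `|LG q| <= M * (`|q.1.1| + `|q.1.2|) by exact: lLe.
pose S q := LF q * Rm G V1 V2 q + Rm F U1 U2 q * LG q + Rm F U1 U2 q * Rm G V1 V2 q.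
(* Weighted inequality 2 A B <= s A^2 + B^2 / s with s = sqrt t: the means of A^2 and B^2 are of
   order t and t^2, so both terms are of order t sqrt t. *)
pose D q : R := M ^+ 2 * (2 * s * (q.1.1 ^+ 2 + q.1.2 ^+ 2) + (s^-1 + 1) * hrem q ^+ 2).
have SD q : `|S q| <= D q.
  apply: (@le_trans _ _ (M ^+ 2 * (2 * (`|q.1.1| + `|q.1.2|) * hrem q + hrem q ^+ 2))).
    have r0 := hrem_ge0 q.
    have h1 : `|LF q * Rm G V1 V2 q| <= M * (`|q.1.1| + `|q.1.2|) * (M * hrem q) by rewrite normrM; exact: ler_pM.
    have h2 : `|Rm F U1 U2 q * LG q| <= M * hrem q * (M * (`|q.1.1| + `|q.1.2|)) by rewrite normrM; exact: ler_pM.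
    have h3 : `|Rm F U1 U2 q * Rm G V1 V2 q| <= M * hrem q * (M * hrem q) by rewrite normrM; exact: ler_pM.
    have := le_trans (ler_normD _ _) (lerD (le_trans (ler_normD _ _) (lerD h1 h2)) h3).
    by rewrite -/(S q) => /le_trans; apply; rewrite le_eqVlt; apply/orP; left; apply/eqP; ring.
  rewrite /D ler_wpM2l ?sqr_ge0// [(s^-1 + 1) * _]mulrDl mul1r addrA lerD2r.
  set A := `|q.1.1| + `|q.1.2|; set B := hrem q.
  have hA : A ^+ 2 <= 2 * (q.1.1 ^+ 2 + q.1.2 ^+ 2).
    rewrite /A -(real_normK (num_real q.1.1)) -(real_normK (num_real q.1.2)).
    by have := sqr_ge0 (`|q.1.1| - `|q.1.2|); nra.
  have hs : s * A ^+ 2 <= s * (2 * (q.1.1 ^+ 2 + q.1.2 ^+ 2)) by apply: ler_wpM2l => //; exact: ltW.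
  have : 2 * A * B <= s * A ^+ 2 + s^-1 * B ^+ 2.
    have -> : s * A ^+ 2 + s^-1 * B ^+ 2 = ((s * A) ^+ 2 + B ^+ 2) / s by field; exact: lt0r_neq0.
    by rewrite ler_pdivlMr//; have := sqr_ge0 (s * A - B); nra.
  lra.
have aF := aRm TF; have aG := aRm TG; have aR2 := adm_hrem2.
have aFy := adm_trans y mF bF; have aGy := adm_trans y mG bG.
have mLF : measurable_fun setT LF by rewrite /LF; mfun.
have mLG : measurable_fun setT LG by rewrite /LG; mfun.
have aD : adm D.
  apply: admZ; apply: admD; last exact: admZ.
  by apply: admZ; exact: admD (@adm_x2 R) (@adm_y2 R).
have aS : adm S.
  have [mRF _] := aF; have [mRG _] := aG.
  by apply: (adm_le _ SD aD); rewrite /S; mfun.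
have aL : adm (fun q => U1 y * V1 y * q.1.1 ^+ 2 + U2 y * V2 y * q.1.2 ^+ 2 + (U1 y * V2 y + U2 y * V1 y) * (q.1.1 * q.1.2)).
  apply: admD; last by apply: admZ; exact: adm_xy.
  by apply: admD; apply: admZ; [exact: adm_x2|exact: adm_y2].
have ESb : `|Ex t S| <= M ^+ 2 * (2064 * (t * s) + 2056 * t ^+ 2).
  apply: (le_trans (Ex_norm pk_ge0 t0 aS aD SD)); rewrite /D.
  have ax := admD (@adm_x2 R) (@adm_y2 R).
  rewrite (ExZ pk_ge0 t0 _ (admD (admZ (2 * s) ax) (admZ (s^-1 + 1) aR2))) ler_wpM2l ?sqr_ge0//.
  rewrite (ExD pk_ge0 t0 (admZ (2 * s) ax) (admZ (s^-1 + 1) aR2)) (ExZ pk_ge0 t0 _ ax) (ExZ pk_ge0 t0 _ aR2).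
  rewrite (ExD pk_ge0 t0 (@adm_x2 R) (@adm_y2 R)) Ex_x2// Ex_y2//.
  have sp : 0 <= s^-1 + 1 by rewrite addr_ge0// invr_ge0 ltW.
  have := ler_wpM2l sp Ex_hrem2.
  have -> : (s^-1 + 1) * (2056 * t ^+ 2) = 2056 * (t * s) + 2056 * t ^+ 2.
    by rewrite -s2; field; exact: lt0r_neq0.
  lra.
have EL : Ex t (fun q => U1 y * V1 y * q.1.1 ^+ 2 + U2 y * V2 y * q.1.2 ^+ 2 + (U1 y * V2 y + U2 y * V1 y) * (q.1.1 * q.1.2))
   = 2 * t * (U1 y * V1 y + U2 y * V2 y).
  have p1 := admZ (U1 y * V1 y) (@adm_x2 R); have p2 := admZ (U2 y * V2 y) (@adm_y2 R).
  have p3 := admZ (U1 y * V2 y + U2 y * V1 y) (@adm_xy R).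
  rewrite (ExD pk_ge0 t0 (admD p1 p2) p3) (ExD pk_ge0 t0 p1 p2) (ExZ pk_ge0 t0 _ (@adm_x2 R)).
  by rewrite (ExZ pk_ge0 t0 _ (@adm_y2 R)) (ExZ pk_ge0 t0 _ (@adm_xy R)) Ex_x2// Ex_y2// Ex_xy//; ring.
have key : Pt t (fun q => F q * G q) y = F y * Pt t G y + G y * Pt t F y - F y * G y +
    2 * t * (U1 y * V1 y + U2 y * V2 y) + Ex t S.
  have q1 := admZ (F y) aGy; have q2 := admZ (G y) aFy; have q3 := adm_cst (F y * G y).
  have q12 := admD q1 q2; have q123 := admB q12 q3.
  have -> : Pt t (fun q => F q * G q) y = Ex t (fun q => F y * G (hmul y q) + G y * F (hmul y q) - F y * G y +
    (U1 y * V1 y * q.1.1 ^+ 2 + U2 y * V2 y * q.1.2 ^+ 2 + (U1 y * V2 y + U2 y * V1 y) * (q.1.1 * q.1.2)) + S q).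
    by apply: eq_Ex => q; rewrite /S /LF /LG /Rm; ring.
  rewrite (ExD pk_ge0 t0 (admD q123 aL) aS) (ExD pk_ge0 t0 q123 aL) EL (ExB pk_ge0 t0 q12 q3).
  by rewrite (ExD pk_ge0 t0 q1 q2) (ExZ pk_ge0 t0 _ aGy) (ExZ pk_ge0 t0 _ aFy) (Ex_cst pk_ge0 t0).
(* 2100 covers 2064 = 8 + 2056 for t sqrt t and 2056 + 36 for t^2, where 36 = 6 * 6 comes from the
   product of the two drifts. *)
have dF := taylor_Pt_sub TF; have dG := taylor_Pt_sub TG.
have -> : Pt t (fun q => F q * G q) y - Pt t F y * Pt t G y - 2 * t * (U1 y * V1 y + U2 y * V2 y) =
   Ex t S - (Pt t F y - F y) * (Pt t G y - G y) by rewrite key; ring.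
apply: le_trans (ler_normB _ _) _; rewrite normrM.
have := ler_pM (normr_ge0 _) (normr_ge0 _) dF dG.
have : 0 <= M ^+ 2 * (t * s) by rewrite mulr_ge0 ?sqr_ge0// mulr_ge0 ?(ltW t0) ?(ltW s0).
have : 0 <= M ^+ 2 * t ^+ 2 by rewrite mulr_ge0 ?sqr_ge0.
rewrite -/s; nra.
Qed.

Lemma heat_covariance_le : Pt t (fun q => F q * G q) y - Pt t F y * Pt t G y <=
  2 * t * (Num.sqrt (U1 y ^+ 2 + U2 y ^+ 2) * Num.sqrt (V1 y ^+ 2 + V2 y ^+ 2)) +
  2100 * M ^+ 2 * (t * Num.sqrt t + t ^+ 2).
Proof.
have := heat_covariance_expansion; rewrite ler_norml => /andP[_].
rewrite lerBlDl => h; apply: (le_trans h); rewrite lerD2r ler_wpM2l//; first by rewrite mulr_ge0// ltW.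
rewrite -sqrtrM ?addr_ge0 ?sqr_ge0//; apply: le_trans (ler_norm _) _; rewrite -sqrtr_sqr.
apply: ler_wsqrtr; have := sqr_ge0 (U1 y * V2 y - U2 y * V1 y); nra.
Qed.

End covariance.

End fixed_time.
End taylor.

(** * Entropy of the heat kernel *)

Section log_inequalities.
Context {R : realType}.
Implicit Types p m y : R.

Lemma ln_le_sub1 (x : R) : 0 < x -> ln x <= x - 1.
Proof. by move=> x0; have := @le_ln1Dx R (x - 1) ltac:(lra); rewrite addrC subrK. Qed.

(** 1 + y + y^2/2 is the quadratic truncation of e^y, hence the cubic error; unlike 1 + y it is
    positive for all y. The two signs are separated so that |y|^3 becomes a polynomial. *)
Lemma ln_quadratic_ge y : y - `|y| ^+ 3 <= ln (1 + y + y ^+ 2 / 2).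
Proof.
have Q0 (x : R) : 0 < 1 + x + x ^+ 2 / 2 by have := sqr_ge0 (x + 1); nra.
have dQ (x : R) : is_derive x (1 : R) (fun x => 1 + x + x ^+ 2 / 2) (1 + x).
  by apply: is_derive_eq; rewrite /GRing.scale /=; field.
have dl (x : R) : is_derive x (1 : R) (fun x => ln (1 + x + x ^+ 2 / 2)) ((1 + x) / (1 + x + x ^+ 2 / 2)).
  by have := @is_derive1_comp _ (@ln R) (fun x : R => 1 + x + x ^+ 2 / 2) x _ _ (is_derive1_ln (Q0 x)) (dQ x); rewrite mulrC.
rewrite -subr_ge0; have [y0|y0] := lerP 0 y.
  rewrite (ger0_norm y0).
  have d (x : R) : is_derive x (1 : R) (fun x => ln (1 + x + x ^+ 2 / 2) - (x - x ^+ 3))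
      ((1 + x) / (1 + x + x ^+ 2 / 2) - (1 - 3 * x ^+ 2)).
    by have := dl x => e; apply: is_derive_eq; rewrite /GRing.scale /=; ring.
  have d0 (x : R) : 0 <= x -> 0 <= (1 + x) / (1 + x + x ^+ 2 / 2) - (1 - 3 * x ^+ 2).
    move=> x0; have -> : (1 + x) / (1 + x + x ^+ 2 / 2) - (1 - 3 * x ^+ 2) =
      (3 * x ^+ 2 * (1 + x + x ^+ 2 / 2) - x ^+ 2 / 2) / (1 + x + x ^+ 2 / 2).
      by field; have := Q0 x; move=> /lt0r_neq0; apply: contra => /eqP h; apply/eqP; lra.
    by rewrite divr_ge0 ?(ltW (Q0 x))//; have := sqr_ge0 x; have := mulr_ge0 (sqr_ge0 x) x0; have := sqr_ge0 (x ^+ 2); nra.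
  by have := ge0_derive_le d d0 y0; rewrite !expr0n /= !mul0r !addr0 ln1 !subrr.
pose x := - y; have x0 : 0 <= x by rewrite oppr_ge0 ltW.
have -> : y = - x by rewrite opprK.
rewrite normrN (ger0_norm x0) sqrrN.
have Q0' (z : R) : 0 < 1 - z + z ^+ 2 / 2 by have := Q0 (- z); rewrite sqrrN.
have dl' (z : R) : is_derive z (1 : R) (fun z => ln (1 - z + z ^+ 2 / 2)) ((z - 1) / (1 - z + z ^+ 2 / 2)).
  have dQ' : is_derive z (1 : R) (fun x => 1 - x + x ^+ 2 / 2) (z - 1).
    by apply: is_derive_eq; rewrite /GRing.scale /=; field.
  by have := @is_derive1_comp _ (@ln R) (fun x : R => 1 - x + x ^+ 2 / 2) z _ _ (is_derive1_ln (Q0' z)) dQ'; rewrite mulrC.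
have d (z : R) : is_derive z (1 : R) (fun z => ln (1 - z + z ^+ 2 / 2) - (- z - z ^+ 3))
    ((z - 1) / (1 - z + z ^+ 2 / 2) - (- 1 - 3 * z ^+ 2)).
  by have := dl' z => e; apply: is_derive_eq; rewrite /GRing.scale /=; ring.
have d0 (z : R) : 0 <= z -> 0 <= (z - 1) / (1 - z + z ^+ 2 / 2) - (- 1 - 3 * z ^+ 2).
  move=> z0; have -> : (z - 1) / (1 - z + z ^+ 2 / 2) - (- 1 - 3 * z ^+ 2) =
    (z ^+ 2 / 2) / (1 - z + z ^+ 2 / 2) + 3 * z ^+ 2.
    by field; have := Q0' z; move=> /lt0r_neq0; apply: contra => /eqP h; apply/eqP; lra.
  by rewrite addr_ge0 ?divr_ge0 ?(ltW (Q0' z)) ?sqr_ge0// mulr_ge0 ?sqr_ge0.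
by have := ge0_derive_le d d0 x0; rewrite !expr0n /= !mul0r !oppr0 !addr0 ln1 !subrr.
Qed.

(** Take ln x <= x - 1 at x = m Q / p with Q = 1 + y + y^2/2; [z] is a lower bound for ln Q. At p =
    0 the terms with logarithms vanish. *)
Lemma gibbs p m y z : 0 <= p -> 0 < m -> z <= y - `|y| ^+ 3 ->
  p - m * (1 + y + y ^+ 2 / 2) <= p * ln p - p * ln m - p * z.
Proof.
move=> p0 m0 zy; have Q0 : 0 < 1 + y + y ^+ 2 / 2 by have := sqr_ge0 (y + 1); nra.
have lQ := le_trans zy (ln_quadratic_ge y).
move: (1 + y + y ^+ 2 / 2) Q0 lQ => Q Q0 lQ.
move: p0; rewrite le_eqVlt => /predU1P[<-|p0].
  by rewrite !mul0r !subr0 sub0r oppr_le0 mulr_ge0// ltW.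
have := @ln_le_sub1 (m * Q / p) ltac:(by rewrite divr_gt0// mulr_gt0).
rewrite lnM ?posrE ?invr_gt0 ?mulr_gt0// lnM ?posrE// lnV ?posrE// => h.
have := ler_wpM2l (ltW p0) h.
have -> : p * (m * Q / p - 1) = m * Q - p by field; exact: lt0r_neq0.
have := ler_wpM2l (ltW p0) lQ; lra.
Qed.

(** The negative part of p ln p is not controlled by a multiple of p; it is compared with an
    integrable weight [w] through p ln (w / p) <= w - p. *)
Lemma abs_xlnx_le p w c : 0 <= p -> 0 < w -> p <= c -> w <= 1 ->
  `|p * ln p| <= p * (c + - ln w) + w.
Proof.
move=> p0 w0 pc w1; move: p0; rewrite le_eqVlt => /predU1P[<-|p0].
  by rewrite !mul0r normr0 add0r ltW.
have h1 := @ln_le_sub1 (w / p) ltac:(by rewrite divr_gt0).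
rewrite lnM ?posrE ?invr_gt0// lnV ?posrE// in h1.
have := ler_wpM2l (ltW p0) h1.
have -> : p * (w / p - 1) = w - p by field; exact: lt0r_neq0.
have h2 : ln p <= c by have := ln_le_sub1 p0; lra.
have h3 : ln w <= 0 by have := ln_le_sub1 w0; lra.
have := ler_wpM2l (ltW p0) h2.
have := ler_wpM2l (ltW p0) h3; rewrite mulr0 => h4 h5 h6.
have c0 : 0 <= p * c by rewrite mulr_ge0 ?(ltW p0)// (le_trans (ltW p0)).
by rewrite ler_norml; apply/andP; split; lra.
Qed.

End log_inequalities.

Section entropy.
Context {R : realType}.
Local Notation mu := (@mu1 R).
Local Notation mu6 := (prodm (prodm (prodm mu mu) mu) (prodm (prodm mu mu) mu)).
Hypothesis pk_ge0 : forall (t : R) q, 0 < t -> 0 <= pk t q.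

(** A positive integrable weight whose logarithm is bounded below by minus a quadratic: it makes p
    ln p integrable and later provides the floor of [m]. *)
Definition w3 (q : heis R) : R := w1 q.1.1 * w1 q.1.2 * w1 q.2.

Lemma w3_gt0 q : 0 < w3 q. Proof. by rewrite !mulr_gt0// w1_gt0. Qed.

Let w1_le1 (x : R) : w1 x <= 1.
Proof. by rewrite /w1 invf_le1 ?lerDl ?sqr_ge0// ltr_wpDr ?sqr_ge0. Qed.

Lemma w3_le1 q : w3 q <= 1.
Proof.
have w0 (x : R) : 0 <= w1 x by exact: ltW (w1_gt0 x).
by rewrite /w3 !mulr_ile1// mulr_ge0.
Qed.

Lemma integrable_w3 : mu3.-integrable setT (EFin \o w3).
Proof.
have w0 (x : R) : 0 <= w1 x by exact: ltW (w1_gt0 x).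
exact: (integrable_prod3 w0 w0 w0 integrable_w1 integrable_w1 integrable_w1).
Qed.

Lemma measurable_w3 : measurable_fun setT w3. Proof. exact: integrable_meas integrable_w3. Qed.

Lemma ln_w3_ge q : - (q.1.1 ^+ 2 + q.1.2 ^+ 2 + q.2 ^+ 2) <= ln (w3 q).
Proof.
have l1 (x : R) : - x ^+ 2 <= ln (w1 x).
  have p0 : 0 < 1 + x ^+ 2 by rewrite ltr_wpDr ?sqr_ge0.
  by rewrite /w1 lnV ?posrE// lerN2; have := ln_le_sub1 p0; lra.
have p1 (x : R) : w1 x \is Num.pos by rewrite posrE w1_gt0.
rewrite /w3 !lnM//; last by rewrite posrE mulr_gt0// w1_gt0.
by have := l1 q.1.1; have := l1 q.1.2; have := l1 q.2; lra.
Qed.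

Definition sq3 (q : heis R) : R := q.1.1 ^+ 2 + q.1.2 ^+ 2 + q.2 ^+ 2.
Lemma adm_sq3 : adm sq3.
Proof. by apply: admD (@adm_z2 R); exact: admD (@adm_x2 R) (@adm_y2 R). Qed.

Lemma measurable_lnf (F : heis R -> R) : measurable_fun setT F -> measurable_fun setT (fun q => ln (F q)).
Proof. by move=> mF; exact: (measurableT_comp (@measurable_ln R) mF). Qed.

Lemma integrable_plnp (t : R) : 0 < t -> mu3.-integrable setT (EFin \o (fun q => pk t q * ln (pk t q))).
Proof.
move=> t0; have mk := measurable_pk t0.
have i1 := adm_integrable pk_ge0 t0 (admD (adm_cst (cA t)) adm_sq3).
apply: (integrable_dom _ _ (integrable_add i1 integrable_w3)).
  exact: (measurable_funM mk (measurable_lnf mk)).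
move=> q; have pc : pk t q <= cA t by apply: le_trans (ler_norm _) (pk_le q t0).
apply: le_trans (abs_xlnx_le (pk_ge0 q t0) (w3_gt0 q) pc (w3_le1 q)) _.
rewrite lerD2r [leRHS]mulrC ler_wpM2l ?pk_ge0// lerD2l /sq3.
by have := ln_w3_ge q; lra.
Qed.

(** Minus the differential entropy of the heat kernel. *)
Definition Ent (t : R) := Rintegral mu3 setT (fun q => pk t q * ln (pk t q)).

(** By [pk_scale] the law at time t is a dilate of the law at time 1, so what is added is the
    logarithm of the factor t^-2. *)
Lemma Ent_scale (t : R) : 0 < t -> Ent t = Ent 1 - 2 * ln t.
Proof.
move=> t0; set r := (Num.sqrt t)^-1; have r0 : 0 < r by rewrite invr_gt0 sqrtr_gt0.
have r4 : (r ^+ 4)^-1 = t ^+ 2.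
  by rewrite /r exprVn invrK (exprM _ 2 2) sqr_sqrtr// ltW.
pose G q : R := pk 1 q * ln (pk 1 q) - 2 * ln t * pk 1 q.
have i1 := integrable_plnp (@ltr01 R); have i2 := integrable_pk pk_ge0 (@ltr01 R).
have iG : mu3.-integrable setT (EFin \o G) by exact: (integrable_sub i1 (integrable_scale _ i2)).
have tr (g : heis R -> \bar R) : measurable_fun setT g -> (forall x, 0 <= g x)%E ->
    (\int[mu3]_x g (dil r x) = (t ^+ 2)%:E * \int[mu3]_x g x)%E.
  by move=> mg g0; rewrite -r4; exact: ge0_integral_dil.
have t20 : 0 < t ^+ 2 by exact: exprn_gt0.
have iGd := integrable_transfer (measurable_dil r) (ltW t20) tr iG.
have := Rintegral_transfer tr iG => h.
transitivity ((t ^+ 2)^-1 * Rintegral mu3 setT (G \o dil r)).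
  rewrite /Ent -(RintegralZl _ measurableT iGd); apply: eq_Rintegral => q _.
  rewrite (pk_scale t0 q) -/r /G /=.
  have := pk_ge0 (dil r q) (@ltr01 R); move: (pk 1 (dil r q)) => p.
  rewrite le_eqVlt => /predU1P[<-|p0]; first by rewrite !mulr0 !mul0r subrr mulr0.
  rewrite lnM ?posrE ?invr_gt0// lnV ?posrE// lnXn//; ring.
rewrite h mulrA mulVf ?lt0r_neq0// mul1r.
apply: etrans; first exact: (RintegralB measurableT i1 (integrable_scale (2 * ln t) i2)).
by rewrite (RintegralZl _ measurableT i2) Rintegral_pk// mulr1.
Qed.

Lemma Ent_diff (s t : R) : 0 < s -> 0 < t -> Ent t - Ent (s + t) <= 2 * s / t.
Proof.
move=> s0 t0; have st0 := addr_gt0 s0 t0; rewrite (Ent_scale t0) (Ent_scale st0).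
have := @ln_le_sub1 R ((s + t) / t) ltac:(by rewrite divr_gt0).
rewrite lnM ?posrE ?invr_gt0// lnV ?posrE// => h.
have e : (s + t) / t - 1 = s / t by field; exact: lt0r_neq0.
by rewrite e in h; lra.
Qed.

Lemma Rint6 (Phi : heis R * heis R -> R) (C s t : R) : 0 < s -> 0 < t -> measurable_fun setT Phi ->
  (forall w, `|Phi w| <= C * (weight w.1 * weight w.2)) ->
  mu6.-integrable setT (EFin \o (fun w => Phi w * (pk s w.1 * pk t w.2))) /\
  Rintegral mu6 setT (fun w => Phi w * (pk s w.1 * pk t w.2)) =
  Ex s (fun a => Ex t (fun q => Phi (a, q))).
Proof.
move=> s0 t0 mPhi hC.
have ms := measurable_pk s0; have mt := measurable_pk t0.
have mP : measurable_fun setT (fun w : heis R * heis R => Phi w * (pk s w.1 * pk t w.2)).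
  apply: (measurable_funM mPhi).
  exact: (measurable_funM (measurableT_comp ms measurable_fst) (measurableT_comp mt measurable_snd)).
have iw (u : R) (u0 : 0 < u) : mu3.-integrable setT (EFin \o (fun q => weight q * pk u q)) by exact: integrable_weight.
have bd w : `|Phi w * (pk s w.1 * pk t w.2)| <= C * ((weight w.1 * pk s w.1) * (weight w.2 * pk t w.2)).
  rewrite (normrM (Phi w)) [X in _ * X]ger0_norm; last exact: (mulr_ge0 (pk_ge0 _ s0) (pk_ge0 _ t0)).
  apply: le_trans (ler_wpM2r (mulr_ge0 (pk_ge0 w.1 s0) (pk_ge0 w.2 t0)) (hC w)) _.
  by rewrite le_eqVlt; apply/orP; left; apply/eqP; move: (pk s _) (pk t _) => u v; ring.
have iP : mu6.-integrable setT (EFin \o (fun w => Phi w * (pk s w.1 * pk t w.2))).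
  exact: (integrable_dom mP bd (integrable_scale C (integrable_prod (iw s s0) (iw t t0)))).
split => //.
have aP a : adm (fun q => Phi (a, q)).
  split; first by apply: (measurableT_comp mPhi (g := fun q => (a, q))); exact: measurable_fun_pair.
  by exists (C * weight a) => q; rewrite -mulrA; exact: hC.
have iq a := adm_integrable pk_ge0 t0 (aP a).
rewrite (Rfubini1 iP).
  apply: eq_Rintegral => a _; rewrite [RHS]mulrC -(RintegralZl _ measurableT (iq a)).
  by apply: eq_Rintegral => q _; exact: mulrCA.
move=> a; have := integrable_scale (pk s a) (iq a).
by apply: eq_integrable => // q _; rewrite /=; congr EFin; exact: mulrCA.
Qed.

End entropy.

(** * The entropic gradient bound *)

Section entropic_gradient_bound.
Context {R : realType}.
Local Notation mu := (@mu1 R).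
Local Notation mu6 := (prodm (prodm (prodm mu mu) mu) (prodm (prodm mu mu) mu)).
Hypothesis pk_ge0 : forall (t : R) q, 0 < t -> 0 <= pk t q.
(** [V0] and ([A], [B]) stand for the value and the horizontal gradient of [Pt t g] at the identity;
    [g_exp] is the expansion supplied by [taylor_horizontal]. Other base points are reached by
    translating [g]. *)
Variables (t : R) (g : heis R -> R) (V0 A B M : R).
Hypotheses (t0 : 0 < t) (mg : measurable_fun setT g) (g1 : forall q, `|g q| <= 1).
Hypothesis g_exp : forall a, `|Pt t g a - V0 - a.1.1 * A - a.1.2 * B| <= M * hrem a.

Let N := A ^+ 2 + B ^+ 2.
Let c := `|A| + `|B|.
Let l1 (a : heis R) := A * a.1.1 + B * a.1.2.
Let c0 : 0 <= c. Proof. by rewrite addr_ge0. Qed.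
Let M0 : 0 <= M.
Proof.
have := le_trans (normr_ge0 _) (g_exp (1, 0, 0)).
by rewrite /hrem /= normr0 mulr0 expr1n expr0n /= add0r addr0 mulr1.
Qed.
Let ml1 : measurable_fun setT l1. Proof. by rewrite /l1; mfun. Qed.
Let mg_rho : measurable_fun setT (fun b => g (rho b)).
Proof. exact: (measurableT_comp mg measurable_rho). Qed.

(* Using both [g b] and [g (rho b)] doubles the drift and the quadratic term of [Q] for
   the same entropy: this gives the constant 1 in [gradient_le_inv_sqrt] instead of
   [sqrt 2]. *)
Let Y (a b : heis R) : R := l1 a * g b + l1 (rho a) * g (rho b).

Let l1_le a : `|l1 a| <= c * (`|a.1.1| + `|a.1.2|).
Proof.
apply: le_trans (ler_normD _ _) _; rewrite !normrM /c.
by have := mulr_ge0 (normr_ge0 A) (normr_ge0 a.1.2); have := mulr_ge0 (normr_ge0 B) (normr_ge0 a.1.1); lra.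
Qed.

Let l1r_le a : `|l1 (rho a)| <= c * (`|a.1.1| + `|a.1.2|).
Proof. by have := l1_le (rho a); rewrite /rho /= normrN addrC [`|a.1.1| + _]addrC addrC. Qed.

Let Y_le a b : `|Y a b| <= 2 * c * (`|a.1.1| + `|a.1.2|).
Proof.
apply: le_trans (ler_normD _ _) _; rewrite !normrM.
have := ler_pM (normr_ge0 _) (normr_ge0 _) (l1_le a) (g1 b).
have := ler_pM (normr_ge0 _) (normr_ge0 _) (l1r_le a) (g1 (rho b)); lra.
Qed.

Variable s : R.
Hypothesis s0 : 0 < s.
Let st0 : 0 < s + t. Proof. exact: addr_gt0. Qed.
Let sg := Num.sqrt s.
Let sg0 : 0 < sg. Proof. by rewrite sqrtr_gt0. Qed.
Let sg2 : sg ^+ 2 = s. Proof. by rewrite sqr_sqrtr// ltW. Qed.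

(** Majorant of |Y|^3 by even moments, from l^3 <= (sg l^2 + l^4 / sg) / 2 with l = |x| + |y| and
    |Y| <= 2 c l. As sg = sqrt s, both means are of order s sqrt s. *)
Let E3 (a : heis R) : R := 8 * c ^+ 3 * (sg * (a.1.1 ^+ 2 + a.1.2 ^+ 2) + 4 / sg * (a.1.1 ^+ 4 + a.1.2 ^+ 4)).

Let Y3_le a b : `|Y a b| ^+ 3 <= E3 a.
Proof.
set l := `|a.1.1| + `|a.1.2|; have ll : 0 <= l by rewrite addr_ge0.
apply: (@le_trans _ _ ((2 * c * l) ^+ 3)).
  by apply: lerXn2r; rewrite ?nnegrE ?normr_ge0// ?mulr_ge0//; exact: Y_le.
have -> : (2 * c * l) ^+ 3 = 8 * c ^+ 3 * l ^+ 3 by ring.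
rewrite /E3 ler_wpM2l ?mulr_ge0 ?exprn_ge0//.
have -> : a.1.1 ^+ 4 = (a.1.1 ^+ 2) ^+ 2 by rewrite -exprM.
have -> : a.1.2 ^+ 4 = (a.1.2 ^+ 2) ^+ 2 by rewrite -exprM.
rewrite -(real_normK (num_real a.1.1)) -(real_normK (num_real a.1.2)).
move: (`|a.1.1|) (`|a.1.2|) @l ll (normr_ge0 a.1.1) (normr_ge0 a.1.2) => u v l ll u0 v0.
have h2 : l ^+ 2 <= 2 * (u ^+ 2 + v ^+ 2) by rewrite /l; have := sqr_ge0 (u - v); nra.
have h4 : (l ^+ 2) ^+ 2 <= 8 * ((u ^+ 2) ^+ 2 + (v ^+ 2) ^+ 2).
  apply: (@le_trans _ _ ((2 * (u ^+ 2 + v ^+ 2)) ^+ 2)).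
    by apply: lerXn2r; rewrite ?nnegrE ?mulr_ge0 ?addr_ge0 ?sqr_ge0.
  by have := sqr_ge0 (u ^+ 2 - v ^+ 2); nra.
have h3 : 2 * l ^+ 3 <= sg * l ^+ 2 + (l ^+ 2) ^+ 2 / sg.
  have -> : sg * l ^+ 2 + (l ^+ 2) ^+ 2 / sg = ((sg * l) ^+ 2 + (l ^+ 2) ^+ 2) / sg by field; exact: lt0r_neq0.
  rewrite ler_pdivlMr//; have := sqr_ge0 (sg * l - l ^+ 2); nra.
have k1 := ler_wpM2l (ltW sg0) h2.
have sgi : 0 <= sg^-1 by rewrite invr_ge0 ltW.
have k2 := ler_wpM2r sgi h4.
lra.
Qed.

Let aE3 : adm E3.
Proof.
apply: admZ; apply: admD; apply: admZ; first exact: admD (@adm_x2 R) (@adm_y2 R).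
exact: admD (@adm_x4 R) (@adm_y4 R).
Qed.

Let Ex_E3 : Ex s E3 <= 16416 * c ^+ 3 * (s * sg).
Proof.
have a2 := admD (@adm_x2 R) (@adm_y2 R); have a4 := admD (@adm_x4 R) (@adm_y4 R).
have b2 := admZ sg a2; have b4 := admZ (4 / sg) a4.
rewrite /E3 (ExZ pk_ge0 s0 _ (admD b2 b4)) (ExD pk_ge0 s0 b2 b4) (ExZ pk_ge0 s0 _ a2) (ExZ pk_ge0 s0 _ a4).
rewrite (ExD pk_ge0 s0 (@adm_x2 R) (@adm_y2 R)) (ExD pk_ge0 s0 (@adm_x4 R) (@adm_y4 R)).
rewrite (Ex_x2 pk_ge0 s0) (Ex_y2 pk_ge0 s0).
have := Ex_x4 pk_ge0 s0; have := Ex_y4 pk_ge0 s0.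
move: (Ex s _) (Ex s _) => u v hu hv.
have -> : 16416 * c ^+ 3 * (s * sg) = 8 * c ^+ 3 * (2052 * (s * sg)) by ring.
rewrite ler_wpM2l ?mulr_ge0 ?exprn_ge0//.
have k : 4 / sg * (v + u) <= 4 / sg * (512 * s ^+ 2).
  by apply: ler_wpM2l; [rewrite divr_ge0// ltW|lra].
have e : 4 / sg * (512 * s ^+ 2) = 2048 * (s * sg) by rewrite -sg2; field; exact: lt0r_neq0.
lra.
Qed.

Let rhoM (a q : heis R) : rho (hmul a q) = hmul (rho a) (rho q).
Proof. by rewrite !hmulE /rho /=; congr (_, _, _); ring. Qed.

Let al1 : adm l1. Proof. by apply: admD; apply: admZ; [exact: adm_x|exact: adm_y]. Qed.

Let mPt : measurable_fun setT (Pt t g). Proof. exact: (measurable_Pt pk_ge0 t0 mg g1). Qed.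
Let Pt1 a : `|Pt t g a| <= 1. Proof. exact: (Pt_bnd pk_ge0 a t0 mg g1). Qed.

Let aLP : adm (fun a => l1 a * Pt t g a).
Proof. by have := admM mPt Pt1 al1; under eq_fun do rewrite mulrC. Qed.

Let aLPr : adm (fun a => l1 (rho a) * Pt t g (rho a)).
Proof.
have mr := measurable_rho (R := R).
have ar : adm (fun a => l1 (rho a)).
  by apply: admD; [apply: admZ; exact: adm_y|have := admZ (- B) (@adm_x R); under eq_fun do rewrite mulNr -mulrN].
by have := admM (measurableT_comp mPt mr) (fun a => Pt1 (rho a)) ar; under eq_fun do rewrite mulrC.
Qed.

(** Against the linear form [l1] the constant [V0] has mean 0, the linear part of [Pt t g] gives 2 s
    (A^2 + B^2), and the remainder is of order s sqrt s; 1032 = 4 + 2056/2. *)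
Let Ex_LP : 2 * s * N - 1032 * (c * M) * (s * sg) <= Ex s (fun a => l1 a * Pt t g a).
Proof.
pose e a := Pt t g a - V0 - a.1.1 * A - a.1.2 * B.
pose D (a : heis R) : R := c * M * (sg * (a.1.1 ^+ 2 + a.1.2 ^+ 2) + (2 * sg)^-1 * hrem a ^+ 2).
have a2 := admD (@adm_x2 R) (@adm_y2 R); have ar2 := @adm_hrem2 R.
have d1 := admZ sg a2; have d2 := admZ (2 * sg)^-1 ar2.
have aD : adm D := admZ (c * M) (admD d1 d2).
have De a : `|l1 a * e a| <= D a.
  rewrite normrM; apply: (le_trans (ler_pM (normr_ge0 _) (normr_ge0 _) (l1_le a) (g_exp a))).
  rewrite mulrACA /D ler_wpM2l ?mulr_ge0//.
  rewrite -(real_normK (num_real a.1.1)) -(real_normK (num_real a.1.2)).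
  move: (`|a.1.1|) (`|a.1.2|) (hrem a) => u v r.
  have -> : sg * (u ^+ 2 + v ^+ 2) + (2 * sg)^-1 * r ^+ 2 = (2 * sg ^+ 2 * (u ^+ 2 + v ^+ 2) + r ^+ 2) / (2 * sg).
    by field; exact: lt0r_neq0.
  rewrite ler_pdivlMr ?mulr_gt0//; have := sqr_ge0 (sg * (u + v) - r); have := sqr_ge0 (sg * (u - v)); nra.
have me : measurable_fun setT e by rewrite /e; mfun.
have ae : adm (fun a => l1 a * e a) by apply: (adm_le _ De aD); mfun.
pose q2 (a : heis R) : R := A ^+ 2 * a.1.1 ^+ 2 + B ^+ 2 * a.1.2 ^+ 2 + (2 * A * B) * (a.1.1 * a.1.2).
have p1 := admZ (A ^+ 2) (@adm_x2 R); have p2 := admZ (B ^+ 2) (@adm_y2 R); have p3 := admZ (2 * A * B) (@adm_xy R).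
have aq2 : adm q2 := admD (admD p1 p2) p3.
have Eq2 : Ex s q2 = 2 * s * N.
  rewrite /q2 (ExD pk_ge0 s0 (admD p1 p2) p3) (ExD pk_ge0 s0 p1 p2) (ExZ pk_ge0 s0 _ (@adm_x2 R)).
  rewrite (ExZ pk_ge0 s0 _ (@adm_y2 R)) (ExZ pk_ge0 s0 _ (@adm_xy R)).
  by rewrite (Ex_x2 pk_ge0 s0) (Ex_y2 pk_ge0 s0) (Ex_xy pk_ge0 s0) /N; ring.
have El1 : Ex s l1 = 0.
  rewrite /l1 (ExD pk_ge0 s0 (admZ A (@adm_x R)) (admZ B (@adm_y R))) (ExZ pk_ge0 s0 _ (@adm_x R)).
  by rewrite (ExZ pk_ge0 s0 _ (@adm_y R)) (Ex_x pk_ge0 s0) (Ex_y pk_ge0 s0) !mulr0 addr0.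
have -> : Ex s (fun a => l1 a * Pt t g a) = Ex s (fun a => V0 * l1 a + q2 a + l1 a * e a).
  by apply: eq_Ex => a; rewrite /q2 /e /l1; ring.
rewrite (ExD pk_ge0 s0 (admD (admZ V0 al1) aq2) ae) (ExD pk_ge0 s0 (admZ V0 al1) aq2).
rewrite (ExZ pk_ge0 s0 _ al1) El1 Eq2 mulr0 add0r lerD2l.
have := Ex_norm pk_ge0 s0 ae aD De; rewrite ler_norml => /andP[h _]; apply: le_trans h.
rewrite lerN2 (ExZ pk_ge0 s0 _ (admD d1 d2)) (ExD pk_ge0 s0 d1 d2) (ExZ pk_ge0 s0 _ a2) (ExZ pk_ge0 s0 _ ar2).
rewrite (ExD pk_ge0 s0 (@adm_x2 R) (@adm_y2 R)) (Ex_x2 pk_ge0 s0) (Ex_y2 pk_ge0 s0).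
have -> : 1032 * (c * M) * (s * sg) = c * M * (1032 * (s * sg)) by ring.
rewrite ler_wpM2l ?mulr_ge0//.
have k : (2 * sg)^-1 * Ex s (fun q => hrem q ^+ 2) <= (2 * sg)^-1 * (2056 * s ^+ 2).
  by apply: ler_wpM2l; [rewrite invr_ge0 mulr_ge0// ltW|exact: Ex_hrem2].
have e' : (2 * sg)^-1 * (2056 * s ^+ 2) = 1028 * (s * sg) by rewrite -sg2; field; exact: lt0r_neq0.
lra.
Qed.

(** By [Y3_le] and [ln_quadratic_ge], a lower bound for ln (1 + Y + Y^2/2) at (a, a q); it plays the
    part of [z] in [gibbs]. *)
Let Z (w : heis R * heis R) : R := Y w.1 (hmul w.1 w.2) - E3 w.1.

Let w_ge1 (q : heis R) : 1 <= weight q. Proof. exact: weight_ge1. Qed.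

Let weightM (w : heis R * heis R) : weight w.1 <= weight w.1 * weight w.2 :> R.
Proof. by rewrite ler_peMr//; exact: le_trans (w_ge1 _). Qed.

Let mZ : measurable_fun setT Z.
Proof.
have mh := @measurable_hmul2 R; have mr := measurable_rho (R := R).
have h1 : measurable_fun setT (fun w : heis R * heis R => l1 w.1) by exact: (measurableT_comp ml1 measurable_fst).
have h2 : measurable_fun setT (fun w : heis R * heis R => l1 (rho w.1)) by exact: (measurableT_comp (measurableT_comp ml1 mr) measurable_fst).
have h3 : measurable_fun setT (fun w : heis R * heis R => g (hmul w.1 w.2)) by exact: (measurableT_comp mg mh).
have h4 : measurable_fun setT (fun w : heis R * heis R => g (rho (hmul w.1 w.2))) by exact: (measurableT_comp mg_rho mh).
have h5 : measurable_fun setT (fun w : heis R * heis R => E3 w.1) by have [m5 _] := aE3; exact: (measurableT_comp m5 measurable_fst).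
by rewrite /Z /Y; mfun.
Qed.

Let Z_le : exists C, forall w, `|Z w| <= C * (weight w.1 * weight w.2).
Proof.
have [_ [C1 h1]] := adm_abs (@adm_x R); have [_ [C2 h2]] := adm_abs (@adm_y R).
have [_ [C3 h3]] := aE3.
exists (2 * c * (C1 + C2) + C3) => w.
apply: (@le_trans _ _ ((2 * c * (C1 + C2) + C3) * weight w.1)).
  apply: le_trans (ler_normB _ _) _; rewrite mulrDl; apply: lerD; last exact: h3.
  apply: le_trans (Y_le _ _) _; rewrite -[leRHS]mulrA; apply: ler_wpM2l; first by rewrite mulr_ge0.
  have := h1 w.1; have := h2 w.1; rewrite !normr_id mulrDl; lra.
apply: ler_wpM2l => //.
have C_ge0 (C : R) (F : heis R -> R) : (forall q, `|F q| <= C * weight q) -> 0 <= C.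
  move=> /(_ (0, 0, 0)) /(le_trans (normr_ge0 _)); rewrite pmulr_lge0//.
  exact: lt_le_trans (w_ge1 _).
by rewrite addr_ge0 ?mulr_ge0 ?addr_ge0 ?(C_ge0 _ _ h1) ?(C_ge0 _ _ h2) ?(C_ge0 _ _ h3).
Qed.

Let aYq a : adm (fun q => Y a (hmul a q)).
Proof.
have h1 := admZ (l1 a) (adm_trans a mg g1).
have h2 := admZ (l1 (rho a)) (adm_trans a mg_rho (fun q => g1 (rho q))).
exact: admD h1 h2.
Qed.

(** [rho] is an automorphism preserving both laws, so the rotated half of [Y] has the same mean as
    the other; hence the factor 2. *)
Let ExZ_val : Ex s (fun a => Ex t (fun q => Z (a, q))) = 2 * Ex s (fun a => l1 a * Pt t g a) - Ex s E3.
Proof.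
have inner a : Ex t (fun q => Z (a, q)) = l1 a * Pt t g a + l1 (rho a) * Pt t g (rho a) - E3 a.
  apply: etrans; first exact: (ExB pk_ge0 t0 (aYq a) (adm_cst (E3 a))).
  rewrite (Ex_cst pk_ge0 t0); congr (_ - _).
  have h1 := adm_trans a mg g1; have h2 := adm_trans a mg_rho (fun q => g1 (rho q)).
  rewrite /Y (ExD pk_ge0 t0 (admZ (l1 a) h1) (admZ (l1 (rho a)) h2)) (ExZ pk_ge0 t0 _ h1) (ExZ pk_ge0 t0 _ h2).
  congr (_ + _ * _); rewrite /Pt -[RHS](Rintegral_rho_pk (F := fun q => g (hmul (rho a) q))); last first.
    exact: (adm_integrable pk_ge0 t0 (adm_trans (rho a) mg g1)).
  by apply: eq_Rintegral => q _; rewrite rhoM.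
rewrite (eq_Ex s inner) (ExB pk_ge0 s0 (admD aLP aLPr) aE3) (ExD pk_ge0 s0 aLP aLPr).
have -> : Ex s (fun a => l1 (rho a) * Pt t g (rho a)) = Ex s (fun a => l1 a * Pt t g a).
  exact: (Rintegral_rho_pk (F := fun a => l1 a * Pt t g a) (adm_integrable pk_ge0 s0 aLP)).
ring.
Qed.

Section regularised.
Variable eta : R.
Hypothesis eta0 : 0 < eta.

(* The floor [eta * w3] keeps [ln m] of polynomial growth. *)
Let m (b : heis R) : R := Num.max (pk (s + t) b) (eta * w3 b).
Let m_gt0 b : 0 < m b. Proof. by rewrite /m lt_max [X in _ || X]mulr_gt0 ?w3_gt0 ?orbT. Qed.
Let mst := measurable_pk st0.
Let ms := measurable_pk s0.
Let mt := measurable_pk t0.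
Let mm : measurable_fun setT m.
Proof.
apply: (measurable_maxr mst); have mw := @measurable_w3 R.
exact: (measurable_funM (measurable_cst eta) mw).
Qed.

Let a_lnm : adm (fun b => ln (m b)).
Proof.
pose C := cA (s + t) + eta + `|ln eta|.
apply: (adm_le (G := fun q => C + sq3 q)); [exact: measurable_lnf| |exact: admD (adm_cst C) (@adm_sq3 R)].
move=> q; rewrite /C.
have w1 := w3_le1 q; have w0 := w3_gt0 q.
have mc : m q <= cA (s + t) + eta.
  have c1 := cA_ge0 st0.
  rewrite /m ge_max; apply/andP; split.
    by apply: le_trans (le_trans (ler_norm _) (pk_le q st0)) _; rewrite lerDl ltW.
  have : eta * w3 q <= eta * 1 by rewrite ler_wpM2l// ltW.
  lra.
have h1 : ln (m q) <= cA (s + t) + eta by have := ln_le_sub1 (m_gt0 q); lra.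
have h2 : ln (eta * w3 q) <= ln (m q).
  by rewrite ler_ln ?posrE ?(m_gt0 q) ?(mulr_gt0 eta0 w0)// /m le_max lexx orbT.
rewrite lnM ?posrE// in h2; have h3 := ln_w3_ge q; rewrite -/(sq3 q) in h3.
have := ler_norm (- ln eta); rewrite normrN => h4.
have := normr_ge0 (ln eta) => h5.
have sq0 : 0 <= sq3 q by rewrite /sq3 !addr_ge0 ?sqr_ge0.
have c1 := cA_ge0 st0; have e1 := ltW eta0.
rewrite ler_norml; apply/andP; split; lra.
Qed.

Let Q (a b : heis R) : R := 1 + Y a b + Y a b ^+ 2 / 2.
Let Q0 a b : 0 <= Q a b. Proof. by rewrite /Q; have := sqr_ge0 (Y a b + 1); nra. Qed.

Let mY2 : measurable_fun setT (fun w : heis R * heis R => Y w.1 w.2).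
Proof.
have mr := measurable_rho (R := R).
have h1 : measurable_fun setT (fun w : heis R * heis R => l1 w.1) by exact: (measurableT_comp ml1 measurable_fst).
have h2 : measurable_fun setT (fun w : heis R * heis R => l1 (rho w.1)) by exact: (measurableT_comp (measurableT_comp ml1 mr) measurable_fst).
have h3 : measurable_fun setT (fun w : heis R * heis R => g w.2) by exact: (measurableT_comp mg measurable_snd).
have h4 : measurable_fun setT (fun w : heis R * heis R => g (rho w.2)) by exact: (measurableT_comp mg_rho measurable_snd).
by rewrite /Y; mfun.
Qed.

Let I := Rintegral mu3 setT (@w3 R).
Let G (w : heis R * heis R) : R := m w.2 * (pk s w.1 * Q w.1 w.2).
Let G0 w : 0 <= G w.
Proof. exact: (mulr_ge0 (ltW (m_gt0 _)) (mulr_ge0 (pk_ge0 _ s0) (Q0 _ _))). Qed.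
Let mG : measurable_fun setT G.
Proof.
apply: (measurable_funM (measurableT_comp mm measurable_snd)).
apply: (measurable_funM (measurableT_comp ms measurable_fst)).
by rewrite /Q; mfun.
Qed.

(** For fixed [b], [Y] is linear in [a] with coefficients [k1] and [k2]. Thanks to the quarter turn
    k1^2 + k2^2 = (u^2 + v^2) N has no cross term, and it is at most 2 N because |g| <= 1. *)
Let aQ b : adm (fun a => Q a b) /\ Ex s (fun a => Q a b) <= 1 + 2 * s * N.
Proof.
pose u := g b; pose v := g (rho b).
have u2 : u ^+ 2 <= 1 by rewrite -(real_normK (num_real u)) -(expr1n R 2) lerXn2r ?nnegrE//; exact: g1.
have v2 : v ^+ 2 <= 1 by rewrite -(real_normK (num_real v)) -(expr1n R 2) lerXn2r ?nnegrE//; exact: g1.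
pose k1 := A * u - B * v; pose k2 := B * u + A * v.
have QE a : Q a b = 1 + k1 * a.1.1 + k2 * a.1.2 + k1 ^+ 2 / 2 * a.1.1 ^+ 2 + k2 ^+ 2 / 2 * a.1.2 ^+ 2 + k1 * k2 * (a.1.1 * a.1.2).
  by rewrite /Q /Y /l1 /rho /= -/u -/v /k1 /k2; field.
have a0 := adm_cst (1 : R); have a1 := admZ k1 (@adm_x R); have a2 := admZ k2 (@adm_y R).
have a3 := admZ (k1 ^+ 2 / 2) (@adm_x2 R); have a4 := admZ (k2 ^+ 2 / 2) (@adm_y2 R); have a5 := admZ (k1 * k2) (@adm_xy R).
rewrite (funext QE); split; first exact: admD (admD (admD (admD (admD a0 a1) a2) a3) a4) a5.
rewrite (ExD pk_ge0 s0 (admD (admD (admD (admD a0 a1) a2) a3) a4) a5) (ExD pk_ge0 s0 (admD (admD (admD a0 a1) a2) a3) a4).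
rewrite (ExD pk_ge0 s0 (admD (admD a0 a1) a2) a3) (ExD pk_ge0 s0 (admD a0 a1) a2) (ExD pk_ge0 s0 a0 a1).
rewrite (Ex_cst pk_ge0 s0) (ExZ pk_ge0 s0 _ (@adm_x R)) (ExZ pk_ge0 s0 _ (@adm_y R)) (ExZ pk_ge0 s0 _ (@adm_x2 R)).
rewrite (ExZ pk_ge0 s0 _ (@adm_y2 R)) (ExZ pk_ge0 s0 _ (@adm_xy R)).
rewrite (Ex_x2 pk_ge0 s0) (Ex_y2 pk_ge0 s0) (Ex_xy pk_ge0 s0) (Ex_x pk_ge0 s0) (Ex_y pk_ge0 s0).
have -> : 1 + k1 * 0 + k2 * 0 + k1 ^+ 2 / 2 * (2 * s) + k2 ^+ 2 / 2 * (2 * s) + k1 * k2 * 0 = 1 + s * ((u ^+ 2 + v ^+ 2) * N).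
  by rewrite /k1 /k2 /N; field.
rewrite lerD2l [2 * s]mulrC -mulrA; apply: ler_wpM2l; first exact: ltW.
by apply: ler_wpM2r; [rewrite addr_ge0 ?sqr_ge0|lra].
Qed.

(** Total mass of the comparison density. After the substitution b = a q, integrating in [a] first
    gives at most 1 + 2 s N by [aQ], and m <= p_(s+t) + eta w3 gives 1 + eta I. *)
Let T5 : mu6.-integrable setT (EFin \o (fun w => m (hmul w.1 w.2) * (pk s w.1 * Q w.1 (hmul w.1 w.2)))) /\
  Rintegral mu6 setT (fun w => m (hmul w.1 w.2) * (pk s w.1 * Q w.1 (hmul w.1 w.2))) <=
  (1 + 2 * s * N) * (1 + eta * I).
Proof.
have mh : measurable_fun setT (fun w : heis R * heis R => (w.1, hmul w.1 w.2)).
  by apply: measurable_fun_pair; [exact: measurable_fst|exact: measurable_hmul2].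
apply: (@le_integrable_EFin _ _ _ mu6 (fun w => G (w.1, hmul w.1 w.2))).
- exact: (measurableT_comp mG mh).
- by move=> w; exact: G0.
rewrite (ge0_integral_comp mG G0).
have mG' : measurable_fun setT (fun w => (G w)%:E) by apply/measurable_EFinP.
have G0' w : (0 <= (G w)%:E)%E by rewrite lee_fin.
have -> := @fubini_tonelli2 _ _ _ _ R _ _ _ mG' G0'.
have N0 : 0 <= N by rewrite /N addr_ge0 ?sqr_ge0.
have k0 : 0 <= 1 + 2 * s * N by rewrite addr_ge0// mulr_ge0// mulr_ge0// ltW.
pose H b : R := (1 + 2 * s * N) * (pk (s + t) b + eta * w3 b).
have iw := @integrable_w3 R; have ip := integrable_pk pk_ge0 st0.
have iH : mu3.-integrable setT (EFin \o H).
  exact: (integrable_scale _ (integrable_add ip (integrable_scale eta iw))).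
apply: (@le_trans _ _ (\int[mu3]_b (H b)%:E)%E).
  apply: ge0_le_integral => //.
  - by move=> b _; apply: integral_ge0.
  - exact: (@measurable_fun_fubini_tonelli_G _ _ _ _ R mu3 _ mG' G0').
  - by apply/measurable_EFinP; exact: integrable_meas iH.
  - move=> b _; rewrite /fubini_G /=.
    have [ab Eb] := aQ b; have ib := adm_integrable pk_ge0 s0 ab.
    have ib' : mu3.-integrable setT (EFin \o (fun a => pk s a * Q a b)).
      by apply: eq_integrable ib => // a _ /=; rewrite mulrC.
    have e1 := EFin_Rintegral (integrable_scale (m b) ib').
    have e2 := RintegralZl (m b) measurableT ib'.
    have -> : (\int[mu3]_x (G (x, b))%:E)%E = (m b * Rintegral mu3 setT (fun a => pk s a * Q a b))%:E.
      by rewrite -e2 -e1.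
    have -> : Rintegral mu3 setT (fun a => pk s a * Q a b) = Ex s (fun a => Q a b).
      by apply: eq_Rintegral => a _; exact: mulrC.
    rewrite lee_fin /H mulrC; apply: ler_pM => //.
    + by apply: (Ex_ge0 pk_ge0 s0 ab) => a; exact: Q0.
    + exact: ltW.
    + have p0 := pk_ge0 b st0; have e0 : 0 <= eta * w3 b by rewrite mulr_ge0// ltW// w3_gt0.
      by rewrite /m ge_max lerDl e0 lerDr p0.
rewrite (EFin_Rintegral iH) lee_fin (RintegralZl _ measurableT (integrable_add ip (integrable_scale eta iw))).
rewrite (RintegralD measurableT ip (integrable_scale eta iw)) (RintegralZl _ measurableT iw).
by rewrite (Rintegral_pk pk_ge0 st0).
Qed.

Let P (w : heis R * heis R) : R := pk s w.1 * pk t w.2.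

Let lerM_alg (x1 x2 x3 x4 x5 y1 y2 : R) : x1 * (x2 - x3 * x4) <= x1 * (x2 * y1 - x2 * y2 - x2 * x5) ->
  1 * (x1 * x2) - x3 * (x1 * x4) <= x1 * (x2 * y1) - y2 * (x1 * x2) - x5 * (x1 * x2).
Proof.
have -> : 1 * (x1 * x2) - x3 * (x1 * x4) = x1 * (x2 - x3 * x4) by ring.
by have -> : x1 * (x2 * y1) - y2 * (x1 * x2) - x5 * (x1 * x2) = x1 * (x2 * y1 - x2 * y2 - x2 * x5) by ring.
Qed.

Let ler_gap (k x x' e1 e2 z : R) : e2 <= x' -> x <= k -> 1 - x <= e1 - x' - z -> 1 - k <= e1 - e2 - z.
Proof. by lra. Qed.

(** [gibbs] with p = p_t(q), m = m(a q) and y = Y(a, a q), integrated against p_s(a). As a q has law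
    p_(s+t), the mean of ln m becomes an integral over a single copy of the group. *)
Let entropy_reg : 1 - (1 + 2 * s * N) * (1 + eta * I) <=
  Ent t - Ent (s + t) - (2 * Ex s (fun a => l1 a * Pt t g a) - Ex s E3).
Proof.
have [i5 h5] := T5.
have [CZ hZ] := Z_le.
have [iZ eZ] := Rint6 pk_ge0 s0 t0 mZ hZ.
have [i2 e2] := pk_comp pk_ge0 s0 t0 (measurable_lnf mm) (adm_integrable pk_ge0 st0 a_lnm).
have [i4 e4] := Rint6 (Phi := fun _ : heis R * heis R => 1 : R) (C := 1) pk_ge0 s0 t0 (measurable_cst _) ltac:(by move=> w;
  rewrite normr1 mul1r (le_trans (w_ge1 w.1))).
have e4' : Ex s (fun=> Ex t (fun=> 1)) = 1 by rewrite (eq_Ex s (fun=> Ex_cst pk_ge0 t0 1)) (Ex_cst pk_ge0 s0).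
rewrite e4' in e4.
have ip := integrable_plnp pk_ge0 t0.
have i1 : mu6.-integrable setT (EFin \o (fun w : heis R * heis R => pk s w.1 * (pk t w.2 * ln (pk t w.2)))).
  exact: (integrable_prod (integrable_pk pk_ge0 s0) ip).
have e1 : Rintegral mu6 setT (fun w : heis R * heis R => pk s w.1 * (pk t w.2 * ln (pk t w.2))) = Ent t.
  rewrite (Rfubini1 i1); last by move=> a; exact: (integrable_scale (pk s a) ip).
  transitivity (Rintegral mu3 setT (fun a => Ent t * pk s a)).
    by apply: eq_Rintegral => a _; rewrite /= (RintegralZl _ measurableT ip) mulrC.
  by rewrite (RintegralZl _ measurableT (integrable_pk pk_ge0 s0)) (Rintegral_pk pk_ge0 s0) mulr1.
(* Since m >= p_(s+t), the mean of ln m is at least [Ent (s + t)]: the right direction, as it enters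
   with a minus sign. *)
have h2 : Ent (s + t) <= Rintegral mu3 setT (fun b => ln (m b) * pk (s + t) b).
  apply: (le_Rintegral measurableT (integrable_plnp pk_ge0 st0) (adm_integrable pk_ge0 st0 a_lnm)) => b _.
  have := pk_ge0 b st0; rewrite le_eqVlt => /predU1P[<-|p0]; first by rewrite mul0r mulr0.
  rewrite mulrC ler_wpM2r ?(ltW p0)//; rewrite ler_ln ?posrE//.
  by rewrite /m le_max lexx.
pose L (w : heis R * heis R) : R := 1 * P w - m (hmul w.1 w.2) * (pk s w.1 * Q w.1 (hmul w.1 w.2)).
pose U (w : heis R * heis R) : R := pk s w.1 * (pk t w.2 * ln (pk t w.2)) - ln (m (hmul w.1 w.2)) * P w - Z w * P w.
have iL : mu6.-integrable setT (EFin \o L) by exact: (integrable_sub i4 i5).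
have i12 := integrable_sub i1 i2.
have iU : mu6.-integrable setT (EFin \o U) by exact: (integrable_sub i12 iZ).
have LU w : L w <= U w.
  rewrite /L /U /P; have p1 := pk_ge0 w.1 s0; have p2 := pk_ge0 w.2 t0.
  have z3 : Z w <= Y w.1 (hmul w.1 w.2) - `|Y w.1 (hmul w.1 w.2)| ^+ 3.
    by rewrite /Z lerD2l lerN2; exact: Y3_le.
  have := ler_wpM2l p1 (gibbs p2 (m_gt0 (hmul w.1 w.2)) z3).
  rewrite -/(Q w.1 (hmul w.1 w.2)).
  move: (pk s w.1) (pk t w.2) (m _) (Q _ _) (Z w) => x1 x2 x3 x4 x5.
  by move: (ln x2) (ln x3) => y1 y2; exact: lerM_alg.
have := le_Rintegral measurableT iL iU (fun w _ => LU w).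
have -> : Rintegral mu6 setT L = 1 - Rintegral mu6 setT (fun w => m (hmul w.1 w.2) * (pk s w.1 * Q w.1 (hmul w.1 w.2))).
  by apply: etrans; [exact: (RintegralB measurableT i4 i5)|rewrite e4].
have -> : Rintegral mu6 setT U = Ent t - Rintegral mu3 setT (fun b => ln (m b) * pk (s + t) b) -
   (2 * Ex s (fun a => l1 a * Pt t g a) - Ex s E3).
  apply: etrans; first exact: (RintegralB measurableT i12 iZ).
  apply: (f_equal2 (fun x y : R => x - y)); last exact: (etrans eZ ExZ_val).
  apply: etrans; first exact: (RintegralB measurableT i1 i2).
  exact: (f_equal2 (fun x y : R => x - y) e1 e2).
exact: (ler_gap h2 h5).
Qed.

(** Twice [Ex_LP] gives 4 s N, of which 2 s N is lost to the mass bound [T5]; [Ent_diff] bounds what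
    remains by 2 s / t up to errors. *)
Lemma entropy_reg_bound : 2 * s * N <= 2 * s / t + (2064 * (c * M) + 16416 * c ^+ 3) * (s * sg) +
  (1 + 2 * s * N) * I * eta.
Proof.
have h1 := entropy_reg; have h2 := Ent_diff pk_ge0 s0 t0; have h3 := Ex_LP; have h4 := Ex_E3.
move: h1 h2 h3 h4; move: (Ent t) (Ent (s + t)) (Ex s E3) (Ex s _) (N) (I) (c) (sg) => x1 x2 x3 x4 n i d z.
lra.
Qed.

End regularised.

Lemma entropy_step : N <= t^-1 + (1032 * (c * M) + 8208 * c ^+ 3) * Num.sqrt s.
Proof.
set K := 1032 * _ + _.
have k1 : 2 * s * N <= 2 * s / t + 2 * K * (s * sg).
  apply/ler_addgt0Pr => e e0.
  (* [eta = e / D] makes the contribution of the floor at most [e]; the + 1 keeps [D] positive. *)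
  pose D := `|(1 + 2 * s * N) * Rintegral mu3 setT (@w3 R)| + 1.
  have D0 : 0 < D by rewrite ltr_wpDl.
  have := entropy_reg_bound (divr_gt0 e0 D0).
  set x := (1 + 2 * s * N) * _; have xD : x * (e / D) <= e.
    rewrite mulrA ler_pdivrMr// mulrC ler_wpM2l ?(ltW e0)// /D.
    by apply: le_trans (ler_norm x) _; rewrite lerDl.
  by move=> h; apply: (le_trans h); apply: lerD => //; rewrite lerD2l /K le_eqVlt; apply/orP; left; apply/eqP; ring.
have s20 : 0 < 2 * s by rewrite mulr_gt0.
rewrite -(ler_pM2l s20); apply: (le_trans k1).
by rewrite le_eqVlt; apply/orP; left; apply/eqP; rewrite /sg; ring.
Qed.

End entropic_gradient_bound.

Lemma gradient_le_inv_sqrt {R : realType} (pk_ge0 : forall (t : R) q, 0 < t -> 0 <= pk t q)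
  (t : R) (g : heis R -> R) (V0 A B M : R) : 0 < t -> measurable_fun setT g ->
  (forall q, `|g q| <= 1) ->
  (forall a, `|Pt t g a - V0 - a.1.1 * A - a.1.2 * B| <= M * hrem a) ->
  Num.sqrt (A ^+ 2 + B ^+ 2) <= (Num.sqrt t)^-1.
Proof.
move=> t0 mg g1 gexp.
have h s (s0 : 0 < s) := entropy_step pk_ge0 t0 mg g1 gexp s0.
rewrite -sqrtrV ?(ltW t0)//; apply: ler_wsqrtr; apply/ler_addgt0Pr => e e0.
set K := 1032 * _ + _ in h.
pose D := `|K| + 1; have D0 : 0 < D by rewrite ltr_wpDl.
(* [s] is taken with sqrt s = e / D, which brings the error term below [e]. *)
have s0 : 0 < (e / D) ^+ 2 by rewrite exprn_gt0// divr_gt0.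
apply: (le_trans (h _ s0)); rewrite lerD2l sqrtr_sqr ger0_norm; last by rewrite divr_ge0 ?ltW.
by rewrite mulrA ler_pdivrMr// mulrC ler_wpM2l ?(ltW e0)// /D (le_trans (ler_norm K))// lerDl.
Qed.

(** * Smooth compactly supported functions *)

Section smooth_functions.
Context {R : realType}.

Lemma is_derive_shift (G : heis R -> R) p v (u d : R) : is_derive (u *: v + p) v G d ->
  is_derive u (1 : R) (fun h : R => G (h *: v + p)) d.
Proof.
move=> [d1 d2].
have e : (fun h : R => h^-1 *: ((G \o shift (u *: v + p)) (h *: v) - G (u *: v + p))) =
   (fun h : R => h^-1 *: (((fun h : R => G (h *: v + p)) \o shift u) (h *: (1 : R)) - G (u *: v + p))).
  apply/funext => h; rewrite /= /shift; congr (_ *: (G _ - _)).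
  by rewrite addrA -scalerDl; congr ((_ + _) *: _ + _); exact: esym (mulr1 h).
apply: DeriveDef.
  by move: d1; rewrite /derivable e.
by move: d2; rewrite /derive e.
Qed.

Lemma axis_mvt (G g : heis R -> R) p (v : heis R) (h : R) : (forall q, is_derive q v G (g q)) ->
  exists2 th : R, `|th| <= `|h| & G (h *: v + p) - G p = h * g (th *: v + p).
Proof.
move=> dG; pose phi (u : R) := G (u *: v + p).
have dphi (u : R) : is_derive u (1 : R) phi (g (u *: v + p)) by apply: is_derive_shift; exact: dG.
have cphi (i : interval R) : {within [set` i], continuous phi}.
  by apply: derivable_within_continuous => u _; exact: (@ex_derive _ _ _ _ _ _ _ (dphi u)).
have phi0 : phi 0 = G p by rewrite /phi scale0r add0r.
rewrite -phi0 -/(phi h); have [h0|h0|<-] := ltgtP 0 h.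
- have [th] := MVT h0 (fun u _ => dphi u) (cphi _).
  rewrite in_itv /= => /andP[th0 thh] e; exists th; last by rewrite e subr0 mulrC.
  by rewrite !gtr0_norm// ltW.
- have [th] := MVT h0 (fun u _ => dphi u) (cphi _).
  rewrite in_itv /= => /andP[th0 thh] e; exists th; last by rewrite -opprB e sub0r mulrN opprK mulrC.
  by rewrite !ltr0_norm// lerN2 ltW.
- by exists 0; rewrite ?normr0 ?mul0r ?subrr.
Qed.

Let eq3 (p q : heis R) : p.1.1 = q.1.1 -> p.1.2 = q.1.2 -> p.2 = q.2 -> p = q.
Proof. by case: p => [[? ?] ?]; case: q => [[? ?] ?] /= -> -> ->. Qed.

Let heisE : (forall v p : heis R, (v + p).1.1 = v.1.1 + p.1.1) * (forall v p : heis R, (v + p).1.2 = v.1.2 + p.1.2) *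
  (forall v p : heis R, (v + p).2 = v.2 + p.2) * (forall (u : R) (v : heis R), (u *: v).1.1 = u * v.1.1) *
  (forall (u : R) (v : heis R), (u *: v).1.2 = u * v.1.2) * (forall (u : R) (v : heis R), (u *: v).2 = u * v.2).
Proof. by []. Qed.

Definition n1 (w : heis R) : R := `|w.1.1| + `|w.1.2| + `|w.2|.

Let step_xyz (w p : heis R) : w + p = w.2 *: axis 2 + (w.1.2 *: axis 1 + (w.1.1 *: axis 0 + p)).
Proof.
have [-> -> ->] := @axisE R; case: w => [[a b] c]; case: p => [[x y] z].
rewrite /= ; congr (_, _, _); rewrite /= /GRing.scale /=; ring.
Qed.

Lemma lipschitz_partials (G : heis R -> R) (G' : 'I_3 -> heis R -> R) (D : R) :
  (forall i q, is_derive q (axis i) G (G' i q)) -> (forall i q, `|G' i q| <= D) ->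
  forall w p, `|G (w + p) - G p| <= D * n1 w.
Proof.
move=> dG bG w p; rewrite step_xyz.
set p1 := w.1.1 *: axis 0 + p; set p2 := w.1.2 *: axis 1 + p1; set p3 := w.2 *: axis 2 + p2.
have st i (h : R) q : `|G (h *: axis i + q) - G q| <= D * `|h|.
  have [th _ ->] := axis_mvt q h (dG i).
  by rewrite normrM mulrC; apply: ler_wpM2r.
have h1 := st 0 w.1.1 p; have h2 := st 1 w.1.2 p1; have h3 := st 2 w.2 p2.
have := le_trans (ler_normD _ _) (lerD (le_trans (ler_normD _ _) (lerD h1 h2)) h3).
rewrite -/p1 -/p2 -/p3.
have -> : G p1 - G p + (G p2 - G p1) + (G p3 - G p2) = G p3 - G p by ring.
by rewrite /n1 !mulrDr.
Qed.

(** Move along one axis at a time: each mean value point is [v + p] with [n1 v <= n1 w], and there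
    the first derivative differs from its value at [p] by at most D n1 w. *)
Lemma taylor_partials (G : heis R -> R) (G1 : 'I_3 -> heis R -> R) (G2 : 'I_3 -> 'I_3 -> heis R -> R) (D : R) :
  (forall i q, is_derive q (axis i) G (G1 i q)) ->
  (forall i j q, is_derive q (axis j) (G1 i) (G2 i j q)) -> (forall i j q, `|G2 i j q| <= D) ->
  forall w p, `|G (w + p) - G p - w.1.1 * G1 0 p - w.1.2 * G1 1 p - w.2 * G1 2 p| <= D * n1 w ^+ 2.
Proof.
move=> dG dG1 bG w p.
have D0 : 0 <= D by exact: le_trans (bG 0 0 p).
have L i := lipschitz_partials (dG1 i) (bG i).
have [a0 a1 a2] := @axisE R.
have st i (h : R) (q : heis R) : (forall th : R, `|th| <= `|h| -> exists2 v, th *: axis i + q = v + p & n1 v <= n1 w) ->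
  `|G (h *: axis i + q) - G q - h * G1 i p| <= `|h| * (D * n1 w).
  move=> hv; have [th ht ->] := axis_mvt q h (dG i).
  have [v -> nv] := hv th ht.
  rewrite -mulrBr normrM; apply: ler_wpM2l => //.
  by apply: le_trans (L i v p) _; apply: ler_wpM2l.
rewrite step_xyz.
set p1 := w.1.1 *: axis 0 + p; set p2 := w.1.2 *: axis 1 + p1; set p3 := w.2 *: axis 2 + p2.
have h1 : `|G p1 - G p - w.1.1 * G1 0 p| <= `|w.1.1| * (D * n1 w).
  apply: st => // th ht; exists (th, 0, 0); last by rewrite /n1 /= !normr0 !addr0; have := normr_ge0 w.1.2; have := normr_ge0 w.2; lra.
  by rewrite a0; apply: eq3; rewrite !heisE /= !(mulr0, mulr1, add0r).
have h2 : `|G p2 - G p1 - w.1.2 * G1 1 p| <= `|w.1.2| * (D * n1 w).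
  apply: st => // th ht; exists (w.1.1, th, 0); last by rewrite /n1 /= !normr0 !addr0; have := normr_ge0 w.2; lra.
  by rewrite /p1 a0 a1; apply: eq3; rewrite !heisE /= !(mulr0, mulr1, add0r).
have h3 : `|G p3 - G p2 - w.2 * G1 2 p| <= `|w.2| * (D * n1 w).
  apply: st => // th ht; exists (w.1.1, w.1.2, th); last by rewrite /n1 /=; lra.
  by rewrite /p2 /p1 a0 a1 a2; apply: eq3; rewrite !heisE /= !(mulr0, mulr1, add0r).
have := le_trans (ler_normD _ _) (lerD (le_trans (ler_normD _ _) (lerD h1 h2)) h3).
have -> : G p1 - G p - w.1.1 * G1 0 p + (G p2 - G p1 - w.1.2 * G1 1 p) + (G p3 - G p2 - w.2 * G1 2 p) =
  G p3 - G p - w.1.1 * G1 0 p - w.1.2 * G1 1 p - w.2 * G1 2 p by ring.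
by move=> /le_trans; apply; rewrite le_eqVlt; apply/orP; left; apply/eqP; rewrite -!mulrDl -/(n1 w) expr2 mulrCA.
Qed.

Variable f : heis R -> R.
Hypothesis hf : smooth_compact_support f.
Let K := closure [set p | f p != 0].
Let cK : compact K. Proof. by have [] := hf. Qed.

(** The complement of the support is open, so [f], and inductively each partial derivative, vanishes
    in a whole neighbourhood. *)
Lemma partials_out s p : ~ K p -> partials s f p = 0.
Proof.
have oK : open (~` K) by rewrite openC; exact: closed_closure.
elim: s p => [|i s IH] p Kp /=.
  by apply/eqP/negPn/negP => fp; apply: Kp; exact: subset_closure.
rewrite /partial (@near_eq_derive _ _ _ _ (fun=> 0)) ?derive_cst//.
have : nbhs p (~` K) by exact: open_nbhs_nbhs.
by apply: filterS => q; exact: IH.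
Qed.

Let K_bound : exists2 r : R, 0 <= r & forall p, K p -> `|p| <= r.
Proof.
have [M [_ hM]] := compact_bounded cK.
exists (`|M| + 1); first exact: addr_ge0.
by move=> p Kp; apply: hM => //; have := ler_norm M; lra.
Qed.

Lemma partials_bounded s : exists2 D : R, 0 <= D & forall p, `|partials s f p| <= D.
Proof.
have [cs _] := hf.1 s.
have cw : {within K, continuous (partials s f)} by exact: continuous_subspaceT.
have [M [_ hM]] := compact_bounded (continuous_compact cw cK).
exists (`|M| + 1); first exact: addr_ge0.
move=> p; have [Kp|Kp] := pselect (K p); last by rewrite partials_out// normr0 addr_ge0.
by apply: hM; [have := ler_norm M; lra|exists p].
Qed.

Lemma smooth_compact_growth : smooth_polynomial_growth f.
Proof.
split; first exact: hf.1.
move=> s; have [D D0 hD] := partials_bounded s; exists D, 0%N => p.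
by rewrite expr0 mulr1.
Qed.

Let dpart s i q : is_derive q (axis i) (partials s f) (partials (i :: s) f q).
Proof. by apply: DeriveDef => //; exact: (hf.1 s).2. Qed.

Let U1 p := partials [:: 0] f p - p.1.2 / 2 * partials [:: 2] f p.
Let U2 p := partials [:: 1] f p + p.1.1 / 2 * partials [:: 2] f p.
Let U3 p := partials [:: 2] f p.

(* Increments of size at least 1 are handled by boundedness; for smaller ones both
   sides vanish when [y] is far from the support, and otherwise the mean value theorem
   applies along the three axes. *)
Lemma smooth_compact_taylor : exists U1 U2 U3 M, taylor f U1 U2 U3 M.
Proof.
have [B0 B00 b0] := partials_bounded [::].
have [D [D0 d1 d2]] : exists D, [/\ 0 <= D, forall i q, `|partials [:: i] f q| <= D &
    forall i j q, `|partials [:: j; i] f q| <= D].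
  have h1 i : {D : R | 0 <= D /\ forall q, `|partials [:: i] f q| <= D}.
    by apply: cid; have [D ? ?] := partials_bounded [:: i]; exists D.
  have h2 ij : {D : R | 0 <= D /\ forall q, `|partials [:: ij.2; ij.1] f q| <= D}.
    by apply: cid; have [D ? ?] := partials_bounded [:: ij.2; ij.1]; exists D.
  pose S1 := \sum_(i : 'I_3) sval (h1 i); pose S2 := \sum_(ij : 'I_3 * 'I_3) sval (h2 ij).
  have s1 i : sval (h1 i) <= S1.
    rewrite /S1 (bigD1 i)//= lerDl sumr_ge0// => j _; exact: (svalP (h1 j)).1.
  have s2 ij : sval (h2 ij) <= S2.
    rewrite /S2 (bigD1 ij)//= lerDl sumr_ge0// => j _; exact: (svalP (h2 j)).1.
  have S10 : 0 <= S1 by apply: sumr_ge0 => j _; exact: (svalP (h1 j)).1.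
  have S20 : 0 <= S2 by apply: sumr_ge0 => j _; exact: (svalP (h2 j)).1.
  exists (S1 + S2); split; first exact: addr_ge0.
  - by move=> i q; apply: le_trans ((svalP (h1 i)).2 q) _; apply: le_trans (s1 i) _; rewrite lerDl.
  - by move=> i j q; apply: le_trans ((svalP (h2 (i, j))).2 q) _; apply: le_trans (s2 (i, j)) _; rewrite lerDr.
have [r r0 hr] := K_bound.
(* [M1] bounds [f] and the three fields, whose coefficients matter on the support only, of radius
   [r]. The 5 counts the terms of the expansion for a large increment. [M2] serves small ones: 3
   from the square of a sum of three terms, 2 + (r + 1)^2 from the vertical entry of [w]. *)
pose M1 := B0 + D * (1 + r); pose M2 := 3 * D * (2 + (r + 1) ^+ 2); pose M := 5 * M1 + M2.
have M10 : 0 <= M1 by rewrite addr_ge0// mulr_ge0// addr_ge0.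
have M20 : 0 <= M2 by rewrite mulr_ge0 ?mulr_ge0// addr_ge0// sqr_ge0.
have M1M : M1 <= M by rewrite /M; lra.
have bB y : `|f y| <= M1 by apply: le_trans (b0 y) _; rewrite /M1 lerDl mulr_ge0// addr_ge0.
have b3 y : `|U3 y| <= M1.
  by apply: le_trans (d1 2 y) _; rewrite /M1; have := mulr_ge0 D0 r0; lra.
have coef (u : R) (y : heis R) : `|u| <= `|y| -> `|u / 2 * partials [:: 2] f y| <= D * r.
  move=> uy; have [Ky|Ky] := pselect (K y); last by rewrite partials_out// mulr0 normr0 mulr_ge0.
  rewrite normrM mulrC; apply: ler_pM => //.
  by rewrite normrM (ger0_norm (_ : 0 <= 2^-1)) ?invr_ge0//; have := le_trans uy (hr y Ky); have := normr_ge0 u; lra.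
have b1 y : `|U1 y| <= M1.
  have [_ ny _] := norm_xyz y.
  have := le_trans (ler_normB _ _) (lerD (d1 0 y) (coef _ _ ny)); rewrite -/(U1 y) /M1; lra.
have b2 y : `|U2 y| <= M1.
  have [nx _ _] := norm_xyz y.
  have := le_trans (ler_normD _ _) (lerD (d1 1 y) (coef _ _ nx)); rewrite -/(U2 y) /M1; lra.
have ms s : measurable_fun setT (partials s f) by apply: continuous_measurable3; exact: (hf.1 s).1.
have m0 := ms [:: 0]; have m1 := ms [:: 1]; have m2 := ms [:: 2].
have mx : measurable_fun setT (fun q : heis R => q.1.1 / 2) by mfun.
have my : measurable_fun setT (fun q : heis R => q.1.2 / 2) by mfun.
exists U1, U2, U3, M; split.
- exact: (ms [::]).
- by rewrite /U1; apply: (measurable_funB m0); exact: measurable_funM.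
- by rewrite /U2; apply: (measurable_funD m1); exact: measurable_funM.
- exact: m2.
- by move=> y; exact: le_trans (bB y) M1M.
- by move=> y; exact: le_trans (b1 y) M1M.
- by move=> y; exact: le_trans (b2 y) M1M.
- by move=> y; exact: le_trans (b3 y) M1M.
move=> y h; set a := h.1.1; set b := h.1.2; set c := h.2.
set H := a ^+ 2 + b ^+ 2 + c ^+ 2.
have H0 : 0 <= H by rewrite /H !addr_ge0 ?sqr_ge0.
have [H1|H1] := lerP 1 H.
  have aH (u : R) : u ^+ 2 <= H -> `|u| <= H.
    rewrite -(real_normK (num_real u)) => uH; have := sqr_ge0 (`|u| - 1); nra.
  have sa := sqr_ge0 a; have sb := sqr_ge0 b; have sc := sqr_ge0 c.
  have aa : `|a * U1 y| <= H * M1 by rewrite normrM; apply: ler_pM => //; apply: aH; rewrite /H; lra.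
  have bb : `|b * U2 y| <= H * M1 by rewrite normrM; apply: ler_pM => //; apply: aH; rewrite /H; lra.
  have cc : `|c * U3 y| <= H * M1 by rewrite normrM; apply: ler_pM => //; apply: aH; rewrite /H; lra.
  have := le_trans (ler_normB _ _) (lerD (le_trans (ler_normB _ _) (lerD (le_trans (ler_normB _ _) (lerD
    (le_trans (ler_normB _ _) (lerD (bB (hmul y h)) (bB y))) aa)) bb)) cc).
  move=> /le_trans; apply; rewrite /M; have := mulr_ge0 M20 H0; have := mulr_ge0 M10 (_ : 0 <= H - 1).
  by rewrite subr_ge0 => /(_ H1); lra.
(* [hmul y h] is [y] moved by the Euclidean vector [w]. Its vertical entry contains an area term,
   controlled once the horizontal coordinates of [y] are at most r + 1. *)
pose w : heis R := (a, b, c + 2^-1 * (y.1.1 * b - y.1.2 * a)).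
have yh : hmul y h = w + y.
  by rewrite hmulE; apply: eq3; rewrite /= -/a -/b -/c; ring.
have a1 : `|a| < 1 /\ `|b| < 1.
  have lt1 (u : R) : u ^+ 2 < 1 -> `|u| < 1.
    by move=> u1; rewrite -(@ltr_pXn2r _ 2) ?nnegrE// expr1n real_normK ?num_real.
  by have sa := sqr_ge0 a; have sb := sqr_ge0 b; have sc := sqr_ge0 c; split; apply: lt1; move: H1; rewrite /H; lra.
have [ia|oa] := boolP ((`|y.1.1| <= r + 1) && (`|y.1.2| <= r + 1)); last first.
  have hout : ~ K y /\ ~ K (hmul y h).
    move: oa; rewrite negb_and -!ltNge => /orP[oa|oa]; split=> /hr hy.
    - by have [n _ _] := norm_xyz y; move: (le_trans n hy); lra.
    - have [n _ _] := norm_xyz (hmul y h); move: (le_trans n hy); rewrite yh /=.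
      by have := ler_normB (a + y.1.1) a; rewrite addrAC subrr add0r; lra.
    - by have [_ n _] := norm_xyz y; move: (le_trans n hy); lra.
    - have [_ n _] := norm_xyz (hmul y h); move: (le_trans n hy); rewrite yh /=.
      by have := ler_normB (b + y.1.2) b; rewrite addrAC subrr add0r; lra.
  case: hout => o1 o2.
  have z s : partials s f y = 0 by exact: partials_out.
  have fy : f y = 0 by exact: (z [::]).
  have fyh : f (hmul y h) = 0 by exact: (@partials_out [::]).
  rewrite fy fyh /U1 /U2 /U3 !z !mulr0 !subr0 addr0 !mulr0 !subr0 normr0.
  by rewrite mulr_ge0// addr_ge0// mulr_ge0.
have key : `|f (hmul y h) - f y - a * partials [:: 0] f y - b * partials [:: 1] f y -
    (c + 2^-1 * (y.1.1 * b - y.1.2 * a)) * partials [:: 2] f y| <= D * n1 w ^+ 2.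
  by have := taylor_partials (dpart [::]) (fun i => dpart [:: i]) d2 w y; rewrite -yh; exact.
rewrite /U1 /U2 /U3; move: key.
move: (f (hmul y h)) (f y) (partials [:: 0] f y) (partials [:: 1] f y) (partials [:: 2] f y) => g1 g2 F0 F1 F2.
have -> : g1 - g2 - a * (F0 - y.1.2 / 2 * F2) - b * (F1 + y.1.1 / 2 * F2) - c * F2 =
  g1 - g2 - a * F0 - b * F1 - (c + 2^-1 * (y.1.1 * b - y.1.2 * a)) * F2 by field.
move=> /le_trans; apply; apply: (@le_trans _ _ (M2 * H)); last first.
  by rewrite ler_wpM2r// /M; lra.
rewrite /M2 [3 * D]mulrC -!mulrA ler_wpM2l// /n1 /w /=.
case/andP: ia => i1 i2.
set v := 2^-1 * (y.1.1 * b - y.1.2 * a).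
have v2 : v ^+ 2 <= (r + 1) ^+ 2 * (a ^+ 2 + b ^+ 2) / 2.
  have x2 : y.1.1 ^+ 2 <= (r + 1) ^+ 2 by rewrite -(real_normK (num_real y.1.1)) lerXn2r ?nnegrE// addr_ge0.
  have y2 : y.1.2 ^+ 2 <= (r + 1) ^+ 2 by rewrite -(real_normK (num_real y.1.2)) lerXn2r ?nnegrE// addr_ge0.
  have := ler_wpM2r (sqr_ge0 b) x2; have := ler_wpM2r (sqr_ge0 a) y2.
  by rewrite /v; have := sqr_ge0 (y.1.1 * b + y.1.2 * a); nra.
have : (`|a| + `|b| + `|c + v|) ^+ 2 <= 3 * (a ^+ 2 + b ^+ 2 + (c + v) ^+ 2).
  rewrite -(real_normK (num_real a)) -(real_normK (num_real b)) -(real_normK (num_real (c + v))).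
  by have := sqr_ge0 (`|a| - `|b|); have := sqr_ge0 (`|b| - `|c + v|); have := sqr_ge0 (`|a| - `|c + v|); nra.
move=> /le_trans; apply; rewrite ler_wpM2l//.
have := sqr_ge0 (c - v); have := sqr_ge0 c; have := sqr_ge0 a; have := sqr_ge0 b.
have := mulr_ge0 (sqr_ge0 (r + 1)) (sqr_ge0 c).
rewrite /H; move: v2; move: ((r + 1) ^+ 2) => rr; nra.
Qed.

End smooth_functions.

(** * A regularised sign function *)

Section sign_approximation.
Context {R : realType}.

(** A bounded function with Lipschitz derivative, so that composition with it stays in [taylor]; the
    price is the loss of 1 in [softsign_abs]. *)
Definition softsign (x : R) : R := x / (`|x| + 1).
Definition softsign' (x : R) : R := (`|x| + 1) ^- 2.

Let p1 (x : R) : 0 < `|x| + 1. Proof. by rewrite ltr_wpDl. Qed.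

Lemma softsign_le1 x : `|softsign x| <= 1.
Proof.
rewrite /softsign normrM normfV (gtr0_norm (p1 x)) ler_pdivrMr// mul1r; by rewrite lerDl.
Qed.

Lemma softsign'_le1 x : 0 <= softsign' x <= 1.
Proof.
rewrite /softsign' invr_ge0 sqr_ge0 /= invf_le1 ?exprn_gt0//.
by have := normr_ge0 x; move: (`|x|) => u u0; nra.
Qed.

Lemma softsignN x : softsign (- x) = - softsign x.
Proof. by rewrite /softsign normrN mulNr. Qed.

Lemma softsign'N x : softsign' (- x) = softsign' x.
Proof. by rewrite /softsign' normrN. Qed.

(** The second derivative is at most 2 in size but jumps at 0, so the remainder is computed by hand:
    x >= 0 by oddness, then x + d on either side of 0. *)
Lemma softsign_taylor x d : `|softsign (x + d) - softsign x - d * softsign' x| <= d ^+ 2.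
Proof.
have pos (y z : R) : 0 <= y -> `|softsign (y + z) - softsign y - z * softsign' y| <= z ^+ 2.
  move: y z => {}x {}d x0; rewrite /softsign /softsign' (ger0_norm x0).
  have x1 : 0 < x + 1 by rewrite ltr_wpDl.
  have [v0|v0] := lerP 0 (x + d).
    rewrite (ger0_norm v0); have v1 : 0 < x + d + 1 by rewrite ltr_wpDl.
    have -> : (x + d) / (x + d + 1) - x / (x + 1) - d * (x + 1) ^- 2 = - (d ^+ 2 / ((x + d + 1) * (x + 1) ^+ 2)).
      by field; rewrite !lt0r_neq0.
    have q1 : 1 <= (x + d + 1) * (x + 1) ^+ 2.
      by rewrite -[leLHS]mulr1; apply: ler_pM => //; [lra|rewrite -[leLHS](expr1n R 2) lerXn2r ?nnegrE//; lra].
    have q0 := lt_le_trans ltr01 q1.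
    rewrite normrN normrM normfV (gtr0_norm q0) ger0_norm ?sqr_ge0// ler_pdivrMr//.
    by rewrite ler_peMr ?sqr_ge0.
  rewrite (ltr0_norm v0); set w := - (x + d); have dE : d = - (x + w) by rewrite /w; ring.
  have w0 : 0 < w by rewrite oppr_gt0.
  clearbody w; rewrite dE.
  rewrite sqrrN; have w1 : 0 < w + 1 by lra.
  have -> : (x + - (x + w)) = - w by ring.
  set i := (x + 1) ^- 2.
  have i1 : i <= 1 by have := softsign'_le1 x; rewrite /softsign' (ger0_norm x0) => /andP[].
  have i2 : 1 - 2 * x <= i.
    rewrite /i -[leRHS]mul1r ler_pdivlMr ?exprn_gt0//.
    by have := mulr_ge0 x0 x0; have := mulr_ge0 (mulr_ge0 x0 x0) x0; nra.
  have i3 : x / (x + 1) - x * i = x ^+ 2 * i by rewrite /i; field; rewrite lt0r_neq0.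
  have j0 : 0 <= w - w / (w + 1) <= w ^+ 2.
    have -> : w - w / (w + 1) = w ^+ 2 / (w + 1) by field; exact: lt0r_neq0.
    rewrite divr_ge0 ?sqr_ge0 ?(ltW w1)//= ler_pdivrMr// ler_peMr ?sqr_ge0//; lra.
  have i0 : 0 <= i by rewrite /i invr_ge0 sqr_ge0.
  have i4 := mulr_ge0 (sqr_ge0 x) i0.
  have i5 : x ^+ 2 * i <= x ^+ 2 by rewrite ler_piMr ?sqr_ge0.
  have i6 := ler_wpM2l (ltW w0) i1; have i7 := ler_wpM2l (ltW w0) i2.
  have i8 := mulr_ge0 x0 (ltW w0).
  have i9 : x * i <= x * 1 by rewrite ler_wpM2l.
  case/andP: j0 => j0 j1.
  have -> : - w / (w + 1) - x / (x + 1) - - (x + w) * i = (w * i - w / (w + 1)) - x ^+ 2 * i.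
    by rewrite -i3; ring.
  rewrite ler_norml; apply/andP; split; nra.
have [x0|x0] := lerP 0 x; first exact: pos.
have := pos (- x) (- d) ltac:(by rewrite oppr_ge0 ltW); rewrite -opprD !softsignN sqrrN.
rewrite softsign'N.
have -> : - softsign (x + d) - - softsign x - - d * softsign' x =
  - (softsign (x + d) - softsign x - d * softsign' x) by ring.
by rewrite normrN.
Qed.

Lemma softsign_abs (x : R) : `|x| - 1 <= x * softsign x.
Proof.
rewrite /softsign mulrA -expr2 -(real_normK (num_real x)) ler_pdivlMr//.
by move: (`|x|) => u; nra.
Qed.

Let c_inv : continuous (fun x : R => (`|x| + 1)^-1).
Proof.
move=> x; apply: cvgV; first exact: lt0r_neq0.
by apply: cvgD; [exact: norm_continuous|exact: cvg_cst].
Qed.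

Let m_inv : measurable_fun setT (fun x : R => (`|x| + 1)^-1).
Proof. exact: continuous_measurable_fun. Qed.

Lemma measurable_softsign : measurable_fun setT softsign.
Proof. by rewrite /softsign; apply: measurable_funM => //; mfun. Qed.

Lemma measurable_softsign' : measurable_fun setT softsign'.
Proof.
have -> : softsign' = (fun x : R => (`|x| + 1)^-1 ^+ 2) by apply/funext => x; rewrite /softsign' exprVn.
by mfun.
Qed.

Lemma taylor_softsign (f U1 U2 U3 : heis R -> R) (M c e : R) : 0 < e -> taylor f U1 U2 U3 M ->
  exists V1 V2 V3 M', taylor (fun q => softsign ((f q - c) / e)) V1 V2 V3 M'.
Proof.
move=> e0 T; have M0 := taylor_M_ge0 T.
have [mf m1 m2 m3 bf b1 b2 b3 ex] := T.
have ie : 0 < e^-1 by rewrite invr_gt0.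
pose k q := softsign' ((f q - c) / e) / e.
have mfc : measurable_fun setT (fun q => (f q - c) / e) by mfun.
have mk : measurable_fun setT k.
  by apply: measurable_funM => //; exact: (measurableT_comp measurable_softsign' mfc).
have kb q : `|k q| <= e^-1.
  have /andP[h0 h1] := softsign'_le1 ((f q - c) / e).
  by rewrite /k ger0_norm ?mulr_ge0 ?(ltW ie)// ler_piMl ?(ltW ie).
(* The 1 bounds [softsign], M / e the chain-rule derivatives and the transported remainder of [f],
   and 8 M^2 / e^2 controls d^2. *)
pose M' := 1 + M / e + 8 * M ^+ 2 / e ^+ 2.
have q1 : 0 <= M / e by rewrite divr_ge0// ltW.
have q2 : 0 <= 8 * M ^+ 2 / e ^+ 2 by rewrite divr_ge0 ?sqr_ge0// mulr_ge0// sqr_ge0.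
have kU U y : (forall q, `|U q| <= M) -> `|k y * U y| <= M'.
  move=> bU; rewrite normrM; apply: (@le_trans _ _ (e^-1 * M)); first exact: ler_pM.
  by rewrite /M'; lra.
exists (fun q => k q * U1 q), (fun q => k q * U2 q), (fun q => k q * U3 q), M'; split.
- exact: (measurableT_comp measurable_softsign mfc).
- exact: measurable_funM.
- exact: measurable_funM.
- exact: measurable_funM.
- by move=> y; apply: le_trans (softsign_le1 _) _; rewrite /M'; lra.
- by move=> y; exact: kU.
- by move=> y; exact: kU.
- by move=> y; exact: kU.
move=> y h; have E := ex y h.
move: (bf (hmul y h)) (bf y) E (kb y) (b1 y) (b2 y) (b3 y).
set H := h.1.1 ^+ 2 + h.1.2 ^+ 2 + h.2 ^+ 2.
have H0 : 0 <= H by rewrite /H !addr_ge0 ?sqr_ge0.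
rewrite /k; set F := f (hmul y h); set F0 := f y; set a := h.1.1; set b := h.1.2; set z := h.2.
set u1 := U1 y; set u2 := U2 y; set u3 := U3 y.
move=> bF bF0 E kq v1 v2 v3.
pose d := (F - F0) / e.
have := softsign_taylor ((F0 - c) / e) d.
have -> : (F0 - c) / e + d = (F - c) / e by rewrite /d; field; exact: lt0r_neq0.
move=> S.
have d2 : d ^+ 2 <= 8 * M ^+ 2 / e ^+ 2 * H.
  have -> : d ^+ 2 = (F - F0) ^+ 2 / e ^+ 2 by rewrite /d; field; exact: lt0r_neq0.
  have -> : 8 * M ^+ 2 / e ^+ 2 * H = 8 * M ^+ 2 * H / e ^+ 2 by ring.
  rewrite ler_wpM2r ?invr_ge0 ?sqr_ge0//.
  have sqM (u m : R) : `|u| <= m -> u ^+ 2 <= m ^+ 2.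
    by move=> um; rewrite -(real_normK (num_real u)) lerXn2r ?nnegrE// (le_trans _ um).
  (* For H >= 1, (F - F0)^2 <= (2 M)^2 <= 8 M^2 H. Otherwise (F - F0)^2 <= 2 (M^2 H + 3 M^2 H), from
     the remainder and the linear part [L]. *)
  have [H1|H1] := lerP 1 H.
    apply: (@le_trans _ _ ((2 * M) ^+ 2)).
      by apply: sqM; apply: le_trans (ler_normB _ _) _; lra.
    by have := mulr_ge0 (sqr_ge0 M) (_ : 0 <= H - 1); rewrite subr_ge0 => /(_ H1); nra.
  set L := a * u1 + b * u2 + z * u3.
  have E' : `|F - F0 - L| <= M * H by rewrite (_ : F - F0 - L = F - F0 - a * u1 - b * u2 - z * u3)// /L; ring.
  have L2 : L ^+ 2 <= 3 * M ^+ 2 * H.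
    have w1 := sqM _ _ v1; have w2 := sqM _ _ v2; have w3 := sqM _ _ v3.
    have k1 := ler_wpM2l (sqr_ge0 a) w1; have k2 := ler_wpM2l (sqr_ge0 b) w2; have k3 := ler_wpM2l (sqr_ge0 z) w3.
    have := sqr_ge0 (a * u1 - b * u2); have := sqr_ge0 (b * u2 - z * u3); have := sqr_ge0 (a * u1 - z * u3).
    by rewrite /L /H -/a -/b -/z; nra.
  have e2 := sqM _ _ E'.
  have HH : (M * H) ^+ 2 <= M ^+ 2 * H.
    by rewrite exprMn ler_wpM2l ?sqr_ge0// expr2; apply: ler_piMl => //; exact: ltW.
  have -> : F - F0 = (F - F0 - L) + L by ring.
  have := sqr_ge0 ((F - F0 - L) - L); move: (F - F0 - L) e2 => g e2; nra.
set kk := softsign' _ / e in kq *.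
have -> : softsign ((F - c) / e) - softsign ((F0 - c) / e) - a * (kk * u1) - b * (kk * u2) - z * (kk * u3) =
   (softsign ((F - c) / e) - softsign ((F0 - c) / e) - d * softsign' ((F0 - c) / e)) +
   kk * (F - F0 - a * u1 - b * u2 - z * u3).
  by rewrite /kk /d; ring.
have kE : `|kk * (F - F0 - a * u1 - b * u2 - z * u3)| <= e^-1 * (M * H) by rewrite normrM; exact: ler_pM.
have := le_trans (ler_normD _ _) (lerD (le_trans S d2) kE).
by move=> /le_trans; apply; rewrite /M'; lra.
Qed.

End sign_approximation.

(** * Telescoping along the semigroup *)

Section iterates.
Context {R : realType}.
Hypothesis pk_ge0 : forall (t : R) q, 0 < t -> 0 <= pk t q.
Implicit Types F G : heis R -> R.

Definition bm F := measurable_fun setT F /\ exists C : R, forall q, `|F q| <= C.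

Lemma bmD F G : bm F -> bm G -> bm (fun q => F q + G q).
Proof.
move=> [mF [C hC]] [mG [D hD]]; split; first exact: measurable_funD.
by exists (C + D) => q; apply: le_trans (ler_normD _ _) _; exact: lerD.
Qed.

Lemma bmM F G : bm F -> bm G -> bm (fun q => F q * G q).
Proof.
move=> [mF [C hC]] [mG [D hD]]; split; first exact: measurable_funM.
by exists (C * D) => q; rewrite normrM; exact: ler_pM.
Qed.

Lemma bm_cst (c : R) : bm (fun=> c).
Proof. by split; [exact: measurable_cst|exists `|c|]. Qed.

Lemma bmZ F k : bm F -> bm (fun q => k * F q).
Proof. by move=> bF; exact: bmM (bm_cst k) bF. Qed.

Lemma bm_trans F y : bm F -> adm (fun q => F (hmul y q)).
Proof. by move=> [mF [C hC]]; exact: adm_trans mF hC. Qed.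

Lemma bm_Pt t F : 0 < t -> bm F -> bm (Pt t F).
Proof.
move=> t0 [mF [C hC]]; split; first exact: measurable_Pt hC.
by exists C => q; exact: Pt_bnd.
Qed.

Variable de : R.
Hypothesis de0 : 0 < de.

(** Time 0 is set apart: by the conventions on division [pk 0] is the zero function, so [Pt 0] is
    not the identity. *)
Definition Pk (k : nat) F := if k is 0 then F else Pt (k%:R * de) F.

Let kde k : 0 < k.+1%:R * de. Proof. by rewrite mulr_gt0. Qed.

Lemma bm_Pk k F : bm F -> bm (Pk k F).
Proof. by case: k => [//|k] bF /=; exact: bm_Pt. Qed.

Lemma Pk_le k F G y : bm F -> bm G -> (forall q, F q <= G q) -> Pk k F y <= Pk k G y.
Proof.
case: k => [|k] bF bG FG /=; first exact: FG.
by apply: (Ex_le pk_ge0 (kde k) (bm_trans y bF) (bm_trans y bG)) => q; exact: FG.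
Qed.

Lemma PkD k F G y : bm F -> bm G -> Pk k (fun q => F q + G q) y = Pk k F y + Pk k G y.
Proof.
case: k => [//|k] bF bG /=; exact: (ExD pk_ge0 (kde k) (bm_trans y bF) (bm_trans y bG)).
Qed.

Lemma PkZ k F c y : bm F -> Pk k (fun q => c * F q) y = c * Pk k F y.
Proof. by case: k => [//|k] bF /=; exact: (ExZ pk_ge0 (kde k) c (bm_trans y bF)). Qed.

Lemma Pk_cst k c y : Pk k (fun=> c) y = c.
Proof. by case: k => [//|k] /=; exact: (Ex_cst pk_ge0 (kde k)). Qed.

Lemma Pk_add j k F : bm F -> Pk j (Pk k F) = Pk (j + k) F.
Proof.
case: j => [//|j]; case: k => [|k] bF; first by rewrite addn0.
apply/funext => y; have [mF [C hC]] := bF; rewrite /=.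
rewrite (Pt_add pk_ge0 y (kde j) (kde k) mF hC) addSn addnS; congr (Pt _ F y).
by rewrite -mulrDl -natrD; congr (_%:R * _); rewrite addSn addnS.
Qed.

Lemma Pk1 F : Pk 1 F = Pt de F. Proof. by rewrite /= mul1r. Qed.

Lemma PkS k F : bm F -> Pk k.+1 F = Pt de (Pk k F).
Proof. by move=> bF; rewrite -Pk1 Pk_add. Qed.

Lemma PkSr k F : bm F -> Pk k.+1 F = Pk k (Pt de F).
Proof. by move=> bF; rewrite -Pk1 Pk_add// addn1. Qed.

End iterates.

Section covariance_bound.
Context {R : realType}.
Variable C1 : R.
Hypothesis hC1 : gradient_bound C1.
Let pk_pos (t : R) q : 0 < t -> 0 <= pk t q. Proof. exact: pk_ge0 hC1 t q. Qed.
Let C1_ge0 : 0 <= C1. Proof. exact: le_trans ler01 (optimal_ge1 hC1). Qed.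

Lemma taylor_bm (F U1 U2 U3 : heis R -> R) M : taylor F U1 U2 U3 M -> bm F.
Proof. by move=> T; split; [exact: ty_m T|exists M; exact: ty_b T]. Qed.

Lemma taylor_weaken (F U1 U2 U3 : heis R -> R) M M' : M <= M' -> taylor F U1 U2 U3 M -> taylor F U1 U2 U3 M'.
Proof.
move=> MM [mF m1 m2 m3 bF b1 b2 b3 ex]; split=> //; try by move=> y; apply: le_trans MM.
by move=> y h; apply: le_trans (ex y h) _; rewrite ler_wpM2r// !addr_ge0 ?sqr_ge0.
Qed.

Lemma Pt_heat (t : R) (F : heis R -> R) y : 0 < t -> measurable_fun setT F -> Pt t F y = heat t F y.
Proof. by move=> t0 mF; rewrite (heatE y t0 mF). Qed.

Variables (f g U1 U2 U3 V1 V2 V3 : heis R -> R) (M : R).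
Hypotheses (Tf : taylor f U1 U2 U3 M) (Tg : taylor g V1 V2 V3 M).
Hypothesis sf : smooth_polynomial_growth f.
Hypothesis g1 : forall q, `|g q| <= 1.
Variables (t : R) (x : heis R).
Hypothesis t0 : 0 < t.

Let M0 : 0 <= M. Proof. exact: taylor_M_ge0 Tf. Qed.
Let bf : bm f. Proof. exact: taylor_bm Tf. Qed.
Let bg : bm g. Proof. exact: taylor_bm Tg. Qed.

Lemma bm_hgrad : bm (hgrad f).
Proof.
have -> : hgrad f = (fun q => Num.sqrt (U1 q ^+ 2 + U2 q ^+ 2)) by apply/funext => q; exact: taylor_hgrad Tf.
have m1 := ty_m1 Tf; have m2 := ty_m2 Tf.
split; first by apply: measurable_sqrt; mfun.
exists (2 * M) => q; rewrite ger0_norm ?sqrtr_ge0//.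
rewrite -[leRHS]ger0_norm ?mulr_ge0// -sqrtr_sqr; apply: ler_wsqrtr.
have h (u : R) : `|u| <= M -> u ^+ 2 <= M ^+ 2.
  by move=> um; rewrite -(real_normK (num_real u)) lerXn2r ?nnegrE.
by have := h _ (ty_b1 Tf q); have := h _ (ty_b2 Tf q); have := sqr_ge0 M; nra.
Qed.

Let H : R := Pt t (hgrad f) x.
Let H0 : 0 <= H.
Proof.
apply: (Ex_ge0 pk_pos t0 (bm_trans x bm_hgrad)) => q.
by rewrite /hgrad; case: (hmul x q) => [[? ?] ?]; exact: sqrtr_ge0.
Qed.

Let normM_le (a b c d : R) : `|a| <= c -> `|b| <= d -> `|a * b| <= c * d.
Proof. by move=> ac bd; rewrite normrM; exact: ler_pM. Qed.

Let natr_alg (m : nat) (e : R) : 1 <= m%:R :> R -> 0 <= e -> m.+1%:R * e + e <= 3 * (m%:R * e).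
Proof. by move=> m1 e0; rewrite -natr1; have := ler_wpM2r e0 m1; lra. Qed.

Let steps_alg (z1 z2 z3 z4 m h a1 a2 a3 a4 a5 a6 : R) :
  - (16 * m ^+ 2 * z4 + z2) <= a1 - a4 -> a2 * (a3 - a6) <= m * (6 * m * z4) ->
  (a2 - a5) * a6 <= 6 * m * z4 * m ->
  a1 - a2 * a3 <= 4 * z4 * m ^+ 2 + h + z1 * z2 ->
  z1 * z2 + z2 <= m ^+ 2 * (6300 * t) * (z3 + z4) -> 0 <= m ^+ 2 * z3 ->
  a4 - a5 * a6 <= h + m ^+ 2 * (6300 * t + 32) * (z3 + z4).
Proof. by move=> *; lra. Qed.

Section steps.
Variables (n : nat) (de M' E : R).
Hypotheses (n0 : (0 < n)%N) (de0 : 0 < de) (nde : n%:R * de = t).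
Hypothesis M'E : M' = M * (3 + 6 * t).
Hypothesis EE : E = 2100 * M' ^+ 2 * (de * Num.sqrt de + de ^+ 2).
Let MM' : M <= M'. Proof. by rewrite M'E; have := mulr_ge0 M0 (ltW t0); have := M0; lra. Qed.
Let M'0 : 0 <= M'. Proof. exact: le_trans MM'. Qed.
Let E0 : 0 <= E.
Proof.
rewrite EE; apply: mulr_ge0; first by apply: mulr_ge0; [exact: ler0n|exact: sqr_ge0].
by apply: addr_ge0; [apply: mulr_ge0; [exact: ltW|exact: sqrtr_ge0]|exact: sqr_ge0].
Qed.
Local Notation P := (Pk de).

Let Pn F : P n F = Pt t F.
Proof. by case: (n) n0 nde => [//|m] _ /= ->. Qed.

Let taylor_P k F W1 W2 W3 : (k <= n)%N -> taylor F W1 W2 W3 M ->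
  exists Z1 Z2 Z3, taylor (P k F) Z1 Z2 Z3 M'.
Proof.
case: k => [|k] kn T; first by exists W1, W2, W3; exact: taylor_weaken T.
have k0 : 0 < k.+1%:R * de by rewrite mulr_gt0.
do 3 eexists; apply: (taylor_weaken _ (taylor_Pt pk_pos k0 T)).
rewrite M'E; apply: ler_wpM2l; first exact: M0.
rewrite lerD2l; apply: ler_wpM2l => //; rewrite -nde; apply: ler_wpM2r; first exact: ltW.
by rewrite ler_nat.
Qed.

Let u k := P k f.
Let v k := P k g.
Let uv k q := u k q * v k q.
Let uS k : Pt de (u k) = u k.+1. Proof. by rewrite /u (PkS pk_pos de0 _ bf). Qed.
Let vS k : Pt de (v k) = v k.+1. Proof. by rewrite /v (PkS pk_pos de0 _ bg). Qed.
Let buv k : bm (uv k). Proof. by apply: bmM; exact: bm_Pk. Qed.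

(** At time 0 the bound 1/sqrt s is void; the crude bound 2 M'^2 on the product of the gradients
    costs a single term of order [de]. *)
Let local_cov0 q : Pt de (uv 0) q <= uv 1 q + (4 * de * M' ^+ 2 + E).
Proof.
have := heat_covariance_le pk_pos de0 q (taylor_weaken MM' Tf) (taylor_weaken MM' Tg).
rewrite -EE lerBlDl /uv /u /v !Pk1 => h; apply: (le_trans h).
rewrite lerD2l lerD2r.
have hs (a b : R) : `|a| <= M -> `|b| <= M -> Num.sqrt (a ^+ 2 + b ^+ 2) ^+ 2 <= 2 * M' ^+ 2.
  move=> ha hb; rewrite sqr_sqrtr ?addr_ge0 ?sqr_ge0//.
  have h2 (z : R) : `|z| <= M -> z ^+ 2 <= M' ^+ 2.
    by move=> um; rewrite -(real_normK (num_real z)) lerXn2r ?nnegrE// (le_trans um).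
  by have := h2 _ ha; have := h2 _ hb; lra.
have s1 := hs _ _ (ty_b1 Tf q) (ty_b2 Tf q); have s2 := hs _ _ (ty_b1 Tg q) (ty_b2 Tg q).
set a := Num.sqrt _ in s1 *; set b := Num.sqrt _ in s2 *.
have ab : a * b <= 2 * M' ^+ 2 by have := sqr_ge0 (a - b); nra.
have d2 : 0 <= 2 * de by rewrite mulr_ge0// ltW.
have := ler_wpM2l d2 ab; lra.
Qed.

(** The gradient of P_s f is bounded by [hC1], that of P_s g by [gradient_le_inv_sqrt], both at s =
    k de. *)
Let local_cov k q : (0 < k <= n)%N ->
  Pt de (uv k) q <= uv k.+1 q + (2 * de * C1 / Num.sqrt (k%:R * de) * P k (hgrad f) q + E).
Proof.
case: k => [//|k] /= kn; have k0 : 0 < k.+1%:R * de by rewrite mulr_gt0.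
have [Z1 [Z2 [Z3 Tu]]] := taylor_P kn Tf; have [Y1 [Y2 [Y3 Tv]]] := taylor_P kn Tg.
have h : Pt de (uv k.+1) q - uv k.+2 q <= 2 * de * (Num.sqrt (Z1 q ^+ 2 + Z2 q ^+ 2) *
    Num.sqrt (Y1 q ^+ 2 + Y2 q ^+ 2)) + E.
  rewrite EE /uv -(uS k.+1) -(vS k.+1); exact: (heat_covariance_le pk_pos de0 q Tu Tv).
rewrite lerBlDl in h; apply: (le_trans h); rewrite lerD2l lerD2r.
have gu : Num.sqrt (Z1 q ^+ 2 + Z2 q ^+ 2) <= C1 * P k.+1 (hgrad f) q.
  rewrite -(taylor_hgrad q Tu) /=.
  have -> : Pt (k.+1%:R * de) f = heat (k.+1%:R * de) f.
    by apply/funext => y; apply: Pt_heat => //; exact: bf.1.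
  by rewrite (Pt_heat _ k0 bm_hgrad.1); apply: hC1 => //; exact: ltW.
have gv : Num.sqrt (Y1 q ^+ 2 + Y2 q ^+ 2) <= (Num.sqrt (k.+1%:R * de))^-1.
  (* The entropic bound lives at the identity: [g] is translated by [q], which commutes with the
     semigroup. *)
  apply: (gradient_le_inv_sqrt (V0 := v k.+1 q) (g := fun a => g (hmul q a)) (M := M') pk_pos k0).
  - exact: measurable_trans bg.1.
  - by move=> a; exact: g1.
  move=> a; have := taylor_horizontal q a Tv.
  suff -> : Pt (k.+1%:R * de) (fun a => g (hmul q a)) a = P k.+1 g (hmul q a) by [].
  by rewrite /= /Pt; apply: eq_Ex => b; rewrite hmulA.
have -> : 2 * de * C1 / Num.sqrt (k.+1%:R * de) * P k.+1 (hgrad f) q =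
  2 * de * ((C1 * P k.+1 (hgrad f) q) * (Num.sqrt (k.+1%:R * de))^-1) by ring.
rewrite ler_wpM2l//; first by rewrite mulr_ge0// ltW.
by apply: ler_pM => //; exact: sqrtr_ge0.
Qed.

(* [n + 1] steps of length [t / n], so that each gradient term is evaluated at time
   exactly [t]. *)
Let A k : R := P (n.+1 - k) (uv k) x.

Let A_step k : (0 < k <= n)%N -> A k - A k.+1 <= 2 * de * C1 / Num.sqrt (k%:R * de) * H + E.
Proof.
move=> kn; have [_ kn'] := andP kn.
have e : (n.+1 - k = (n - k).+1)%N by rewrite subSn.
rewrite /A subSS e (PkSr pk_pos de0 _ (buv k)).
set kap := 2 * de * C1 / _.
have bh := bm_Pk pk_pos de0 k bm_hgrad.
have b1 := bmD (bmZ kap bh) (bm_cst E).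
rewrite lerBlDl; apply: (le_trans (Pk_le pk_pos de0 _ x (bm_Pt pk_pos de0 (buv k)) (bmD (buv k.+1) b1) (fun q => local_cov q kn))).
apply: (@le_trans _ _ (P (n - k) (uv k.+1) x + (kap * P (n - k) (P k (hgrad f)) x + E))).
  rewrite le_eqVlt; apply/orP; left; apply/eqP.
  apply: etrans; first exact: (PkD pk_pos de0 _ x (buv k.+1) b1).
  congr (_ + _); apply: etrans; first exact: (PkD pk_pos de0 _ x (bmZ kap bh) (bm_cst E)).
  by rewrite (Pk_cst pk_pos de0) (PkZ pk_pos de0 _ kap x bh).
rewrite (Pk_add pk_pos de0 _ _ bm_hgrad) subnK//.
by rewrite Pn.
Qed.

Let A_step0 : A 0 - A 1 <= 4 * de * M' ^+ 2 + E.
Proof.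
rewrite /A subn0 subSS subn0 (PkSr pk_pos de0 _ (buv 0)).
rewrite lerBlDl; apply: (le_trans (Pk_le pk_pos de0 _ x (bm_Pt pk_pos de0 (buv 0)) (bmD (buv 1) (bm_cst _)) local_cov0)).
rewrite le_eqVlt; apply/orP; left; apply/eqP.
apply: etrans; first exact: (PkD pk_pos de0 _ x (buv 1) (bm_cst _)).
by rewrite (Pk_cst pk_pos de0).
Qed.

(** Discrete form of the integral of 1/sqrt s: a^2 - b^2 = 1 and b <= a give 1/a <= 2 (a - b), and
    the sum over j telescopes. *)
Let sqrt_step (j : nat) : (Num.sqrt (j.+1%:R : R))^-1 <= 2 * (Num.sqrt j.+1%:R - Num.sqrt j%:R).
Proof.
set a := Num.sqrt j.+1%:R; set b := Num.sqrt j%:R.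
have a0 : 0 < a by rewrite sqrtr_gt0.
have ab : a ^+ 2 = b ^+ 2 + 1 by rewrite !sqr_sqrtr// -natr1.
rewrite -[leLHS]mul1r ler_pdivrMr//; have := sqr_ge0 (a - b); nra.
Qed.

(** The leading 4 is the 2 of [local_cov] times the 2 of [sqrt_step]. *)
Let A_sum j : (j <= n)%N -> A 0 - A j.+1 <=
  4 * de * M' ^+ 2 + 4 * C1 * H * (Num.sqrt de * Num.sqrt j%:R) + j.+1%:R * E.
Proof.
elim: j => [_|j IH jn]; first by rewrite sqrtr0 !mulr0 addr0 mul1r; exact: A_step0.
have h := IH (ltnW jn); have st := A_step (jn : 0 < j.+1 <= n)%N.
have sd : 0 < Num.sqrt de by rewrite sqrtr_gt0.
have sd2 : de = Num.sqrt de ^+ 2 by rewrite sqr_sqrtr// ltW.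
have sj : Num.sqrt (j.+1%:R : R) != 0 by rewrite lt0r_neq0// sqrtr_gt0.
have e : 2 * de * C1 / Num.sqrt (j.+1%:R * de) * H = 2 * (C1 * H * Num.sqrt de) * (Num.sqrt (j.+1%:R : R))^-1.
  by rewrite sqrtrM// {1}sd2; field; rewrite sj lt0r_neq0.
have c0 : 0 <= 2 * (C1 * H * Num.sqrt de) by rewrite mulr_ge0// mulr_ge0 ?mulr_ge0// ltW.
have := ler_wpM2l c0 (sqrt_step j); rewrite -e => k.
rewrite -[j.+2%:R]natr1 mulrDl mul1r.
move: st k h; move: (A 0) (A j.+1) (A j.+2) (2 * de * C1 / _ * _) => a1 a2 a3 z st k h.
lra.
Qed.

(** The telescoping sum ends at time t + de. Since P_(n+1) F = P_t (P_de F), returning to time t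
    costs no more than one step does. *)
Let Pt_close F (D : R) : bm F -> (forall q, `|Pt de F q - F q| <= D) -> `|P n.+1 F x - Pt t F x| <= D.
Proof.
move=> bF hD; have bP := bm_Pt pk_pos de0 bF.
rewrite (PkSr pk_pos de0 _ bF).
rewrite Pn.
rewrite /Pt -(ExB pk_pos t0 (bm_trans x bP) (bm_trans x bF)).
rewrite -[leRHS](Ex_cst pk_pos t0); apply: (Ex_norm pk_pos t0 _ (adm_cst D)) => [|q]; last exact: hD.
exact: admB (bm_trans x bP) (bm_trans x bF).
Qed.

(** 32 = 16 + 6 + 6 + 4: the return to time t for f g, for g and for f, and the initial step at time
    0. *)
Lemma covariance_steps : Pt t (fun q => f q * g q) x - Pt t f x * Pt t g x <=
  4 * C1 * Num.sqrt t * H + M' ^+ 2 * (6300 * t + 32) * (Num.sqrt de + de).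
Proof.
have Tf' := taylor_weaken MM' Tf; have Tg' := taylor_weaken MM' Tg.
have df q : `|Pt de f q - f q| <= 6 * M' * de := taylor_Pt_sub pk_pos de0 q Tf'.
have dg q : `|Pt de g q - g q| <= 6 * M' * de := taylor_Pt_sub pk_pos de0 q Tg'.
have bfg := bmM bf bg.
(* 16 = 4 + 6 + 6: the scalar product of the gradients, then the drift of each factor. *)
have dfg q : `|Pt de (fun q => f q * g q) q - f q * g q| <= 16 * M' ^+ 2 * de + E.
  have cov := heat_covariance_expansion pk_pos de0 q Tf' Tg'; rewrite -EE in cov.
  have s : `|U1 q * V1 q + U2 q * V2 q| <= 2 * M' ^+ 2.
    apply: le_trans (ler_normD _ _) _; rewrite !normrM.
    have h1 : `|U1 q| * `|V1 q| <= M' * M' by apply: ler_pM => //; [exact: ty_b1 Tf' q|exact: ty_b1 Tg' q].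
    have h2 : `|U2 q| * `|V2 q| <= M' * M' by apply: ler_pM => //; [exact: ty_b2 Tf' q|exact: ty_b2 Tg' q].
    lra.
  have s' : `|2 * de * (U1 q * V1 q + U2 q * V2 q)| <= 4 * M' ^+ 2 * de.
    have d2 : 0 <= 2 * de by rewrite mulr_ge0// ltW.
    by rewrite normrM (ger0_norm d2); have := ler_wpM2l d2 s; lra.
  have bPf : `|Pt de f q| <= M' by exact: (Pt_bnd pk_pos q de0 (ty_m Tf') (ty_b Tf')).
  have p1 : `|Pt de f q * (Pt de g q - g q)| <= M' * (6 * M' * de) by exact: normM_le.
  have p2 : `|(Pt de f q - f q) * g q| <= 6 * M' * de * M'.
    by apply: normM_le => //; exact: ty_b Tg' q.
  have := le_trans (ler_normD _ _) (lerD (le_trans (ler_normD _ _) (lerD (le_trans (ler_normD _ _) (lerD cov s')) p1)) p2).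
  move: (Pt de (fun q => f q * g q) q) (Pt de f q) (Pt de g q) (2 * de * _) => a b c d.
  have -> : a - b * c - d + d + b * (c - g q) + (b - f q) * g q = a - f q * g q by ring.
  by move=> /le_trans; apply; lra.
have cf := Pt_close bf df; have cg := Pt_close bg dg; have cfg := Pt_close bfg dfg.
have S := A_sum (leqnn n).
have A0 : A 0 = P n.+1 (fun q => f q * g q) x by [].
have An : A n.+1 = P n.+1 f x * P n.+1 g x by rewrite /A subnn.
rewrite A0 An in S.
have bf1 : `|P n.+1 f x| <= M'.
  by apply: (Pt_bnd pk_pos x _ (ty_m Tf') (ty_b Tf')); rewrite mulr_gt0.
have bg1 : `|Pt t g x| <= M' by exact: (Pt_bnd pk_pos x t0 (ty_m Tg') (ty_b Tg')).
have m1 : `|P n.+1 f x * (P n.+1 g x - Pt t g x)| <= M' * (6 * M' * de) := normM_le bf1 cg.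
have m2 : `|(P n.+1 f x - Pt t f x) * Pt t g x| <= 6 * M' * de * M' := normM_le cf bg1.
have sq : Num.sqrt de * Num.sqrt n%:R = Num.sqrt t.
  by rewrite -sqrtrM ?(ltW de0)// mulrC nde.
rewrite sq in S.
(* (n + 1) E + E <= 3 n E because n >= 1, and n de = t; this is 6300 = 3 * 2100. *)
have nE : n.+1%:R * E + E <= M' ^+ 2 * (6300 * t) * (Num.sqrt de + de).
  have n1 : 1 <= n%:R :> R by rewrite ler1n.
  apply: le_trans (natr_alg n1 E0) _; rewrite le_eqVlt; apply/orP; left; apply/eqP.
  transitivity (6300 * M' ^+ 2 * (n%:R * de) * (Num.sqrt de + de)); first by rewrite EE; ring.
  by rewrite nde; ring.
have s0 : 0 <= M' ^+ 2 * Num.sqrt de by rewrite mulr_ge0 ?sqr_ge0 ?sqrtr_ge0.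
move: cfg m1 m2; rewrite !ler_norml => /andP[c1 c2] /andP[m1 m1'] /andP[m2 m2'].
rewrite (_ : 4 * C1 * H * Num.sqrt t = 4 * C1 * Num.sqrt t * H) in S; last by ring.
exact: (steps_alg c1 m1' m2' S nE s0).
Qed.

End steps.

Lemma heat_covariance_bound : Pt t (fun q => f q * g q) x - Pt t f x * Pt t g x <=
  4 * C1 * Num.sqrt t * Pt t (hgrad f) x.
Proof.
apply/ler_addgt0Pr => e e0; rewrite -/H.
have [K K0 hK] : exists2 K : R, 0 <= K & forall n de, (0 < n)%N -> 0 < de -> n%:R * de = t ->
    Pt t (fun q => f q * g q) x - Pt t f x * Pt t g x <=
    4 * C1 * Num.sqrt t * H + K * (Num.sqrt de + de).
  exists ((M * (3 + 6 * t)) ^+ 2 * (6300 * t + 32)).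
    apply: mulr_ge0; first exact: sqr_ge0.
    by apply: addr_ge0; [apply: mulr_ge0; [exact: ler0n|exact: ltW]|exact: ler0n].
  by move=> n de n0 de0 nde; exact: (covariance_steps n0 de0 nde erefl erefl).
(* With sqrt de <= r and de <= r^2 <= r the error is at most 2 K r <= e; the + 1 keeps the
   denominator positive. *)
pose r := Num.min 1 (e / (2 * K + 1)).
have D0 : 0 < 2 * K + 1 by lra.
have r0 : 0 < r by rewrite /r lt_min ltr01 divr_gt0.
have r1 : r <= 1 by rewrite /r ge_min lexx.
have re : r <= e / (2 * K + 1) by rewrite /r ge_min lexx orbT.
pose n := (Num.truncn (t / r ^+ 2)).+1.
have hn : t / n%:R <= r ^+ 2.
  rewrite ler_pdivrMr ?ltr0n// mulrC -ler_pdivrMr ?exprn_gt0//.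
  by apply: ltW; rewrite /n; have := truncnS_gt (t / r ^+ 2).
have h := hK n (t / n%:R) isT (divr_gt0 t0 (ltr0Sn R _)) ltac:(by field; rewrite pnatr_eq0).
apply: (le_trans h); rewrite lerD2l.
have sr : Num.sqrt (t / n%:R) <= r.
  by rewrite -[leRHS]ger0_norm ?(ltW r0)// -sqrtr_sqr; apply: ler_wsqrtr.
have r2 : r ^+ 2 <= r by rewrite expr2 ler_piMl// ltW.
have : K * (Num.sqrt (t / n%:R) + t / n%:R) <= K * (2 * r) by rewrite ler_wpM2l//; lra.
move=> /le_trans; apply.
have : (2 * K + 1) * r <= e by rewrite mulrC -ler_pdivlMr.
lra.
Qed.

End covariance_bound.

Theorem theorem6p2 (R : realType) (C1 : R)
    (hC1 : optimal_gradient_constant C1)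
    (t : R) (ht : 0 <= t) (x : heis R)
    (f : heis R -> R) (hf : smooth_compact_support f) :
  heat t (fun y => `|f y - heat t f x|) x
    <= 4 * C1 * Num.sqrt t * heat t (hgrad f) x.
Proof.
move: ht; rewrite le_eqVlt => /predU1P[<-|t0].
  (* At t = 0 [heat] is the identity and both sides are 0. *)
  by rewrite /heat eqxx subrr normr0 sqrtr0 mulr0 mul0r.
have [gb _] := hC1; have pos (s : R) q := @pk_ge0 R C1 gb s q.
have sf := smooth_compact_growth hf.
have [U1 [U2 [U3 [M T]]]] := smooth_compact_taylor hf.
have bf := taylor_bm T; have bh := bm_hgrad T; have mf := bf.1.
set c := heat t f x.
have cE : Pt t f x = c by rewrite (Pt_heat _ t0 mf).
have babs : bm (fun y => `|f y - c|).
  have [ma [B hB]] := bmD bf (bm_cst (- c)); split.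
    exact: (measurableT_comp (@normr_measurable _ setT) ma).
  by exists B => q; rewrite normr_id.
rewrite -(Pt_heat x t0 babs.1) -(Pt_heat x t0 bh.1).
apply/ler_addgt0Pr => e e0.
(* The sign of f - c is regularised at scale [e]. The result need not have compact support, but it
   is bounded by 1 and belongs to [taylor]. *)
have [V1 [V2 [V3 [M' T']]]] := taylor_softsign c e0 T.
set g := fun q => softsign ((f q - c) / e) in T'.
have bg := taylor_bm T'.
have g1 q : `|g q| <= 1 by exact: softsign_le1.
have MM1 : M <= Num.max M M' by rewrite le_max lexx.
have MM2 : M' <= Num.max M M' by rewrite le_max lexx orbT.
have := heat_covariance_bound gb (taylor_weaken MM1 T) (taylor_weaken MM2 T') sf g1 x t0.
rewrite cE => cov.
have a1 := bm_trans x (bmM bf bg); have a2 := bm_trans x bg.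
(* As c = P_t f (x), the covariance at [x] is the mean of (f - c) g. *)
have e1 : Pt t (fun q => f q * g q) x - c * Pt t g x = Pt t (fun q => (f q - c) * g q) x.
  rewrite /Pt -(ExZ pos t0 c a2) -(ExB pos t0 a1 (admZ c a2)); apply: eq_Ex => q; ring.
rewrite e1 in cov; rewrite -lerBlDr; apply: le_trans cov.
rewrite -[e in leLHS](Ex_cst pos t0) /Pt -(ExB pos t0 (bm_trans x babs) (adm_cst e)).
apply: (Ex_le pos t0 (admB (bm_trans x babs) (adm_cst e))).
  by have := bm_trans x (bmM (bmD bf (bm_cst (- c))) bg).
move=> q; set X := f (hmul x q) - c.
(* Multiplied by [e], this reads |X| - e <= X g: replacing the sign by its regularisation costs
   exactly the [e] that was added. *)
have := softsign_abs (X / e); rewrite normrM (gtr0_norm (_ : 0 < e^-1)) ?invr_gt0// => h.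
have := ler_wpM2l (ltW e0) h.
have -> : e * (`|X| / e - 1) = `|X| - e by field; exact: lt0r_neq0.
by have -> : e * (X / e * softsign (X / e)) = X * g (hmul x q) by rewrite /g -/X; field; exact: lt0r_neq0.
Qed.
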